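(* Let $K$ be a field and let $\mathcal{P}$ be a simple polyomino with at most $11$ cells (i.e. of rank at most $11$). Let $h(t)$ be the numerator of the reduced Hilbert–Poincaré series of the coordinate ring $K[\mathcal{P}]$. Then $h(t)=\widetilde{r}_{\mathcal{P}}(t)$, where $\widetilde{r}_{\mathcal{P}}(t)=\sum_{k=0}^{r(\mathcal{P})}|\widetilde{\mathcal{R}}_k|\,t^k$ is the polynomial counting the switching-equivalence classes of sets of $k$ non-attacking rooks on $\mathcal{P}$.
   Context: **Cells and polyominoes.** $\mathbb{N}=\{0,1,2,\dots\}$. For $a=(i,j)$, $b=(k,l)\in\mathbb{N}^2$ with $i<k$, $j<l$, the proper interval $[a,b]$ is $\{(r,s)\in\mathbb{N}^2: i\le r\le k,\ j\le s\le l\}$; its diagonal corners are $a,b$ and its anti-diagonal corners are $(i,l)$ and $(k,j)$. A cell is an interval $C=[a,a+(1,1)]$; $\ell(C)=a$ is its lower left corner, and its vertices are its four corners. A polyomino $\mathcal{P}$ is a nonempty finite collection of cells such that any two cells of $\mathcal{P}$ are joined by a sequence of cells of $\mathcal{P}$ in which consecutive cells share an edge. The rank of $\mathcal{P}$ is its number of cells. $V(\mathcal{P})$ is the set of all vertices of cells of $\mathcal{P}$. $\mathcal{P}$ is simple if any two cells of $\mathbb{N}^2$ not in $\mathcal{P}$ can be joined by a sequence of cells not in $\mathcal{P}$ in which consecutive cells share an edge (roughly: $\mathcal P$ has no holes). A proper interval $[a,b]$ is an inner interval (also called a rectangle) of $\mathcal{P}$ if all cells contained in $[a,b]$ belong to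 $\mathcal{P}$. **Coordinate ring.** Let $S=K[x_v: v\in V(\mathcal{P})]$ (standard graded). The polyomino ideal $I_{\mathcal{P}}$ is generated by all binomials $x_ax_b-x_cx_d$, where $[a,b]$ is an inner interval of $\mathcal{P}$ with anti-diagonal corners $c,d$. Put $K[\mathcal{P}]=S/I_{\mathcal{P}}$. Its Hilbert–Poincaré series $\sum_{k\ge 0}\dim_K K[\mathcal{P}]_k\,t^k$ equals $h(t)/(1-t)^{d}$ with $d$ the Krull dimension of $K[\mathcal{P}]$ and $h(t)\in\mathbb{Z}[t]$; this defines $h(t)$. **Rooks.** A row of cells of $\mathcal{P}$ is a maximal set of consecutive horizontally adjacent cells all belonging to $\mathcal{P}$, and a column of cells of $\mathcal{P}$ is a maximal set of consecutive vertically adjacent cells all belonging to $\mathcal{P}$. Thus two cells lie in the same row (resp. column) of cells of $\mathcal{P}$ exactly when their lower left corners have equal second (resp. first) coordinate and every cell between them in that horizontal (resp. vertical) line also belongs to $\mathcal{P}$; rooks do not attack across cells missing from $\mathcal{P}$. A set of non-attacking rooks on $\mathcal{P}$ is a set of cells of $\mathcal{P}$ no two of which lie in the same row or the same column of cells of $\mathcal{P}$. $\mathcal{R}_k$ is the set of all sets of $k$ non-attacking rooks ($\mathcal{R}_0=\{\varnothing\}$), and the rook number $r(\mathcal{P})$ is the largest $k$ with $\mathcal{R}_k\neq\varnothing$. For a rectangle $[(i,j),(k,l)]$ of $\mathcal{P}$, its diagonal cells are those with lower left corners $(i,j)$ and $(k-1,l-1)$, and its antidiagonal cells are those with lower left corners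 $(i,l-1)$ and $(k-1,j)$. Two non-attacking rooks $R_1,R_2$ are switching rooks if they are the diagonal (resp. antidiagonal) cells of a rectangle of $\mathcal{P}$; if $R_1',R_2'$ are the antidiagonal (resp. diagonal) cells of that rectangle and $R_1,R_2\in F\in\mathcal{R}_k$, replacing $F$ by $(F\setminus\{R_1,R_2\})\cup\{R_1',R_2'\}\in\mathcal{R}_k$ is called a switch. $F_1,F_2\in\mathcal{R}_k$ are equivalent, $F_1\sim F_2$, if $F_2$ is obtained from $F_1$ by finitely many (possibly zero) switches. $\widetilde{\mathcal{R}}_k=\mathcal{R}_k/\sim$. *)

(* Defs.v *)
From HB Require Import structures.
From mathcomp Require Import all_boot all_order all_algebra.
From mathcomp Require Import generic_quotient ring_quotient finmap boolp mpoly.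

Set Implicit Arguments.
Unset Strict Implicit.
Unset Printing Implicit Defensive.

Import GRing.Theory.
Local Open Scope fset_scope.

Notation point := (nat * nat)%type.

(* A cell [a, a + (1,1)] is represented by its lower left corner a. *)
Notation cell := (nat * nat)%type.

Definition cell_vertices (c : cell) : {fset point} :=
  [fset c; (c.1.+1, c.2); (c.1, c.2.+1); (c.1.+1, c.2.+1)].

Definition share_edge (c d : cell) : bool :=
  (c.1 == d.1) && ((d.2 == c.2.+1) || (c.2 == d.2.+1))
  || (c.2 == d.2) && ((d.1 == c.1.+1) || (c.1 == d.1.+1)).

Definition cell_path (A : pred cell) (c d : cell) : Prop :=
  exists s : seq cell, [/\ path share_edge c s, last c s = d & all A (c :: s)].

Definition polyomino (P : {fset cell}) : Prop :=
  P != fset0 /\ {in P &, forall c d, cell_path (mem P) c d}.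

Definition simple (P : {fset cell}) : Prop :=
  forall c d : cell, c \notin P -> d \notin P -> cell_path (predC (mem P)) c d.

Definition vertices (P : {fset cell}) : {fset point} :=
  \bigcup_(c <- P) cell_vertices c.

(* The cells contained in [a, b] have lower left corner (i, j) with
   a.1 <= i < b.1 and a.2 <= j < b.2. *)
Definition inner_interval (P : {fset cell}) (a b : point) : bool :=
  [&& a.1 < b.1, a.2 < b.2 &
    all (fun i => all (fun j => (i, j) \in P) (index_iota a.2 b.2))
        (index_iota a.1 b.1)].

Section NonAttackingRooks.
Variable P : {fset cell}.

Definition same_row (c d : cell) : bool :=
  (c.2 == d.2) &&
  all (fun i => (i, c.2) \in P) (index_iota (minn c.1 d.1) (maxn c.1 d.1).+1).

Definition same_column (c d : cell) : bool :=
  (c.1 == d.1) &&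
  all (fun j => (c.1, j) \in P) (index_iota (minn c.2 d.2) (maxn c.2 d.2).+1).

Definition non_attacking (F : {fset cell}) : bool :=
  all (fun c => all (fun d =>
    (c != d) ==> ~~ same_row c d && ~~ same_column c d) F) F.

Definition rook_sets (k : nat) : {fset {fset cell}} :=
  [fset F in fpowerset P | (#|` F| == k) && non_attacking F].

(* k ranges up to #|` P|, as rook_sets k is empty for larger k. *)
Definition rook_number : nat :=
  \max_(k < #|` P|.+1 | rook_sets k != fset0) k.

Definition diagonal_cells (a b : point) : {fset cell} :=
  [fset a; (b.1.-1, b.2.-1)].

Definition antidiagonal_cells (a b : point) : {fset cell} :=
  [fset (a.1, b.2.-1); (b.1.-1, a.2)].

(* The first condition rules out one-cell rectangles, where both pairs of
   opposite corner cells collapse to a single cell. *)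
Definition exchange (X Y F F' : {fset cell}) : bool :=
  [&& #|` X| == 2, X `<=` F & F' == (F `\` X) `|` Y].

(* The corners of an inner interval of P are always vertices of P. *)
Definition switch (k : nat) (F F' : rook_sets k) : bool :=
  [exists a : vertices P, exists b : vertices P,
    inner_interval P (val a) (val b) &&
    let D := diagonal_cells (val a) (val b) in
    let A := antidiagonal_cells (val a) (val b) in
    exchange D A (val F) (val F') || exchange A D (val F) (val F')].

(* connect is the reflexive transitive closure. *)
Definition rook_classes (k : nat) : {set {set rook_sets k}} :=
  equivalence_partition (connect (@switch k)) [set: rook_sets k].

Definition switching_rook_polynomial : {poly int} :=
  (\sum_(k < rook_number.+1) #|rook_classes k|%:R *: 'X^k)%R.

End NonAttackingRooks.

Local Open Scope ring_scope.

Definition ideal_generated_by (R : comNzRingType) (G : R -> Prop) (p : R) :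
    Prop :=
  exists s : seq (R * R),
    (forall q, q \in s -> G q.2) /\ p = \sum_(q <- s) q.1 * q.2.

Notation vertex_ring K P := {mpoly K[#|{: vertices P}|]}.

Section CoordinateRing.
Variables (K : fieldType) (P : {fset cell}).

Local Notation vertex_ring := (vertex_ring K P).

Definition vertex_var (v : vertices P) : vertex_ring := 'X_(enum_rank v).

Definition inner_binomial (p : vertex_ring) : Prop :=
  exists a b c d : vertices P,
    [/\ inner_interval P (val a) (val b),
        val c = ((val a).1, (val b).2),
        val d = ((val b).1, (val a).2)
      & p = vertex_var a * vertex_var b - vertex_var c * vertex_var d].

Definition polyomino_ideal : {pred vertex_ring} :=
  fun p => `[< ideal_generated_by inner_binomial p >].

Lemma polyomino_ideal_closed : idealr_closed polyomino_ideal.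
Proof.
have meq (p : vertex_ring) :
  inner_binomial p -> p.@[fun=> 0] = 0.
- move=> [a [b [c [d [_ _ _ ->]]]]].
  by rewrite mevalB !mevalM !mevalXU !mulr0 subrr.
split.
- by apply/asboolP; exists [::]; rewrite big_nil.
- apply/negP => /asboolP [s [Gs /(congr1 (meval (fun=> 0)))]] /eqP.
  rewrite meval1 raddf_sum big_seq big1 ?oner_eq0 // => q /Gs /meq q0.
  by rewrite /= mevalM q0 mulr0.
- move=> a p q /asboolP [s [Gs ->]] /asboolP [t [Gt ->]]; apply/asboolP.
  exists ([seq (a * x.1, x.2) | x <- s] ++ t); split.
  + move=> x; rewrite mem_cat => /orP [/mapP [y ys ->]|]; last exact: Gt.
    exact: Gs y ys.
  + rewrite big_cat big_map mulr_sumr /=; congr (_ + _).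
    by apply: eq_bigr => x _; rewrite mulrA.
Qed.

HB.instance Definition _ :=
  isIdealr.Build vertex_ring polyomino_ideal polyomino_ideal_closed.

Definition coordinate_ring := {ideal_quot polyomino_ideal}.

HB.instance Definition _ := GRing.ComNzRing.on coordinate_ring.

Definition residue (p : vertex_ring) : coordinate_ring :=
  (\pi_(coordinate_ring) p)%qT.

Definition coordinate_scale (a : K) (x : coordinate_ring) : coordinate_ring :=
  residue a%:MP * x.

Lemma coordinate_scaleA a b x :
  coordinate_scale a (coordinate_scale b x) = coordinate_scale (a * b) x.
Proof. by rewrite /coordinate_scale mulrA /residue mpolyCM rmorphM. Qed.

Lemma coordinate_scale1 : left_id 1 coordinate_scale.
Proof. by move=> x; rewrite /coordinate_scale /residue rmorph1 mul1r. Qed.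

Lemma coordinate_scaleDr : right_distributive coordinate_scale +%R.
Proof. by move=> a x y; rewrite /coordinate_scale mulrDr. Qed.

Lemma coordinate_scaleDl x : {morph coordinate_scale^~ x : a b / a + b}.
Proof.
by move=> a b; rewrite /coordinate_scale /residue mpolyCD rmorphD mulrDl.
Qed.

HB.instance Definition _ := GRing.Zmodule_isLmodule.Build K coordinate_ring
  coordinate_scaleA coordinate_scale1 coordinate_scaleDr coordinate_scaleDl.

Definition graded_piece (k : nat) (x : coordinate_ring) : Prop :=
  exists2 p : vertex_ring, p \is k.-homog & x = residue p.

End CoordinateRing.

(* W is a K-subspace of V with a basis of m elements. *)
Definition subspace_dim (K : fieldType) (V : lmodType K) (W : V -> Prop)
    (m : nat) : Prop :=
  exists b : 'I_m -> V,
    (forall i, W (b i)) /\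
    (forall x, W x -> exists! c : 'rV[K]_m, x = \sum_(i < m) c 0 i *: b i).

(* Q 0 < ... < Q d is a strictly increasing chain of prime ideals. *)
Definition prime_chain (R : comNzRingType) (d : nat) (Q : nat -> prime_idealr R) :
    Prop :=
  forall i, (i < d)%N ->
    {subset Q i <= Q i.+1} /\ exists2 x, x \in Q i.+1 & x \notin Q i.

Definition krull_dim (R : comNzRingType) (d : nat) : Prop :=
  (exists Q : nat -> prime_idealr R, prime_chain d Q) /\
  (forall e (Q : nat -> prime_idealr R), prime_chain e Q -> (e <= d)%N).

(* h(t) = (1 - t)^d * sum_k HF(k) t^k as formal power series, where HF is the
   Hilbert function and d the Krull dimension of K[P]. *)
Definition hilbert_numerator (K : fieldType) (P : {fset cell}) (h : {poly int}) :
    Prop :=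
  exists (d : nat) (HF : nat -> nat),
    [/\ krull_dim (coordinate_ring K P) d,
        forall k, subspace_dim (@graded_piece K P k) (HF k)
      & forall k,
          h`_k = \sum_(i < k.+1) ((1 - 'X) ^+ d : {poly int})`_i * (HF (k - i)%N)%:Z].

(* Main.v *)
Require Import Defs.
From HB Require Import structures.
From mathcomp Require Import all_boot all_order all_algebra.
From mathcomp Require Import generic_quotient ring_quotient finmap boolp mpoly.
From mathcomp Require Import zify ring.

Set Implicit Arguments.
Unset Strict Implicit.
Unset Printing Implicit Defensive.

Import Order.TTheory GRing.Theory Num.Theory.

(** Both polynomials count the same configurations of entries of a 0/1 matrix.

    Let the rows (columns) be the maximal horizontal (vertical) runs of edges of
    the polyomino. A vertex lies on one row and one column, and the vertices are
    the entries of the matrix. Inner intervals are rectangles of entries; for a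
    simple polyomino the converse holds ([labels_inner]), so the ideal is generated
    by the relations x_a x_b = x_c x_d for all rectangles of entries.

    The geometry of a simple polyomino yields an order of the rows and of the
    columns in which three entries (r, c), (r, c'), (r', c) with r < r' and c < c'
    always come with (r', c') ([no_gamma], [labels_gamma_free]). Each maximal strip
    of cells cuts the plane in two ([cut_exists]). With a root vertex fixed, the
    number of strips that separate a point from the root is a depth, for which the
    rows form a tree under the crossing of strips towards the root, and the columns
    likewise. Rows that come close to the root column are put last, ties being
    broken by the depth.

    Call a multiset of entries normal if it contains no pair (r, c'), (r', c) as
    above with (r, c) an entry. The relations turn any monomial into a normal one,
    since replacing such a pair increases the sum of the products of the labels.
    A normal multiset is determined by its row and column sums ([normal_unique]),
    that is by its image under the parametrization x_v = y_r z_c, which kills the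
    ideal. Hence the normal monomials form a basis ([normal_mons_dim]).

    Let the star consist of the entries that are last neither in their row nor in
    their column. Deleting the first entry gives parallel recursions for the normal
    multisets and for the normal matchings in the star, the sets of entries with at
    most one entry per row and column; so the generating function of the former,
    times a power of 1 - t, is that of the latter ([iter_diff_nmons]). The exponent
    is the Krull dimension: a chain of kernels of the parametrization restricted to
    growing connected sets of rows and columns has this length
    ([toric_prime_chain]), and a longer chain would contain too many algebraically
    independent elements for the growth of the Hilbert function
    ([prime_chain_bound]). So the coefficients of the numerator count the normal
    matchings in the star ([hilbert_numeratorE]).

    Finally the entries of the star are the corners of the cells furthest from the
    root, and two cells lie in the same row of cells exactly when these corners lie
    in the same row of vertices ([cell_labelling]). Placements of non-attacking
    rooks are therefore matchings in the star. A placement that is not normal can be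
    switched, with the same increase of the sum of products, until it is normal;
    switches preserve the rows and columns of the rooks, which determine a normal
    placement. Thus every class contains exactly one normal matching
    ([card_rook_classes]). *)

(** * Finite differences *)

Section Difference.
Local Open Scope ring_scope.

Definition diff (f : nat -> int) (k : nat) : int :=
  if k is k'.+1 then f k - f k' else f 0%N.

Lemma diffB f g : diff (fun k => f k - g k) = fun k => diff f k - diff g k.
Proof. by apply/funext => -[|k] //=; lia. Qed.

Lemma diffD f g : diff (fun k => f k + g k) = fun k => diff f k + diff g k.
Proof. by apply/funext => -[|k] //=; lia. Qed.

Lemma iter_diffD d f g :
  iter d diff (fun k => f k + g k) = fun k => iter d diff f k + iter d diff g k.
Proof. by elim: d => //= d ->; rewrite diffD. Qed.

Lemma iter_diffB d f g :
  iter d diff (fun k => f k - g k) = fun k => iter d diff f k - iter d diff g k.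
Proof. by elim: d => //= d ->; rewrite diffB. Qed.

(** Multiplying a generating function by [1 - t] takes differences of its coefficients. *)
Lemma iter_diffE d f k :
  iter d diff f k = \sum_(i < k.+1) ((1 - 'X) ^+ d : {poly int})`_i * f (k - i)%N.
Proof.
elim: d k => [|d IH] k.
  rewrite big_ord_recl /= expr0 coef1 /= mul1r subn0.
  by rewrite big1 ?addr0 // => i _; rewrite coef1 mul0r.
rewrite iterS exprS.
under eq_bigr => i _ do rewrite mulrBl mul1r coefB coefXM mulrBl.
rewrite sumrB -IH.
case: k => [|k] /=; first by rewrite big_ord_recl big_ord0 /= mul0r !subr0.
rewrite [X in _ = _ - X]big_ord_recl /= mul0r add0r; congr (_ - _).
by rewrite IH; apply: eq_bigr => i _; rewrite /bump /= subSS.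
Qed.

End Difference.

(** * Normal forms for multisets of entries of a 0/1 matrix *)

Section Matrix.
Variables (n : nat) (rw cl : 'I_n -> nat).
Hypothesis rwcl_inj : forall i j, rw i = rw j -> cl i = cl j -> i = j.
Implicit Types (E B S : {set 'I_n}) (a b e f : 'I_n) (m : 'X_{1..n}).

(** Two entries at antidiagonal corners of a rectangle, rows being drawn downwards,
    whose top left corner is an entry as well. The quadratic relation
    of the rectangle replaces them by the two other corners. *)
Definition inversion E a b :=
  [exists e in E, [&& rw e == rw a, cl e == cl b, rw a < rw b & cl b < cl a]].

Definition normal E S := [forall a in S, forall b in S, ~~ inversion E a b].

(** The three entries [e], [a], [b] draw a letter Gamma. Requiring the fourth
    corner makes every inversion the antidiagonal of a full rectangle; bipartite
    graphs that admit such orders of rows and columns are the chordal bipartite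
    ones. *)
Definition gamma_free E := forall e a b, e \in E -> a \in E -> b \in E ->
  rw e = rw a -> cl e = cl b -> rw e < rw b -> cl e < cl a ->
  exists2 f, f \in E & rw f = rw b /\ cl f = cl a.

(** For a rectangular matrix of vertices, [star] is the matrix of the cells, each
    represented by its corner with the smallest labels. *)
Definition star E := [set e in E |
  [exists a in E, (rw a == rw e) && (cl e < cl a)] &&
  [exists b in E, (cl b == cl e) && (rw e < rw b)]].

Definition first E e := e \in E /\
  forall a, a \in E -> rw e <= rw a /\ (rw a = rw e -> cl e <= cl a).

(** Closed under the crossings, in [E], of a row and a column of [B], so that two
    entries of [B] are inverted in [B] if they are in [E]. *)
Definition induced B E := B \subset E /\ forall e a b, e \in E -> a \in B ->
  b \in B -> rw e = rw a -> cl e = cl b -> e \in B.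

Definition normal_in E S := (S \subset E) && normal E S.

Lemma inversionP E a b :
  reflect (exists2 e, e \in E &
    [/\ rw e = rw a, cl e = cl b, rw a < rw b & cl b < cl a])
    (inversion E a b).
Proof.
apply: (iffP existsP) => [[e /and5P[eE /eqP ? /eqP ? ? ?]]|[e eE [ra cb ? ?]]].
  by exists e.
by exists e; rewrite eE ra cb !eqxx /=; apply/andP.
Qed.

Lemma normalP E S :
  reflect (forall a b, a \in S -> b \in S -> ~~ inversion E a b) (normal E S).
Proof.
apply: (iffP forall_inP) => [H a b aS bS|H a aS].
  by move/forall_inP: (H a aS); apply.
by apply/forall_inP => b bS; apply: H.
Qed.

Lemma normal_subset E S S' : S' \subset S -> normal E S -> normal E S'.
Proof.
by move=> /subsetP sub /normalP H; apply/normalP => a b /sub aS /sub; apply: H.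
Qed.

Lemma normal_induced B E S :
  induced B E -> S \subset B -> normal E S = normal B S.
Proof.
move=> [/subsetP BE ind] /subsetP SB; apply/normalP/normalP => H a b aS bS;
  apply/negP => /inversionP[e eE [ra cb lt1 lt2]]; move: (H a b aS bS);
  move/negP; apply; apply/inversionP; exists e => //.
  exact: BE.
by apply: (ind e a b) => //; apply: SB.
Qed.

Lemma gamma_free_induced B E : induced B E -> gamma_free E -> gamma_free B.
Proof.
move=> [/subsetP BE ind] gE e a b eB aB bB ra cb lt1 lt2.
have [f fE [rf cf]] := gE e a b (BE _ eB) (BE _ aB) (BE _ bB) ra cb lt1 lt2.
by exists f => //; apply: (ind f b a).
Qed.

Lemma first_exists E : E != set0 -> exists e, first E e.
Proof.
move=> /set0Pn[i0 i0E].
case: (arg_minnP rw i0E) => i iE mini.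
have Pi : (i \in E) && (rw i == rw i) by rewrite (iE : i \in E) eqxx.
case: (@arg_minnP _ i (fun j => (j \in E) && (rw j == rw i)) cl Pi).
move=> e /andP[eE /eqP re] mine.
exists e; split=> // a aE; rewrite re; split; first exact: mini.
by move=> ra; apply: mine; rewrite aE ra eqxx.
Qed.

Definition without_row E e := [set a in E | rw a != rw e].
Definition without_col E e := [set a in E | cl a != cl e].
Definition without_cross E e := without_row E e :&: without_col E e.

Lemma in_without_row E e a : (a \in without_row E e) = (a \in E) && (rw a != rw e).
Proof. by rewrite inE. Qed.

Lemma in_without_col E e a : (a \in without_col E e) = (a \in E) && (cl a != cl e).
Proof. by rewrite inE. Qed.

Lemma in_without_cross E e a :
  (a \in without_cross E e) = [&& a \in E, rw a != rw e & cl a != cl e].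
Proof. by rewrite inE in_without_row in_without_col; case: (a \in E). Qed.

Lemma induced_without_row E e : induced (without_row E e) E.
Proof.
split; first by apply/subsetP => a; rewrite inE => /andP[].
move=> f a b fE; rewrite !inE => /andP[_ ra] _ rf _.
by rewrite fE rf.
Qed.

Lemma induced_without_col E e : induced (without_col E e) E.
Proof.
split; first by apply/subsetP => a; rewrite inE => /andP[].
move=> f a b fE _; rewrite !inE => /andP[_ cb] _ cf.
by rewrite fE cf.
Qed.

Lemma induced_without_cross E e : induced (without_cross E e) E.
Proof.
split; first by apply/subsetP => a; rewrite !inE => /andP[/andP[]].
move=> f a b fE; rewrite !inE => /andP[/andP[_ ra] _] /andP[_ /andP[_ cb]] rf cf.
by rewrite fE rf cf ra cb.
Qed.

(** An entry of the row of [e] and one of its column are inverted through the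
    first entry [e], so that a normal set that avoids [e] misses its row or its
    column. *)
Lemma normal_in_without E e S : first E e -> e \notin S ->
  normal_in E S = normal_in (without_row E e) S || normal_in (without_col E e) S.
Proof.
move=> [eE fe] eS; apply/idP/orP => [/andP[/subsetP SE nS]|].
- case: (boolP [exists a in S, rw a == rw e]) => [/existsP[a /andP[aS /eqP ra]]|/existsPn H].
  + right.
    have SB : S \subset without_col E e.
      apply/subsetP => b bS; rewrite inE SE //=; apply/eqP => cb.
      move/normalP: nS => /(_ a b aS bS) /inversionP; apply; exists e => //.
      have [ra' ca'] := fe a (SE _ aS); have [rb' cb'] := fe b (SE _ bS).
      split=> //.
        rewrite ltn_neqAle ra rb' andbT; apply: contra eS => /eqP rb.
        by rewrite (rwcl_inj rb (esym cb)).
      rewrite cb ltn_neqAle (ca' ra) andbT; apply: contra eS => /eqP ca.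
      by rewrite (rwcl_inj (esym ra) ca).
    by rewrite /normal_in SB -(normal_induced (induced_without_col E e)).
  + left.
    have SB : S \subset without_row E e.
      apply/subsetP => b bS; rewrite inE SE //=; move: (H b).
      by rewrite bS.
    by rewrite /normal_in SB -(normal_induced (induced_without_row E e)).
- case=> /andP[SB nS]; apply/andP; split.
  + by apply: subset_trans SB _; apply: (induced_without_row E e).1.
  + by rewrite (normal_induced (induced_without_row E e)).
  + by apply: subset_trans SB _; apply: (induced_without_col E e).1.
  + by rewrite (normal_induced (induced_without_col E e)).
Qed.

Lemma normal_in_without_cross E e S :
  normal_in (without_row E e) S && normal_in (without_col E e) S =
  normal_in (without_cross E e) S.
Proof.
rewrite /normal_in subsetI.
case SR: (S \subset without_row E e) => //=.
case SC: (S \subset without_col E e) => /=; last by rewrite andbF.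
have SX : S \subset without_cross E e by rewrite subsetI SR.
rewrite -(normal_induced (induced_without_row E e)) //.
rewrite -(normal_induced (induced_without_col E e)) //.
by rewrite -(normal_induced (induced_without_cross E e)) // andbb.
Qed.

(** No entry lies before the first one, which is thus never a member of an inversion. *)
Lemma normal_in_setU1 E e S : first E e -> normal_in E (e |: S) = normal_in E S.
Proof.
move=> [eE fe]; rewrite /normal_in subUset sub1set eE /=.
case SE: (S \subset E) => //=; move/subsetP: SE => SE.
apply/idP/idP; first by apply: normal_subset; apply: subsetUr.
move/normalP => H; apply/normalP => a b; rewrite !inE.
move=> /predU1P[->|aS] /predU1P[->|bS]; last exact: H.
- by apply/inversionP => -[f _ [_ _]]; rewrite ltnn.
- apply/inversionP => -[f fE [rf cf _]]; rewrite -cf ltnNge.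
  by rewrite (fe f fE).2.
- apply/inversionP => -[f _ [_ _]]; rewrite ltnNge.
  by rewrite (fe a (SE _ aS)).1.
Qed.

(** ** Counting normal multisets *)

Definition supp m : {set 'I_n} := [set i | 0 < m i].

Definition normal_mons E k : {fset 'X_{1..n}} :=
  [fset bmnm m | m in [pred m : 'X_{1..n < k.+1} |
     (mdeg m == k) && normal_in E (supp m)]]%fset.

Lemma in_normal_mons E k m :
  (m \in normal_mons E k) = (mdeg m == k) && normal_in E (supp m).
Proof.
apply/imfsetP/idP => [[m' /=] + -> //|/andP[/eqP dm sm]].
have lt : mdeg m < k.+1 by rewrite dm.
by exists (BMultinom lt) => //; apply/andP; rewrite /= dm eqxx.
Qed.

Lemma suppDU m e : supp (U_(e) + m)%MM = e |: supp m.
Proof.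
apply/setP => i; rewrite !inE mnmDE mnm1E eq_sym; by case: eqP.
Qed.

(** Multiplication by the first entry creates no inversion: the normal monomials
    divisible by it correspond to all those of one degree less. *)
Lemma card_normal_mons_split E e k : first E e ->
  #|` normal_mons E k.+1| = #|` normal_mons E k| +
     #|` [fset m in normal_mons E k.+1 | e \notin supp m]%fset|.
Proof.
move=> fe; set A := normal_mons E k.+1.
rewrite -(cardfsID [fset m in A | e \notin supp m]%fset A) addnC; congr (_ + _).
  have inj : injective (fun m => (U_(e) + m)%MM : 'X_{1..n}).
    by move=> m m' /mnmP H; apply/mnmP => i; move: (H i); rewrite !mnmDE; lia.
  transitivity #|` [fset (U_(e) + m)%MM | m in normal_mons E k]%fset|; last first.
    by rewrite card_imfset.
  congr #|` _|; apply/fsetP => m; rewrite !inE /=; apply/idP/imfsetP.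
    case/andP; rewrite negb_and negbK => em mA; move: em; rewrite mA /= => em.
    have le : (U_(e) <= m)%MM.
      by apply/mnm_lepP => i; rewrite mnm1E; case: eqP => [<-|].
    exists (m - U_(e))%MM; last by rewrite addmC submK.
    move: mA; rewrite !in_normal_mons.
    rewrite -{1 2}(submK le) addmC mdegD mdeg1 suppDU normal_in_setU1 //.
  case=> m' /=; rewrite in_normal_mons => /andP[/eqP d s] ->.
  have mA : (U_(e) + m')%MM \in A.
    by rewrite in_normal_mons suppDU normal_in_setU1 // s mdegD mdeg1 d eqxx.
  by rewrite mA andbT negb_and negbK mnmDE mnm1E eqxx orbT.
by congr #|` _|; apply/fsetP => m; rewrite !inE /= andbA andbb.
Qed.

(** Inclusion and exclusion in the dichotomy of [normal_in_without]. *)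
Lemma card_normal_mons_notin E e k : first E e ->
  #|` [fset m in normal_mons E k | e \notin supp m]%fset| +
  #|` normal_mons (without_cross E e) k| =
  #|` normal_mons (without_row E e) k| + #|` normal_mons (without_col E e) k|.
Proof.
move=> fe.
rewrite -(cardfsUI (normal_mons (without_row E e) k) (normal_mons (without_col E e) k)).
congr (_ + _); congr #|` _|; apply/fsetP => m; rewrite !inE !in_normal_mons /=.
  have -> : (0 < m e) = (e \in supp m) by rewrite inE.
  case: (mdeg m == k) => //=.
  case: (boolP (e \in supp m)) => em /=; last by rewrite andbT -normal_in_without.
  rewrite andbF; apply/esym/negbTE; rewrite negb_or.
  by apply/andP; split; apply/negP => /andP[/subsetP/(_ _ em)];
    rewrite inE eqxx andbF.
by rewrite -normal_in_without_cross; case: (mdeg m == k); rewrite ?andbT.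
Qed.

Definition nmons E k : int := (#|` normal_mons E k|%:Z)%R.

Lemma supp0 : supp 0%MM = set0.
Proof. by apply/setP => i; rewrite !inE mnm0E. Qed.

Lemma normal_mons0 E : #|` normal_mons E 0| = 1.
Proof.
suff -> : normal_mons E 0 = [fset 0%MM]%fset by rewrite cardfs1.
apply/fsetP => m; rewrite in_normal_mons in_fset1 mdeg_eq0.
apply/idP/idP => [/andP[]//|/eqP->]; rewrite eqxx supp0 /= /normal_in sub0set.
by apply/normalP => a b; rewrite inE.
Qed.

Lemma diff_nmons E e : first E e ->
  diff (nmons E) = (fun k => nmons (without_row E e) k +
    nmons (without_col E e) k - nmons (without_cross E e) k)%R.
Proof.
move=> fe; apply/funext => -[|k] /=; first by rewrite /nmons !normal_mons0.
have := card_normal_mons_split k fe; have := card_normal_mons_notin k.+1 fe.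
rewrite /nmons; lia.
Qed.

(** ** Counting normal matchings *)

Definition matching S := [forall a in S, forall b in S,
  (rw a == rw b) || (cl a == cl b) ==> (a == b)].

Lemma matchingP S : reflect (forall a b, a \in S -> b \in S ->
  rw a = rw b \/ cl a = cl b -> a = b) (matching S).
Proof.
apply: (iffP forall_inP) => [H a b aS bS ab|H a aS].
  move/forall_inP: (H a aS) => /(_ b bS) /implyP H1; apply/eqP/H1.
  by apply/orP; case: ab => /eqP; [left|right].
apply/forall_inP => b bS; apply/implyP => /orP ab; apply/eqP/H => //.
by case: ab => /eqP; [left|right].
Qed.

Definition normal_matchings B k : {set {set 'I_n}} :=
  [set S : {set 'I_n} | [&& #|S| == k, matching S & normal_in B S]].

Lemma normal_matchings0 B : #|normal_matchings B 0| = 1.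
Proof.
suff -> : normal_matchings B 0 = [set set0] by rewrite cards1.
apply/setP => S; rewrite !inE cards_eq0; case: eqP => //= ->.
rewrite /normal_in sub0set /=.
by apply/andP; split; [apply/matchingP|apply/normalP] => a b; rewrite inE.
Qed.

Lemma sub_without_cross B e S : e \in B ->
  (S \subset without_cross B e) =
  [&& S \subset B, [forall a in S, rw a != rw e] & [forall a in S, cl a != cl e]].
Proof.
move=> eB; apply/subsetP/and3P => [H|[/subsetP SB /forall_inP H1 /forall_inP H2] a aS].
  split; [apply/subsetP => a aS|apply/forall_inP => a aS|apply/forall_inP => a aS];
  by move: (H a aS); rewrite !inE => /andP[/andP[? ?] /andP[_ ?]].
by rewrite !inE SB //= H1 // H2.
Qed.

(** A matching through [e] has no other entry in the row and the column of [e]. *)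
Lemma matching_setU1 B e S : first B e -> e \notin S ->
  matching (e |: S) && normal_in B (e |: S) =
  matching S && normal_in (without_cross B e) S.
Proof.
move=> fe eS; rewrite normal_in_setU1 //; have eB := fe.1.
apply/andP/andP => -[mS sS].
  move/matchingP: mS => mS; have [/[dup] SB /subsetP SB' nS] := andP sS.
  have sub : S \subset without_cross B e.
    rewrite sub_without_cross // SB /=; apply/andP; split; apply/forall_inP => a aS;
    apply: contra eS => /eqP E.
      by rewrite -(mS a e _ _ (or_introl E)) ?setU11 // setU1r.
    by rewrite -(mS a e _ _ (or_intror E)) ?setU11 // setU1r.
  split; first by apply/matchingP => a b aS bS; apply: mS; rewrite setU1r.
  by rewrite /normal_in sub -(normal_induced (induced_without_cross B e)).
have [sub nS] := andP sS; rewrite -(normal_induced (induced_without_cross B e)) // in nS.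
move: (sub); rewrite sub_without_cross // => /and3P[SB /forall_inP H1 /forall_inP H2].
split; last by rewrite /normal_in SB.
move/matchingP: mS => mS; apply/matchingP => a b; rewrite !inE.
move=> /predU1P[->|aS] /predU1P[->|bS] //; last exact: mS.
- by case=> E; [move: (H1 b bS)|move: (H2 b bS)]; rewrite E eqxx.
- by case=> E; [move: (H1 a aS)|move: (H2 a aS)]; rewrite E eqxx.
Qed.

Lemma card_normal_matchings_split B e k : first B e ->
  #|normal_matchings B k.+1| = #|normal_matchings (without_cross B e) k| +
     #|[set S in normal_matchings B k.+1 | e \notin S]|.
Proof.
move=> fe; set A := normal_matchings B k.+1.
rewrite -(cardsID [set S in A | e \notin S] A) addnC; congr (_ + _).
  transitivity #|[set e |: S | S in normal_matchings (without_cross B e) k]|; last first.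
    apply: card_in_imset => S S'; rewrite !inE.
    move=> /and3P[_ _ /andP[SB _]] /and3P[_ _ /andP[SB' _]] H.
    have eS : e \notin S by apply/negP => /(subsetP SB); rewrite !inE eqxx andbF.
    have eS' : e \notin S' by apply/negP => /(subsetP SB'); rewrite !inE eqxx andbF.
    by rewrite -(setU1K eS) H setU1K.
  apply: eq_card => S; rewrite inE; apply/idP/imsetP.
    rewrite [in X in ~~ X]inE => /andP[]; rewrite negb_and negbK => eS SA.
    move: eS; rewrite SA /= => eS; exists (S :\ e); last by rewrite setD1K.
    move: SA; rewrite !inE -{1 2 3}(setD1K eS) cardsU1 setD11 /= add1n eqSS.
    by move=> /andP[-> H] /=; rewrite -matching_setU1 // setD11.
  case=> S'; rewrite !inE => /and3P[cS' mS' sS'] ->.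
  have eS' : e \notin S'.
    by case/andP: sS' => SB' _; apply/negP => /(subsetP SB'); rewrite !inE eqxx andbF.
  by rewrite cardsU1 eS' eqSS cS' /= matching_setU1 // mS' sS' setU11.
by congr #|pred_of_set _|; apply/setP => S; rewrite !in_setI !in_set andbA andbb.
Qed.

Lemma card_normal_matchings_notin B e k : first B e ->
  #|[set S in normal_matchings B k | e \notin S]| +
  #|normal_matchings (without_cross B e) k| =
  #|normal_matchings (without_row B e) k| + #|normal_matchings (without_col B e) k|.
Proof.
move=> fe; rewrite -(cardsUI (normal_matchings (without_row B e) k)).
congr (_ + _); apply: eq_card => S; rewrite !inE.
  case: (_ == k) => //=; case: (matching S) => //=.
  case: (boolP (e \in S)) => eS /=; last by rewrite andbT -normal_in_without.
  rewrite andbF; apply/esym/negbTE; rewrite negb_or.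
  by apply/andP; split; apply/negP => /andP[/subsetP/(_ _ eS)];
    rewrite inE eqxx andbF.
by rewrite -normal_in_without_cross; case: (_ == k); case: (matching S); rewrite ?andbT.
Qed.

Definition nmatchings B k : int := (#|normal_matchings B k|%:Z)%R.

(** The matchings through [e] are those of the cross with one entry less. This
    shift accounts for the difference, taken here on the term of the cross and in
    [diff_nmons] on the left hand side. *)
Lemma nmatchings_first B e : first B e ->
  nmatchings B = (fun k => nmatchings (without_row B e) k +
    nmatchings (without_col B e) k - diff (nmatchings (without_cross B e)) k)%R.
Proof.
move=> fe; apply/funext => -[|k] /=; first by rewrite /nmatchings !normal_matchings0.
have := card_normal_matchings_split k fe; have := card_normal_matchings_notin k.+1 fe.
rewrite /nmatchings; lia.
Qed.

(** ** Deleting the first entry *)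

Lemma starP E e : reflect [/\ e \in E,
    exists a, [/\ a \in E, rw a = rw e & cl e < cl a] &
    exists b, [/\ b \in E, cl b = cl e & rw e < rw b]] (e \in star E).
Proof.
rewrite inE; apply: (iffP and3P) => -[eE].
  move=> /existsP[a /and3P[aE /eqP ra ca]] /existsP[b /and3P[bE /eqP cb rb]].
  by split=> //; [exists a|exists b].
move=> [a [aE ra ca]] [b [bE cb rb]]; split=> //.
  by apply/existsP; exists a; rewrite aE ra eqxx.
by apply/existsP; exists b; rewrite bE cb eqxx.
Qed.

Lemma star_sub E : star E \subset E.
Proof. by apply/subsetP => e /starP[]. Qed.

Lemma first_star E e : first E e -> e \in star E -> first (star E) e.
Proof. by move=> [_ fe] eS; split=> // a /starP[aE _ _]; apply: fe. Qed.

Section Removal.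
Variables (E : {set 'I_n}) (e : 'I_n).
Hypotheses (gE : gamma_free E) (fe : first E e).

Lemma first_lt_row a : a \in E -> cl a = cl e -> a != e -> rw e < rw a.
Proof.
move=> aE ca ne; have [le _] := fe.2 a aE; rewrite ltn_neqAle le andbT.
by apply: contra ne => /eqP r; rewrite (rwcl_inj (esym r) ca).
Qed.

Lemma first_lt_col a : a \in E -> rw a = rw e -> a != e -> cl e < cl a.
Proof.
move=> aE ra ne; have [_ /(_ ra) le] := fe.2 a aE; rewrite ltn_neqAle le andbT.
by apply: contra ne => /eqP c; rewrite (rwcl_inj ra (esym c)).
Qed.

Section Inner.
Hypothesis (eS : e \in star E).

(** The row of the first entry contains no entry that comes later in a column. *)
Lemma star_without_row : star (without_row E e) = without_row (star E) e.
Proof.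
apply/setP => f; rewrite in_without_row; apply/starP/andP.
  move=> [+ [a [+ ra ca]] [b [+ cb rb]]]; rewrite !in_without_row.
  move=> /andP[fE nf] /andP[aE na] /andP[bE nb]; split=> //.
  by apply/starP; split=> //; [exists a|exists b].
move=> [/starP[fE [a [aE ra ca]] [b [bE cb rb]]] nf].
split; rewrite ?in_without_row ?fE //.
  by exists a; rewrite in_without_row aE ra.
exists b; rewrite in_without_row bE cb; split=> //=.
by have [+ _] := fe.2 f fE; move: nf rb; lia.
Qed.

(** The column of [e] need not precede the others, so it may contain the entry
    that puts some [f] in [star E]; the fourth corner of a Gamma at [e] then
    replaces that entry. *)
Lemma star_without_col : star (without_col E e) = without_col (star E) e.
Proof.
apply/setP => f; rewrite in_without_col; apply/starP/andP.
  move=> [+ [a [+ ra ca]] [b [+ cb rb]]]; rewrite !in_without_col.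
  move=> /andP[fE nf] /andP[aE na] /andP[bE nb]; split=> //.
  by apply/starP; split=> //; [exists a|exists b].
move=> [/starP[fE [a [aE ra ca]] [b [bE cb rb]]] nf].
split; rewrite ?in_without_col ?fE //; last by exists b; rewrite in_without_col bE cb.
have [ca'|ca'] := eqVneq (cl a) (cl e); last first.
  by exists a; rewrite in_without_col aE ra.
have [_ [a0 [a0E ra0 ca0]] _] := starP _ _ eS.
have ne : a != e by apply: contra nf => /eqP E0; have := (fe.2 f fE).2; rewrite -E0 -ra; lia.
have [g gE' [rg cg]] := gE fe.1 a0E aE (esym ra0) (esym ca') (first_lt_row aE ca' ne) ca0.
exists g; rewrite in_without_col gE' /= cg; split; lia.
Qed.

Lemma star_without_cross : star (without_cross E e) = without_cross (star E) e.
Proof.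
apply/setP => f; rewrite in_without_cross; apply/starP/and3P.
  move=> [+ [a [+ ra ca]] [b [+ cb rb]]]; rewrite !in_without_cross.
  move=> /and3P[fE nf nf'] /and3P[aE _ _] /and3P[bE _ _]; split=> //.
  by apply/starP; split=> //; [exists a|exists b].
move=> [fS nf nf'].
have fR : f \in star (without_row E e) by rewrite star_without_row in_without_row fS.
have fC : f \in star (without_col E e) by rewrite star_without_col in_without_col fS.
have [fE _ _] := starP _ _ fS.
have [_ [a [aE ra ca]] _] := starP _ _ fC; have [_ _ [b [bE cb rb]]] := starP _ _ fR.
move: aE bE; rewrite in_without_row in_without_col => /andP[aE na] /andP[bE nb].
rewrite in_without_cross fE nf nf'; split=> //.
  by exists a; rewrite in_without_cross aE na ra nf.
by exists b; rewrite in_without_cross bE nb cb nf'.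
Qed.

(** Of the row of [e] only the last entry is outside the star: the others have a later
    entry in their column, the fourth corner of a Gamma formed by [e] and an entry
    below [e]. *)
Lemma card_row_star : #|[set a in E | rw a == rw e]| =
  #|[set a in star E | rw a == rw e]|.+1.
Proof.
have eR : (e \in E) && (rw e == rw e) by rewrite fe.1 eqxx.
case: (@arg_maxnP _ e (fun a => (a \in E) && (rw a == rw e)) cl eR) => l /andP[lE /eqP rl] maxl.
have {}maxl a : a \in E -> rw a = rw e -> cl a <= cl l.
  by move=> aE ra; apply: maxl; rewrite aE ra eqxx.
have lR : l \in [set a in E | rw a == rw e] by rewrite inE lE rl eqxx.
rewrite (cardsD1 l) lR add1n; congr _.+1; apply: eq_card => a.
rewrite in_setD1 [in LHS]in_set [in RHS]in_set.
case: eqP => [->|/eqP al] /=.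
  apply/esym/negbTE; rewrite negb_and; apply/orP; left; rewrite -[X in ~~ X]/(l \in star E).
  apply/starP => -[_ [b [bE rb cb]] _]; move: (maxl b bE); lia.
case ra: (rw a == rw e); rewrite ?andbF // !andbT; move/eqP: ra => ra.
apply/idP/idP => [aE|/starP[]//]; apply/starP; split=> //.
  exists l; rewrite rl ra; split=> //; have le := maxl a aE ra.
  by rewrite ltn_neqAle le andbT; apply: contra al => /eqP c; rewrite (rwcl_inj (etrans ra (esym rl)) c).
have [_ _ [b [bE cb rb]]] := starP _ _ eS.
have [->|ne] := eqVneq a e; first by exists b.
have [g gE' [rg cg]] := gE fe.1 aE bE (esym ra) (esym cb) rb (first_lt_col aE ra ne).
by exists g; rewrite rg cg ra.
Qed.

Lemma card_col_star : #|[set a in E | cl a == cl e]| =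
  #|[set a in star E | cl a == cl e]|.+1.
Proof.
have eR : (e \in E) && (cl e == cl e) by rewrite fe.1 eqxx.
case: (@arg_maxnP _ e (fun a => (a \in E) && (cl a == cl e)) rw eR) => l /andP[lE /eqP cl_l] maxl.
have {}maxl a : a \in E -> cl a = cl e -> rw a <= rw l.
  by move=> aE ra; apply: maxl; rewrite aE ra eqxx.
have lR : l \in [set a in E | cl a == cl e] by rewrite inE lE cl_l eqxx.
rewrite (cardsD1 l) lR add1n; congr _.+1; apply: eq_card => a.
rewrite in_setD1 [in LHS]in_set [in RHS]in_set.
case: eqP => [->|/eqP al] /=.
  apply/esym/negbTE; rewrite negb_and; apply/orP; left; rewrite -[X in ~~ X]/(l \in star E).
  apply/starP => -[_ _ [b [bE cb rb]]]; move: (maxl b bE); lia.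
case ca: (cl a == cl e); rewrite ?andbF // !andbT; move/eqP: ca => ca.
apply/idP/idP => [aE|/starP[]//]; apply/starP; split=> //; last first.
  exists l; rewrite cl_l ca; split=> //; have le := maxl a aE ca.
  by rewrite ltn_neqAle le andbT; apply: contra al => /eqP r; rewrite (rwcl_inj r (etrans ca (esym cl_l))).
have [_ [b [bE rb cb]] _] := starP _ _ eS.
have [->|ne] := eqVneq a e; first by exists b.
have [g gE' [rg cg]] := gE fe.1 bE aE (esym rb) (esym ca) (first_lt_row aE ca ne) cb.
by exists g; rewrite rg cg ca.
Qed.

End Inner.

Lemma card_without_row B : #|B| = #|[set a in B | rw a == rw e]| + #|without_row B e|.
Proof.
rewrite -(cardsID [set a | rw a == rw e] B); congr (_ + _); apply: eq_card => a;
  by rewrite !inE // andbC.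
Qed.

Lemma card_without_col B : #|B| = #|[set a in B | cl a == cl e]| + #|without_col B e|.
Proof.
rewrite -(cardsID [set a | cl a == cl e] B); congr (_ + _); apply: eq_card => a;
  by rewrite !inE // andbC.
Qed.

Lemma card_without_cross B : e \in B ->
  #|B|.+1 = #|[set a in B | rw a == rw e]| + #|[set a in B | cl a == cl e]|
            + #|without_cross B e|.
Proof.
move=> eB; rewrite -cardsUI addnAC.
have -> : #|[set a in B | rw a == rw e] :&: [set a in B | cl a == cl e]| = 1.
  rewrite -(cards1 e); apply: eq_card => a; rewrite !inE; apply/idP/eqP => [|->].
    by move=> /andP[/andP[_ /eqP r] /andP[_ /eqP c]]; apply: rwcl_inj.
  by rewrite eB !eqxx.
rewrite addn1; congr _.+1.
rewrite -(cardsID [set a | (rw a == rw e) || (cl a == cl e)] B); congr (_ + _);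
  apply: eq_card => a; rewrite !inE.
  by rewrite -andb_orr.
by rewrite negb_or; case: (a \in B); rewrite ?andbF ?andbT.
Qed.

End Removal.

(** Nothing precedes [e] in its row or in its column, so not being in the star
    means that nothing follows it in one of them. *)
Lemma star_sub_lone E e : first E e -> e \notin star E ->
  without_row E e = E :\ e \/ without_col E e = E :\ e.
Proof.
move=> fe; have [eE _] := fe; rewrite inE eE /= negb_and => /orP[]/existsPn H; [left|right].
  apply/setP => a; rewrite !inE andbC; case aE: (a \in E); rewrite ?andbF // !andbT.
  apply/idP/idP; first by apply: contra => /eqP ->.
  apply: contra => /eqP ra; apply: contraT => ne; move: (H a).
  by rewrite aE ra eqxx (first_lt_col fe).
apply/setP => a; rewrite !inE andbC; case aE: (a \in E); rewrite ?andbF // !andbT.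
apply/idP/idP; first by apply: contra => /eqP ->.
apply: contra => /eqP ca; apply: contraT => ne; move: (H a).
by rewrite aE ca eqxx (first_lt_row fe).
Qed.

Lemma star_setD1 E e : first E e -> e \notin star E -> star (E :\ e) = star E.
Proof.
move=> fe eS; apply/setP => f; apply/starP/starP.
  move=> [+ [a [+ ra ca]] [b [+ cb rb]]]; rewrite !inE.
  move=> /andP[_ fE] /andP[_ aE] /andP[_ bE].
  by split=> //; [exists a|exists b].
move=> [fE [a [aE ra ca]] [b [bE cb rb]]].
have fne : f != e.
  by apply: contra eS => /eqP <-; apply/starP; split=> //; [exists a|exists b].
split; first by rewrite !inE fne.
  exists a; rewrite !inE aE andbT; split=> //; apply/eqP => E0; subst a.
  by have := (fe.2 f fE).2 (esym ra); lia.
exists b; rewrite !inE bE andbT; split=> //; apply/eqP => E0; subst b.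
by have := (fe.2 f fE).1; lia.
Qed.

(** Induction on [E], deleting the first entry [e]. If [e] is in the star,
    removing its row, its column or both lowers [#|E| - #|star E|] by one, one and
    two, which is what turns [diff_nmons] into [nmatchings_first]. Otherwise [e] is
    alone in its row or column; it divides normal monomials freely, and one
    difference removes it. *)
Theorem iter_diff_nmons E : gamma_free E ->
  iter (#|E| - #|star E|) diff (nmons E) = nmatchings (star E).
Proof.
have [N] := ubnP #|E|; elim: N E => // N IH E ltN gE.
have [E0|/first_exists[e fe]] := eqVneq E set0.
  have S0 : star E = set0.
    by apply/eqP; rewrite -subset0; have := star_sub E; rewrite [X in _ \subset pred_of_set X -> _]E0.
  rewrite S0 {1}E0 cards0 sub0n /= E0; apply/funext => -[|k].
    by rewrite /nmons /nmatchings normal_mons0 normal_matchings0.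
  rewrite /nmons /nmatchings; congr (Posz _).
  have -> : normal_mons set0 k.+1 = fset0.
    apply/fsetP => m; rewrite in_normal_mons inE; apply/negbTE.
    apply/negP => /andP[/eqP dm /andP[sm _]].
    move: dm; suff -> : m = 0%MM by rewrite mdeg0.
    apply/mnmP => i; rewrite mnm0E; apply/eqP; rewrite -leqn0 leqNgt.
    by apply/negP => mi; have := subsetP sm i; rewrite !inE => /(_ mi).
  have -> : normal_matchings set0 k.+1 = set0.
    apply/setP => S; rewrite !inE; apply/negbTE.
    apply/negP => /and3P[/eqP cS _ /andP[sS _]].
    by move: sS cS; rewrite subset0 => /eqP ->; rewrite cards0.
  by rewrite cardfs0 cards0.
have eE := fe.1; have subS := subset_leq_card (star_sub E).
case: (boolP (e \in star E)) => eS; last first.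
  have cD := cardsD1 e E; rewrite eE add1n in cD.
  have dE : diff (nmons E) = nmons (E :\ e).
    rewrite (diff_nmons fe); apply/funext => k; case: (star_sub_lone fe eS) => D.
      have -> : without_cross E e = without_col E e.
        apply/setIidPr; rewrite D; apply/subsetP => a; rewrite !inE => /andP[-> H].
        by rewrite andbT; apply: contra H => /eqP ->.
      rewrite D; lia.
    have -> : without_cross E e = without_row E e.
      apply/setIidPl; rewrite D; apply/subsetP => a; rewrite !inE => /andP[-> H].
      by rewrite andbT; apply: contra H => /eqP ->.
    rewrite D; lia.
  have ind : induced (E :\ e) E.
    by case: (star_sub_lone fe eS) => <-;
      [apply: induced_without_row|apply: induced_without_col].
  have := subset_leq_card (star_sub (E :\ e)); rewrite star_setD1 // => le.
  rewrite cD subSn //.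
  rewrite iterSr dE -{1}(star_setD1 fe eS) IH ?star_setD1 //; first by rewrite -ltnS -cD.
  exact: gamma_free_induced ind gE.
have fS := first_star fe eS.
have IHi B : induced B E -> #|B| < #|E| ->
    iter (#|B| - #|star B|) diff (nmons B) = nmatchings (star B).
  move=> ind lt; apply: IH; first lia.
  exact: gamma_free_induced ind gE.
have IHr := IHi _ (induced_without_row E e).
have IHc := IHi _ (induced_without_col E e).
have IHx := IHi _ (induced_without_cross E e).
rewrite star_without_row // in IHr; rewrite star_without_col // in IHc.
rewrite star_without_cross // in IHx.
have c1 := card_without_row e E; have c2 := card_without_col e E.
have c3 := card_without_cross eE.
have s1 := card_without_row e (star E); have s2 := card_without_col e (star E).
have s3 := card_without_cross eS.
have k1 := card_row_star gE fe eS; have k2 := card_col_star gE fe eS.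
have subX : #|without_cross (star E) e| <= #|without_cross E e|.
  by rewrite -star_without_cross //; apply: subset_leq_card; apply: star_sub.
have D2 : #|E| - #|star E| = (#|without_cross E e| - #|without_cross (star E) e|).+2 by lia.
have D1 : #|without_row E e| - #|without_row (star E) e| =
  (#|without_cross E e| - #|without_cross (star E) e|).+1 by lia.
have D1' : #|without_col E e| - #|without_col (star E) e| =
  (#|without_cross E e| - #|without_cross (star E) e|).+1 by lia.
rewrite D1 in IHr; rewrite D1' in IHc.
rewrite D2 iterSr (diff_nmons fe) iter_diffB iter_diffD IHr; last lia.
rewrite IHc; last lia.
rewrite iterS IHx; last lia.
by rewrite -(nmatchings_first fS).
Qed.

(** ** Existence and uniqueness of normal forms *)

(** Consider the first entry in the union of the two supports. If only one of the
    two contained it, the other, having the same row and column sums, would have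
    entries in its row and in its column, and these are inverted. So both contain
    it, and it can be cancelled. *)
Lemma normal_unique E (f g : 'I_n -> nat) :
  normal_in E [set i | 0 < f i] -> normal_in E [set i | 0 < g i] ->
  (forall r, \sum_(i | rw i == r) f i = \sum_(i | rw i == r) g i) ->
  (forall c, \sum_(i | cl i == c) f i = \sum_(i | cl i == c) g i) ->
  f =1 g.
Proof.
have [N] := ubnP (\sum_i f i); elim: N f g => // N IH f g ltN sf sg rfg cfg.
have key (f1 g1 : 'I_n -> nat) e : normal_in E [set i | 0 < f1 i] ->
    normal_in E [set i | 0 < g1 i] ->
    (forall r, \sum_(i | rw i == r) f1 i = \sum_(i | rw i == r) g1 i) ->
    (forall c, \sum_(i | cl i == c) f1 i = \sum_(i | cl i == c) g1 i) ->
    first [set i | (0 < f1 i) || (0 < g1 i)] e -> 0 < f1 e -> 0 < g1 e.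
  move=> /andP[/subsetP fE _] /andP[_ /normalP ng] rr cc fe f1e.
  rewrite lt0n; apply/negP => /eqP g1e.
  have : 0 < \sum_(i | rw i == rw e) g1 i.
    by rewrite -rr (bigD1 e) //= ltn_addr.
  rewrite lt0n sum_nat_eq0 negb_forall => /existsP[a].
  rewrite negb_imply -lt0n => /andP[/eqP ra ga].
  have : 0 < \sum_(i | cl i == cl e) g1 i.
    by rewrite -cc (bigD1 e) //= ltn_addr.
  rewrite lt0n sum_nat_eq0 negb_forall => /existsP[b].
  rewrite negb_imply -lt0n => /andP[/eqP cb gb].
  have aA : a \in [set i | (0 < f1 i) || (0 < g1 i)] by rewrite inE ga orbT.
  have bA : b \in [set i | (0 < f1 i) || (0 < g1 i)] by rewrite inE gb orbT.
  have ae : a != e by apply/eqP => ae; move: ga; rewrite ae g1e.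
  have be : b != e by apply/eqP => be; move: gb; rewrite be g1e.
  have := ng a b; rewrite !inE ga gb => /(_ isT isT) /negP; apply; apply/inversionP.
  exists e; first by apply: fE; rewrite inE.
  split=> //; first by rewrite ra; apply: (first_lt_row fe).
  by rewrite cb; apply: (first_lt_col fe).
have [E0|/first_exists[e fe]] := eqVneq [set i | (0 < f i) || (0 < g i)] set0.
  move=> i; have : i \notin [set i | (0 < f i) || (0 < g i)] by rewrite E0 inE.
  by rewrite inE negb_or -!eqn0Ngt => /andP[/eqP -> /eqP ->].
have fe' : first [set i | (0 < g i) || (0 < f i)] e.
  suff -> : [set i | (0 < g i) || (0 < f i)] = [set i | (0 < f i) || (0 < g i)] by [].
  by apply/setP => i; rewrite !inE orbC.
have [fe0 ge0] : 0 < f e /\ 0 < g e.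
  have := fe.1; rewrite inE => /orP[p|p]; split=> //; first exact: key fe p.
  exact: key fe' p.
have dec (h : 'I_n -> nat) (Q : pred 'I_n) : 0 < h e ->
    \sum_(i | Q i) h i = Q e + \sum_(i | Q i) (h i - (i == e)).
  move=> he; case Qe: (Q e); last first.
    by rewrite add0n; apply: eq_bigr => i Qi; case: eqP => [E0|]; [rewrite -E0 Qi in Qe|rewrite subn0].
  rewrite !(bigD1 e Qe) /= eqxx addnA subnKC //; congr (_ + _).
  by apply: eq_bigr => i /andP[_ /negbTE ->]; rewrite subn0.
have sp (h : 'I_n -> nat) : normal_in E [set i | 0 < h i] ->
    normal_in E [set i | 0 < h i - (i == e)].
  move=> /andP[s1 s2]; have sub : [set i | 0 < h i - (i == e)] \subset [set i | 0 < h i].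
    by apply/subsetP => i; rewrite !inE => /leq_trans; apply; rewrite leq_subr.
  by rewrite /normal_in (subset_trans sub s1) (normal_subset sub).
have H : (fun i => f i - (i == e)) =1 (fun i => g i - (i == e)).
  apply: IH; [|exact: sp|exact: sp| |].
  - by move: ltN; rewrite (dec f xpredT fe0) add1n ltnS.
  - by move=> r; have := rfg r; rewrite (dec f _ fe0) (dec g _ ge0) => /addnI.
  - by move=> c; have := cfg c; rewrite (dec f _ fe0) (dec g _ ge0) => /addnI.
by move=> i; move: (H i) => /=; case: eqP => [->|]; lia.
Qed.

(** The order of the labels decides the direction of the swap: it moves [a] and [b]
    to the diagonal of their rectangle. *)
Lemma not_normal_swap E S : gamma_free E -> S \subset E -> ~~ normal E S ->
  exists a b c d, [/\ [&& a \in S, b \in S, c \in E & d \in E],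
    rw c = rw a /\ cl c = cl b, rw d = rw b /\ cl d = cl a &
    rw a < rw b /\ cl b < cl a].
Proof.
move=> gE /subsetP SE; rewrite negb_forall_in => /exists_inP[a aS].
rewrite negb_forall_in => /exists_inP[b bS].
rewrite negbK => /inversionP[c cE [rc cc lr lc]].
have [d dE [rd cd]] := gE c a b cE (SE _ aS) (SE _ bS) rc cc
  (eq_ind_r (fun x => x < rw b) lr rc) (eq_ind_r (fun x => x < cl a) lc cc).
by exists a, b, c, d; rewrite aS bS cE dE.
Qed.

(** The fourth corner is in the star again: two more rectangles carry the later
    entries of [a] and [b] to its row and its column. *)
Lemma gamma_free_star E : gamma_free E -> gamma_free (star E).
Proof.
move=> gE e a b /starP[eE _ _] /starP[aE [a' [a'E ra' ca']] _].
move=> /starP[bE _ [b' [b'E cb' rb']]] ra cb lr lc.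
have [f fE [rf cf]] := gE e a b eE aE bE ra cb lr lc.
exists f => //; apply/starP; split=> //.
  have [||g gE' [rg cg]] := gE e a' b eE a'E bE _ cb lr; [lia|lia|].
  by exists g; rewrite rg rf cg cf.
have [||g gE' [rg cg]] := gE e a b' eE aE b'E ra _ _ lc; [lia|lia|].
by exists g; rewrite rg cf cg rf.
Qed.

End Matrix.

Local Open Scope ring_scope.

(** * A monomial basis of the coordinate ring *)

Lemma subspace_dim_unique (K : fieldType) (V : lmodType K) (W : V -> Prop) m m' :
  subspace_dim W m -> subspace_dim W m' -> m = m'.
Proof.
have le p q : subspace_dim W p -> subspace_dim W q -> (p <= q)%N.
  move=> [b [Wb Ub]] [b' [Wb' Ub']].
  have /choice[A HA] i := let: ex_intro c (conj Hc _) := Ub' _ (Wb i) in ex_intro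
    (fun c : 'rV_q => b i = \sum_(j < q) c 0 j *: b' j) c Hc.
  have /choice[B HB] i := let: ex_intro c (conj Hc _) := Ub _ (Wb' i) in ex_intro
    (fun c : 'rV_p => b' i = \sum_(j < p) c 0 j *: b j) c Hc.
  pose MA : 'M[K]_(p, q) := \matrix_(i, j) A i 0 j.
  pose MB : 'M[K]_(q, p) := \matrix_(i, j) B i 0 j.
  apply: (@mulmx1_min _ _ _ MA MB).
  apply/row_matrixP => i.
  have [c [_ Uc]] := Ub _ (Wb i).
  rewrite -(Uc (row i (MA *m MB))); last first.
    rewrite {1}HA; under eq_bigr => j _ do rewrite HB scaler_sumr.
    rewrite exchange_big /=; apply: eq_bigr => k _; rewrite !mxE scaler_suml.
    by apply: eq_bigr => j _; rewrite scalerA !mxE.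
  rewrite -(Uc (row i 1%:M)) // (bigD1 i) //= big1 => [|j ne]; rewrite !mxE.
    by rewrite eqxx scale1r addr0.
  by rewrite eq_sym (negbTE ne) scale0r.
by move=> H H'; apply/eqP; rewrite eqn_leq !le.
Qed.

Section Toric.
Variables (K : fieldType) (n : nat) (rw cl : 'I_n -> nat).
Local Notation S := {mpoly K[n]}.
Hypothesis rwcl_inj : forall i j, rw i = rw j -> cl i = cl j -> i = j.
Hypothesis gE : gamma_free rw cl [set: 'I_n].

(** Rows and columns become two disjoint families of variables, numbered by the
    labels. *)
Definition label_bound := (\max_i rw i + \max_i cl i).+1.
Local Notation L := label_bound.

Lemma rw_lt i : (rw i < L)%N.
Proof. by rewrite ltnS; apply: leq_trans (leq_addr _ _); apply: leq_bigmax. Qed.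

Lemma cl_lt i : (cl i < L)%N.
Proof. by rewrite ltnS; apply: leq_trans (leq_addl _ _); apply: leq_bigmax. Qed.

Definition row_node i : 'I_(L + L) := lshift L (Ordinal (rw_lt i)).
Definition col_node i : 'I_(L + L) := rshift L (Ordinal (cl_lt i)).

Lemma eq_row_node i j : (row_node i == row_node j) = (rw i == rw j).
Proof. by rewrite -val_eqE /=. Qed.

Lemma eq_col_node i j : (col_node i == col_node j) = (cl i == cl j).
Proof. by rewrite -val_eqE /= eqn_add2l. Qed.

Lemma row_col_node i j : (row_node i == col_node j) = false.
Proof. by apply/negbTE; rewrite -val_eqE /=; have := rw_lt i; lia. Qed.

Lemma row_nodeE i j : rw i = rw j -> row_node i = row_node j.
Proof. by move=> H; apply/eqP; rewrite eq_row_node H. Qed.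

Lemma col_nodeE i j : cl i = cl j -> col_node i = col_node j.
Proof. by move=> H; apply/eqP; rewrite eq_col_node H. Qed.

(** The parametrization of the edge ring of the graph of rows and columns, cut
    down to the subgraph induced by a set of nodes: the kernels for varying [X]
    are the primes in the chain that bounds the Krull dimension from below. *)
Definition toric_var (X : {set 'I_(L + L)}) i : {mpoly K[L + L]} :=
  if (row_node i \in X) && (col_node i \in X)
  then 'X_(row_node i) * 'X_(col_node i) else 0.

Definition toric X (p : S) : {mpoly K[L + L]} := p \mPo [tuple toric_var X i | i < n].

Lemma toricXU X i : toric X 'X_i = toric_var X i.
Proof. by rewrite /toric comp_mpolyXU -tnth_nth tnth_mktuple. Qed.

Lemma toric_square X a b c d : rw c = rw a -> cl c = cl b -> rw d = rw b ->
  cl d = cl a -> toric_var X a * toric_var X b = toric_var X c * toric_var X d.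
Proof.
move=> rc cc rd cd; rewrite /toric_var (row_nodeE rc) (col_nodeE cc).
rewrite (row_nodeE rd) (col_nodeE cd).
by do 4 case: (_ \in X); rewrite ?mul0r ?mulr0 //=; ring.
Qed.

(** The row and column sums of [m], as the exponent vector of its toric image. *)
Definition margin (m : 'X_{1..n}) : 'X_{1..(L + L)} :=
  (\big[mnm_add/0%MM]_(i < n) ((U_(row_node i) + U_(col_node i)) *+ m i))%MM.

Lemma toricX m : toric setT 'X_[m] = 'X_[margin m].
Proof.
rewrite /toric comp_mpolyX /margin -mprodXE.
rewrite (eq_bigr (fun i => 'X_[(U_(row_node i) + U_(col_node i)) *+ m i])) // => i _.
by rewrite tnth_mktuple /toric_var !inE /= -mpolyXD mpolyXn.
Qed.

Lemma margin_row m i : margin m (row_node i) = (\sum_(j | rw j == rw i) m j)%N.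
Proof.
rewrite mnm_sumE [RHS]big_mkcond /=; apply: eq_bigr => j _.
rewrite mulmnE mnmDE !mnm1E eq_row_node [col_node j == _]eq_sym row_col_node; case: eqP; lia.
Qed.

Lemma margin_col m i : margin m (col_node i) = (\sum_(j | cl j == cl i) m j)%N.
Proof.
rewrite mnm_sumE [RHS]big_mkcond /=; apply: eq_bigr => j _.
rewrite mulmnE mnmDE !mnm1E eq_col_node row_col_node; case: eqP; lia.
Qed.

Lemma margin_normal_inj k m m' : m \in normal_mons rw cl setT k ->
  m' \in normal_mons rw cl setT k -> margin m = margin m' -> m = m'.
Proof.
rewrite !in_normal_mons => /andP[_ s] /andP[_ s'] E.
apply/mnmP; apply: (normal_unique rwcl_inj s s').
  move=> r; case: (pickP (fun i => rw i == r)) => [i /eqP <-|H].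
    by rewrite -!margin_row E.
  by rewrite !big_pred0.
move=> c; case: (pickP (fun i => cl i == c)) => [i /eqP <-|H].
  by rewrite -!margin_col E.
by rewrite !big_pred0.
Qed.

Section Quotient.
Variables (A : lmodType K) (res : {linear S -> A}).
Hypothesis res_toric : forall p, res p = 0 -> toric setT p = 0.
Hypothesis res_square : forall a b c d w, rw c = rw a -> cl c = cl b ->
  rw d = rw b -> cl d = cl a ->
  res ('X_a * 'X_b * w) = res ('X_c * 'X_d * w).

(** Distinct normal monomials have distinct monomials as toric images. *)
Lemma margin_free k (c : 'X_{1..n} -> K) :
  res (\sum_(m <- normal_mons rw cl setT k) c m *: 'X_[m]) = 0 ->
  forall m, m \in normal_mons rw cl setT k -> c m = 0.
Proof.
move=> /res_toric.
rewrite /toric raddf_sum /=.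
under eq_bigr => m _ do rewrite linearZ /= -[comp_mpoly _ _]/(toric setT _) toricX.
move=> E m mN; have := congr1 (mcoeff (margin m)) E.
rewrite mcoeff0 raddf_sum /= (big_fsetD1 m) //= mcoeffZ mcoeffX eqxx mulr1.
rewrite big1_fset ?addr0 // => m' /fsetD1P[ne m'N] _.
rewrite mcoeffZ mcoeffX; case: eqP => [E'|]; last by rewrite mulr0.
by move: ne; rewrite (margin_normal_inj m'N mN E') eqxx.
Qed.

(** Each swap of an inversion increases the sum of [rw * cl], so that swapping
    terminates. *)
Lemma residue_normal k m : mdeg m = k ->
  exists2 m', m' \in normal_mons rw cl setT k & res 'X_[m] = res 'X_[m'].
Proof.
pose wt (m : 'X_{1..n}) := (\sum_i m i * (rw i * cl i))%N.
have wtD m1 m2 : wt (m1 + m2)%MM = (wt m1 + wt m2)%N.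
  by rewrite /wt -big_split; apply: eq_bigr => i _; rewrite mnmDE mulnDl.
have wtU i : wt U_(i)%MM = (rw i * cl i)%N.
  rewrite /wt (bigD1 i) //= mnm1E eqxx mul1n big1 ?addn0 // => j ne.
  by rewrite mnm1E eq_sym (negbTE ne).
have wtle m1 : (wt m1 <= mdeg m1 * (L * L))%N.
  rewrite mdegE big_distrl /=; apply: leq_sum => i _; rewrite leq_mul2l.
  by rewrite leq_mul ?orbT // ltnW ?rw_lt ?cl_lt.
have [N] := ubnP (mdeg m * (L * L) - wt m); elim: N m => // N IH m ltN dm.
have [nm|nm] := boolP (normal rw cl setT (supp m)).
  by exists m => //; rewrite in_normal_mons dm eqxx /normal_in subsetT.
have [a [b [c [d]]]] := not_normal_swap gE (subsetT _) nm.
move=> [/and4P[aS bS _ _] [rc cc] [rd cd] [lr lc]].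
have ab : a != b by apply: contraTneq lr => ->; rewrite ltnn.
pose w := (m - (U_(a) + U_(b)))%MM.
have mw : m = (U_(a) + U_(b) + w)%MM.
  rewrite addmC submK //; apply/mnm_lepP => i; rewrite mnmDE !mnm1E.
  move: aS bS; rewrite !inE; case: (a =P i) => [<-|_]; case: (b =P _) => [E|_] //=.
    by move: ab; rewrite E eqxx.
  by rewrite E.
pose m1 := (U_(c) + U_(d) + w)%MM.
have d1 : mdeg m1 = mdeg m by rewrite mw !mdegD !mdeg1.
have w1 : (wt m < wt m1)%N.
  rewrite mw /m1 !wtD !wtU rc cc rd cd ltn_add2r; nia.
have lt1 : (mdeg m1 * (L * L) - wt m1 < N)%N.
  have := wtle m1; rewrite d1; move: ltN w1; lia.
have [m' m'N E] := IH m1 lt1 (etrans d1 dm).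
exists m' => //; rewrite -E mw /m1 !mpolyXD; exact: res_square.
Qed.

(** Straightening gives the generation, the toric map the independence. *)
Theorem normal_mons_dim k :
  subspace_dim (fun x => exists2 p : S, p \is k.-homog & x = res p) #|` normal_mons rw cl setT k|.
Proof.
set N := normal_mons _ _ _ _; pose s : seq 'X_{1..n} := N.
have us : uniq s by exact: fset_uniq.
have sz : size s = #|` N| by [].
pose b (i : 'I_#|` N|) : A := res 'X_[nth 0%MM s i].
have sum_b (c : 'X_{1..n} -> K) :
    \sum_(i < #|` N|) c (nth 0%MM s i) *: b i = res (\sum_(m <- N) c m *: 'X_[m]).
  rewrite linear_sum (big_nth 0%MM) big_mkord; apply: eq_bigr => i _.
  by rewrite linearZ.
exists b; split=> [i|x [p hp ->]].
  have : nth 0%MM s i \in N by apply: mem_nth.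
  rewrite in_normal_mons => /andP[/eqP dm _].
  move=> /=; exists 'X_[nth 0%MM s i] => //; rewrite dhomogX; exact/eqP.
have spans m : mdeg m = k -> exists c : 'X_{1..n} -> K,
    res 'X_[m] = res (\sum_(m <- N) c m *: 'X_[m]).
  move=> /residue_normal[m' m'N ->]; exists (fun m1 => (m1 == m')%:R).
  rewrite (big_fsetD1 m') //= eqxx scale1r big1_fset ?addr0 // => m1.
  by move=> /fsetD1P[/negbTE -> _] _; rewrite scale0r.
have [c Ec] : exists c : 'X_{1..n} -> K,
    res p = res (\sum_(m <- N) c m *: 'X_[m]).
  rewrite (mpolyE p); move/dhomogP: hp => hp.
  rewrite big_seq; apply: (big_ind (fun q : S => exists c : 'X_{1..n} -> K,
    res q = res (\sum_(m <- N) c m *: 'X_[m]))).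
  - exists (fun=> 0); congr (res _); rewrite big1 // => m _; exact: scale0r.
  - move=> q q' [c Hc] [c' Hc']; exists (fun m => c m + c' m).
    rewrite linearD Hc Hc' -linearD -big_split; congr (res _).
    by apply: eq_bigr => m _; rewrite scalerDl.
  - move=> m mp; have [c Hc] := spans m (hp m mp); exists (fun m1 => p@_m * c m1).
    rewrite linearZ Hc -linearZ scaler_sumr; congr (res _).
    by apply: eq_bigr => m1 _; rewrite scalerA.
exists (\row_i c (nth 0%MM s i)); split=> [|c' Ec'].
  by rewrite Ec -sum_b; apply: eq_bigr => i _; rewrite mxE.
pose c1 m := if insub (index m s) is Some i then c' 0 i else 0.
have c1E (i : 'I_#|` N|) : c1 (nth 0%MM s i) = c' 0 i.
  by rewrite /c1 index_uniq ?sz // valK.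
apply/rowP => i; rewrite mxE -c1E; apply/eqP; rewrite -subr_eq0; apply/eqP.
apply: (margin_free (c := fun m => c m - c1 m) (k := k)); last by apply: mem_nth.
under eq_bigr => m _ do rewrite scalerBl.
rewrite sumrB linearB -Ec Ec' -sum_b.
by under [X in _ - X]eq_bigr => j _ do rewrite c1E; rewrite subrr.
Qed.

End Quotient.

End Toric.

Section Residue.
Variables (K : fieldType) (P : {fset cell}).
Local Notation n := #|{: vertices P}|.
Local Notation S := (vertex_ring K P).
Local Notation A := (coordinate_ring K P).
Implicit Types (p q : S) (x y : A).

Lemma residueD p q : residue (p + q) = residue p + residue q.
Proof. by rewrite /residue rmorphD. Qed.

Lemma residueM p q : residue (p * q) = residue p * residue q.
Proof. by rewrite /residue rmorphM. Qed.

Lemma residue0 : residue (0 : S) = 0.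
Proof. by rewrite /residue rmorph0. Qed.

Lemma residue1 : residue (1 : S) = 1.
Proof. by rewrite /residue rmorph1. Qed.

Lemma residueZ a p : residue (a *: p) = a *: residue p.
Proof. by rewrite -mul_mpolyC residueM. Qed.

Lemma eq_residue p q : (residue p == residue q) = (p - q \in @polyomino_ideal K P).
Proof. by rewrite /residue Quotient.idealrBE. Qed.

Lemma residue_repr x : residue (repr x) = x.
Proof. by rewrite /residue reprK. Qed.

End Residue.

(** * Krull dimension: upper bound *)

Section Independence.
Variables (R : comNzRingType) (a : nat).

(** A polynomial in [e] variables, given by the coefficients [c s] at its exponent
    vectors [s] with entries below [a], evaluated one variable at a time: the
    recursion of the proof is on the length of a chain. *)
Fixpoint nested_eval (e : nat) (c : seq nat -> R) (x : nat -> R) : R :=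
  if e is e'.+1 then
    \sum_(j < a) nested_eval e' (fun s => c (val j :: s)) (fun i => x i.+1) * x 0%N ^+ j
  else c [::].

Lemma nested_eval0 e c x :
  (forall s, size s = e -> all (gtn a) s -> c s = 0) -> nested_eval e c x = 0.
Proof.
elim: e c x => [|e IH] c x c0 /=; first exact: c0.
rewrite big1 // => j _; rewrite IH ?mul0r // => s sz al.
by apply: c0; rewrite /= ?sz ?al ?ltn_ord.
Qed.

Lemma nested_evalE e c x : nested_eval e c x =
  \sum_(t : e.-tuple 'I_a) c (map val t) * \prod_(i < e) x i ^+ tnth t i.
Proof.
elim: e c x => [|e IH] c x /=.
  rewrite (big_pred1 [tuple]) => [|t]; last by apply/esym/eqP; exact: tuple0.
  by rewrite big_ord0 mulr1.
under eq_bigr => j _ do rewrite IH big_distrl /=.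
rewrite pair_big /=.
rewrite [RHS](reindex (fun u : 'I_a * e.-tuple 'I_a => [tuple of u.1 :: u.2])) /=.
  apply: eq_bigr => -[j t] _ /=; rewrite big_ord_recl tnth0 -mulrA; congr (_ * _).
  by rewrite mulrC; congr (_ * _); apply: eq_bigr => i _; rewrite tnthS.
exists (fun t : e.+1.-tuple 'I_a => (thead t, [tuple of behead t])) => [[j t] _|t _] /=.
  by congr pair; apply: val_inj.
by rewrite -tuple_eta.
Qed.

(** A chain of primes is climbed by algebraically independent elements. Factor out
    the lowest power of the first variable: it is not in the first prime, and
    modulo the second prime only the lowest coefficient remains, a relation
    between the other elements, along the rest of the chain. The condition on
    [c] holds when its values are scalars. *)
Lemma prime_chain_indep e (Q : nat -> prime_idealr R) (x : nat -> R) c :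
  (forall i, (i < e)%N -> {subset Q i <= Q i.+1} /\ (x i \in Q i.+1) && (x i \notin Q i)) ->
  (forall s i, c s \in Q i -> c s = 0) ->
  (exists s, [/\ size s = e, all (gtn a) s & c s != 0]) ->
  nested_eval e c x \notin Q 0%N.
Proof.
elim: e Q x c => [|e IH] Q x c HQ Hc [s [sz al cs]] /=.
  by apply: contra cs => /Hc; move/size0nil: sz => -> ->.
case: s sz al cs => // j0 s [sz] /= /andP[j0a al] cs.
pose nz (j : nat) := (j < a)%N && `[< exists s, [/\ size s = e, all (gtn a) s & c (j :: s) != 0] >].
have exj : exists j, nz j.
  by exists j0; rewrite /nz j0a; apply/asboolP; exists s.
case: (ex_minnP exj) => j1 /andP[j1a /asboolP nzj1] minj.
set f := fun j : nat => nested_eval e (fun s => c (j :: s)) (fun i => x i.+1).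
have f0 (j : nat) : (j < j1)%N -> (j < a)%N -> f j = 0.
  move=> lt lta; apply: nested_eval0 => s' sz' al'.
  apply: contraTeq lt => cne; rewrite -leqNgt; apply: minj.
  by rewrite /nz lta; apply/asboolP; exists s'.
have [sub /andP[x0 x0']] := HQ 0%N isT.
set y := \sum_(j < a | (j1 <= j)%N) f j * x 0%N ^+ (j - j1).
have -> : \sum_(j < a) f j * x 0%N ^+ j = x 0%N ^+ j1 * y.
  rewrite (bigID (fun j : 'I_a => (j1 <= j)%N)) /= addrC big1 ?add0r.
    rewrite /y big_distrr /=; apply: eq_bigr => j le.
    by rewrite mulrCA -exprD subnKC.
  by move=> j; rewrite -ltnNge => lt; rewrite f0 ?mul0r.
have xj : x 0%N ^+ j1 \notin Q 0%N.
  elim: (j1) => [|j IHj]; first by rewrite expr0 idealr1.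
  by rewrite exprS prime_idealrM negb_or x0'.
rewrite prime_idealrM negb_or xj /=; apply/negP => /sub yQ.
have : f j1 \in Q 1%N.
  rewrite [f j1](_ : _ = y - \sum_(j < a | (j1 < j)%N) f j * x 0%N ^+ (j - j1)).
    apply: rpredB => //; apply: rpred_sum => j lt; apply: idealMr.
    by rewrite -(subnSK lt) exprS mulrC idealMr.
  rewrite /y (bigD1 (Ordinal j1a)) //= subnn expr0 mulr1.
  rewrite (eq_bigl (fun j : 'I_a => (j1 < j)%N)) ?addrK // => j.
  by rewrite -val_eqE /= ltn_neqAle eq_sym andbC.
apply/negP; apply: (IH (fun i => Q i.+1)) => [i lt|s' i|//].
  exact: HQ i.+1 lt.
exact: Hc.
Qed.

End Independence.

(** Each of the [d] summations raises the degree of a polynomial bound by one. *)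
Lemma sum_le_iter_diff (C : int) d (f : nat -> int) : 0 <= C ->
  (forall N, \sum_(k < N.+1) iter d diff f k <= C) ->
  forall N, \sum_(k < N.+1) f k <= C * N.+1%:R ^+ d.
Proof.
move=> C0; elim: d f => [|d IH] f H N; first by rewrite expr0 mulr1; apply: H.
have tele M : \sum_(k < M.+1) diff f k = f M.
  elim: M => [|M IHM]; first by rewrite big_ord_recl big_ord0 addr0.
  by rewrite big_ord_recr /= IHM addrC subrK.
have fle M : f M <= C * M.+1%:R ^+ d.
  by rewrite -tele; apply: IH => N'; have := H N'; under eq_bigr => k _ do rewrite iterSr.
apply: (@le_trans _ _ (\sum_(k < N.+1) C * N.+1%:R ^+ d)).
  apply: ler_sum => k _; apply: le_trans (fle k) _; apply: ler_wpM2l => //.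
  by apply: lerXn2r; rewrite ?nnegrE ?ler0n // ler_nat ltn_ord.
by rewrite sumr_const card_ord exprSr mulrA mulr_natr.
Qed.

Section UpperBound.
Variables (K : fieldType) (n : nat) (A : comNzRingType).
Local Notation S := {mpoly K[n]}.
Variables (res : {rmorphism S -> A}) (sec : A -> S).
Hypothesis secK : forall x, res (sec x) = x.
Variable nf : nat -> seq 'X_{1..n}.
Hypothesis res_nf : forall m, exists2 m', m' \in nf (mdeg m) & res 'X_[m] = res 'X_[m'].

(** The elements [p t] lie in the piece of filtration degree [N], which the normal
    forms of degree at most [N] generate. *)
Lemma many_monomials_dependent N (T : finType) (p : T -> S) :
  (forall t, msize (p t) <= N.+1)%N ->
  (\sum_(k < N.+1) size (nf k) < #|T|)%N ->
  exists c : T -> K, (exists t, c t != 0) /\ \sum_t res (c t)%:MP * res (p t) = 0.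
Proof.
move=> sz lt; pose ms := flatten [seq nf k | k <- iota 0 N.+1].
have size_ms : size ms = (\sum_(k < N.+1) size (nf k))%N.
  by rewrite size_flatten /shape -map_comp sumnE big_map -/(index_iota 0 N.+1) big_mkord.
pose M := size ms.
have spanX m : (mdeg m <= N)%N -> exists c : 'I_M -> K,
    res 'X_[m] = \sum_(j < M) res (c j)%:MP * res 'X_[nth 0%MM ms j].
  move=> dm; have [m' m'n ->] := res_nf m.
  have m'm : m' \in ms.
    by apply/flattenP; exists (nf (mdeg m)) => //; apply: map_f; rewrite mem_iota.
  have lti : (index m' ms < M)%N by rewrite index_mem.
  exists (fun j => (j == Ordinal lti)%:R); rewrite (bigD1 (Ordinal lti)) //= eqxx.
  rewrite rmorph1 mul1r nth_index // big1 ?addr0 // => j /negbTE ->.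
  by rewrite mulr0n mpolyC0 rmorph0 mul0r.
have span q : (msize q <= N.+1)%N -> exists c : 'I_M -> K,
    res q = \sum_(j < M) res (c j)%:MP * res 'X_[nth 0%MM ms j].
  move=> szq; rewrite (mpolyE q) big_seq.
  apply: (big_ind (fun q : S => exists c : 'I_M -> K,
    res q = \sum_(j < M) res (c j)%:MP * res 'X_[nth 0%MM ms j])).
  - exists (fun=> 0); rewrite rmorph0 big1 // => j _.
    by rewrite mul0r.
  - move=> q1 q2 [c1 H1] [c2 H2]; exists (fun j => c1 j + c2 j).
    rewrite rmorphD H1 H2 -big_split; apply: eq_bigr => j _ /=.
    by rewrite mpolyCD rmorphD mulrDl.
  - move=> m /msize_mdeg_lt/leq_trans/(_ szq); rewrite ltnS => /spanX[c Hc].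
    exists (fun j => q@_m * c j); rewrite -mul_mpolyC rmorphM Hc big_distrr /=.
    by apply: eq_bigr => j _; rewrite mpolyCM rmorphM mulrA.
have /choice[B HB] t := span _ (sz t).
pose MB : 'M[K]_(#|T|, M) := \matrix_(i, j) B (enum_val i) j.
have : kermx MB != 0.
  rewrite -mxrank_eq0 mxrank_ker subn_eq0 -ltnNge.
  by apply: leq_ltn_trans (rank_leq_col _) _; rewrite /M size_ms.
case/rowV0Pn => u /sub_kermxP uB u0.
exists (fun t => u 0 (enum_rank t)); split.
  have [i ui] : exists i, u 0 i != 0.
    apply/existsP; apply: contraNT u0 => /existsPn H; apply/eqP/rowP => i.
    by rewrite mxE; apply/eqP; move: (H i); rewrite negbK.
  by exists (enum_val i); rewrite enum_valK.
under eq_bigr => t _ do rewrite HB big_distrr /=.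
rewrite exchange_big big1 //= => j _.
under eq_bigr => t _ do rewrite mulrA -rmorphM -mpolyCM.
rewrite -big_distrl /= -rmorph_sum -raddf_sum /=.
have := congr1 (fun M : 'rV_M => M 0 j) uB; rewrite !mxE.
rewrite (reindex (@enum_rank T)) /=; last by apply: onW_bij; apply: enum_rank_bij.
under eq_bigr => t _ do rewrite mxE enum_rankK.
by move=> ->; rewrite raddf0 ?rmorph0 mul0r.
Qed.

Lemma msizeM_leq (p q : S) b c :
  (msize p <= b.+1 -> msize q <= c.+1 -> msize (p * q) <= (b + c).+1)%N.
Proof.
move=> lp lq; rewrite msizeE; apply/bigmax_leqP_seq => m + _.
move=> /msuppM_le /allpairsP[[m1 m2] /= [m1p m2q ->]]; rewrite mdegD ltnS.
have := msize_mdeg_lt m1p; have := msize_mdeg_lt m2q; move: lp lq; lia.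
Qed.

(** A chain of length [e] yields [a ^ e] independent monomials with exponents below
    [a]. The elements of the chain having lifts of degree at most [D], these
    monomials have degree at most [e * D * a], so that [a ^ e] is bounded by
    a constant times [a ^ d]. *)
Theorem prime_chain_bound C d e (Q : nat -> prime_idealr A) :
  (forall N, \sum_(k < N.+1) size (nf k) <= C * N.+1 ^ d)%N ->
  prime_chain e Q -> (e <= d)%N.
Proof.
move=> H chain; rewrite leqNgt; apply/negP => de.
have /choice[x Hx] i : exists x, (i < e)%N -> (x \in Q i.+1) && (x \notin Q i).
  case: (ltnP i e) => [/chain[_ [x x1 x2]]|]; last by exists 0.
  by exists x; rewrite x1.
pose D := (\max_(i < e) msize (sec (x i)))%N.
(* this many exponents exceed the constant in the bound on the dimensions *)
pose a := (C * (e * D).+1 ^ d).+1.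
have a0 : (0 < a)%N by [].
pose T := (e.-tuple 'I_a)%type.
pose p (t : T) : S := \prod_(i < e) sec (x i) ^+ tnth t i.
have szX (q : S) k b : (msize q <= b.+1)%N -> (msize (q ^+ k) <= (b * k).+1)%N.
  move=> szq; elim: k => [|k IHk]; first by rewrite expr0 msize1.
  by rewrite exprS mulnS; apply: msizeM_leq.
have szp t : (msize (p t) <= (e * D * a).+1)%N.
  rewrite /p -mulnA -[X in (X * _)%N]card_ord -sum_nat_const.
  apply: (big_ind2 (fun (q : S) b => (msize q <= b.+1)%N)) => [|q b q' b' lq lq'|i _].
  - by rewrite msize1.
  - exact: msizeM_leq.
  - apply: leq_trans (szX _ _ D _) _.
      by apply: leqW; exact: (@leq_bigmax _ (fun i : 'I_e => msize (sec (x i))) i).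
    by rewrite ltnS leq_mul2l (ltnW (ltn_ord _)) orbT.
have big : (\sum_(k < (e * D * a).+1) size (nf k) < #|{: T}|)%N.
  rewrite card_tuple card_ord; apply: leq_ltn_trans (H _) _.
  have le1 : ((e * D * a).+1 <= (e * D).+1 * a)%N by nia.
  apply: (@leq_ltn_trans (C * ((e * D).+1 * a) ^ d)).
    by apply: leq_mul => //; case: (d) => // d'; rewrite leq_exp2r.
  rewrite expnMn mulnA; apply: (@leq_trans (a * a ^ d)); last by rewrite -expnS leq_pexp2l.
  by rewrite ltn_mul2r expn_gt0 a0 /=; exact: leqnn.
have [c [[t0 ct0] sum0]] := many_monomials_dependent szp big.
pose cs (s : seq nat) : A :=
  if [pick t : T | map val t == s] is Some t then res (c t)%:MP else 0.
have csE (t : T) : cs (map val t) = res (c t)%:MP.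
  rewrite /cs; case: pickP => [t' /eqP/(inj_map val_inj)/val_inj -> //|/(_ t)].
  by rewrite eqxx.
have unit_notin k i : k != 0 -> res k%:MP \notin Q i.
  move=> k0; apply/negP => /(idealMr (res k^-1%:MP)).
  by rewrite -rmorphM -mpolyCM mulVf // rmorph1 idealr1.
suff : nested_eval a e cs x \in Q 0%N.
  apply/negP; apply: prime_chain_indep.
  - by move=> i lt; have [sub _] := chain i lt; split=> //; apply: Hx.
  - move=> s i; rewrite /cs; case: pickP => // t _.
    by have [->|/(unit_notin _ i)/negbTE ->] := eqVneq (c t) 0; rewrite ?mpolyC0 ?rmorph0.
  - exists (map val t0); rewrite size_map size_tuple; split=> //.
      by rewrite all_map; apply/allP => j _ /=; exact: ltn_ord.
    rewrite csE; apply: contraNneq (unit_notin _ 0%N ct0) => ->; exact: idealr0.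
rewrite nested_evalE; under eq_bigr => t _.
  rewrite csE (_ : \prod_(i < e) x i ^+ tnth t i = res (p t)); last first.
      by rewrite rmorph_prod; apply: eq_bigr => i _; rewrite rmorphXn /= secK.
  over.
by rewrite sum0 idealr0.
Qed.

End UpperBound.

(** * Krull dimension: lower bound *)

Section Nodes.
Variables (n : nat) (rw cl : 'I_n -> nat).
Hypothesis rwcl_inj : forall i j, rw i = rw j -> cl i = cl j -> i = j.
Local Notation L := (label_bound rw cl).
Local Notation rnode := (row_node rw cl).
Local Notation cnode := (col_node rw cl).

(** An entry that is last both in its row and in its column is called a corner
    below. *)
Definition last_in_row i := [forall a, (rw a == rw i) ==> (cl a <= cl i)%N].
Definition last_in_col i := [forall a, (cl a == cl i) ==> (rw a <= rw i)%N].

Hypothesis corner_unique : forall i j, last_in_row i -> last_in_col i ->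
  last_in_row j -> last_in_col j -> i = j.

Definition nodes : {set 'I_(L + L)} := rnode @: setT :|: cnode @: setT.

Lemma row_in_nodes i : rnode i \in nodes.
Proof. by rewrite inE imset_f. Qed.

Lemma col_in_nodes i : cnode i \in nodes.
Proof. by rewrite inE orbC imset_f. Qed.

(** Moving to later entries in a row or a column ends in a corner. If there is only
    one, every connected component contains it. *)
Lemma corner_in (Q : pred 'I_n) i0 : Q i0 ->
  (forall i j, Q i -> rw j = rw i \/ cl j = cl i -> Q j) ->
  exists2 i, Q i & last_in_row i && last_in_col i.
Proof.
move=> Q0 HQ; case: (arg_maxnP (fun i => rw i + cl i)%N Q0) => i Qi maxi.
exists i => //; apply/andP; split; apply/forallP => a; apply/implyP => /eqP E.
  by have := maxi a (HQ _ _ Qi (or_introl E)); rewrite /= E; lia.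
by have := maxi a (HQ _ _ Qi (or_intror E)); rewrite /= E; lia.
Qed.

(** Every row and every column has one last entry. These are the entries outside the
    star, and only the corner is last in both. *)
Lemma card_star : (0 < n)%N -> #|nodes| = (n - #|star rw cl setT|).+1.
Proof.
move=> n0.
pose LR := [set i | last_in_row i]; pose LC := [set i | last_in_col i].
have starE : star rw cl setT = ~: (LR :|: LC).
  apply/setP => i; rewrite !inE negb_or /=; congr (_ && _).
    rewrite negb_forall; apply: eq_existsb => a.
    by rewrite inE negb_imply -ltnNge.
  rewrite negb_forall; apply: eq_existsb => a.
  by rewrite inE negb_imply -ltnNge.
have lines (f g : 'I_n -> nat) (h : 'I_n -> 'I_(L + L)) :
    (forall i j, (h i == h j) = (f i == f j)) ->
    (forall i j, f i = f j -> g i = g j -> i = j) ->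
    #|h @: setT| = #|[set i | [forall a, (f a == f i) ==> (g a <= g i)%N]]|.
  move=> hE fg; rewrite -(card_in_imset (f := h) (D := [set i | _])).
    apply: eq_card => v; apply/imsetP/imsetP => -[i _ ->]; last by exists i.
    have Pi : f i == f i by [].
    case: (@arg_maxnP _ i (fun j => f j == f i) g Pi) => j /eqP rj maxj.
    exists j; last by apply/esym/eqP; rewrite hE rj.
    rewrite inE; apply/forallP => a; apply/implyP => /eqP ra.
    by apply: maxj; rewrite ra rj.
  move=> i j; rewrite !inE => /forallP li /forallP lj /eqP; rewrite hE => /eqP E.
  by apply: fg => //; move: (li j) (lj i); rewrite E eqxx /=; lia.
have cR : #|rnode @: setT| = #|LR| := lines _ _ _ (eq_row_node rw cl) rwcl_inj.
have cC : #|cnode @: setT| = #|LC| := lines _ _ _ (eq_col_node rw cl)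
  (fun i j c r => rwcl_inj r c).
have [c _ /andP[cr cc]] := @corner_in xpredT (Ordinal n0) isT (fun _ _ _ _ => isT).
have cI : #|LR :&: LC| = 1%N.
  apply/eqP/cards1P; exists c; apply/setP => i; rewrite !inE; apply/andP/eqP.
    by case=> ir ic; apply: corner_unique.
  by move=> ->.
have dis : #|rnode @: setT :&: cnode @: setT| = 0%N.
  apply/eqP; rewrite cards_eq0; apply/eqP/setP => v; rewrite !inE.
  apply/negbTE/negP => /andP[/imsetP[i _ ->] /imsetP[j _ /eqP]].
  by rewrite row_col_node.
have := cardsUI LR LC; rewrite cI.
have := cardsUI (rnode @: setT) (cnode @: setT); rewrite dis cR cC -/nodes.
have := cardsC (LR :|: LC); rewrite -starE card_ord.
move: #|star rw cl setT| #|LR :|: LC| #|LR| #|LC| #|nodes|; lia.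
Qed.

(** The edges of the graph that leave a set of nodes. *)
Definition half_in (X : {set 'I_(L + L)}) i := (rnode i \in X) (+) (cnode i \in X).

Lemma nodes_connected (X : {set 'I_(L + L)}) x : x \in X -> X \proper nodes ->
  exists i, half_in X i.
Proof.
move=> xX /properP[/subsetP sub [y yN yX]].
apply/existsP; apply: contraT; rewrite negb_exists => /forallP H.
have eqX i : (rnode i \in X) = (cnode i \in X).
  by move: (H i); rewrite negb_add => /eqP.
have in_node z : z \in nodes -> exists i, (z == rnode i) || (z == cnode i).
  by rewrite inE => /orP[]/imsetP[i _ ->]; exists i; rewrite eqxx ?orbT.
have clos (b : bool) i j : (rnode i \in X) == b -> rw j = rw i \/ cl j = cl i ->
    (rnode j \in X) == b.
  move=> /eqP <- [E|E]; first by rewrite (row_nodeE cl E).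
  by rewrite !eqX (col_nodeE rw E).
have has b z : z \in nodes -> (z \in X) == b -> exists i, (rnode i \in X) == b.
  move=> /in_node[i /orP[]/eqP->] E; exists i => //; by rewrite eqX.
have [i1 X1] := has true x (sub _ xX) (introT eqP xX).
have [i2 X2] := has false y yN (introT eqP (negbTE yX)).
have [c1 c1X /andP[r1 k1]] := @corner_in (fun i => (rnode i \in X) == true) _ X1 (clos true).
have [c2 c2X /andP[r2 k2]] := @corner_in (fun i => (rnode i \in X) == false) _ X2 (clos false).
by move: c1X c2X; rewrite (corner_unique r1 k1 r2 k2) => /eqP ->.
Qed.

Definition grow (X : {set 'I_(L + L)}) :=
  if [pick i | half_in X i] is Some i then rnode i |: (cnode i |: X) else X.

(** Connected sets of nodes, obtained by adding a neighbour at each step. *)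
Definition flag i0 k := iter k grow [set rnode i0].

Lemma flagP i0 k : (k < #|nodes|)%N ->
  [/\ rnode i0 \in flag i0 k, flag i0 k \subset nodes & #|flag i0 k| = k.+1].
Proof.
elim: k => [|k IH] lt.
  by split; rewrite ?set11 ?cards1 // sub1set row_in_nodes.
have [r0 sub ck] := IH (ltnW lt).
rewrite /flag iterS -/(flag i0 k) /grow; case: pickP => [i hi|H].
  split; first by rewrite !inE r0 !orbT.
    by rewrite !subUset !sub1set row_in_nodes col_in_nodes.
  move: hi; rewrite /half_in; case rX: (rnode i \in _); case cX: (cnode i \in _) => //= _.
    by rewrite !cardsU1 !inE rX cX orbT ck.
  by rewrite !cardsU1 !inE rX cX row_col_node ck.
have prop : flag i0 k \proper nodes by rewrite properEcard sub ck.
by have [i] := nodes_connected r0 prop; rewrite H.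
Qed.

Lemma flag_step i0 k : (k.+1 < #|nodes|)%N -> flag i0 k \subset flag i0 k.+1 /\
  exists i, [/\ rnode i \in flag i0 k.+1, cnode i \in flag i0 k.+1 &
    ~~ ((rnode i \in flag i0 k) && (cnode i \in flag i0 k))].
Proof.
move=> lt; have [r0 sub ck] := flagP i0 (ltnW lt).
rewrite /flag iterS -/(flag i0 k) /grow; case: pickP => [i hi|H].
  split; first by apply/subsetP => x xF; rewrite !inE xF !orbT.
  exists i; rewrite !inE !eqxx !orbT; split=> //.
  by move: hi; rewrite /half_in; case: (_ \in _); case: (_ \in _).
have prop : flag i0 k \proper nodes by rewrite properEcard sub ck.
by have [i] := nodes_connected r0 prop; rewrite H.
Qed.

Section ToricPrimes.
Variables (K : fieldType) (A : comNzRingType).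
Local Notation tor := (@toric K n rw cl).
Local Notation S := {mpoly K[n]}.
Variables (res : {rmorphism S -> A}) (sec : A -> S).
Hypothesis secK : forall x, res (sec x) = x.
Hypothesis res_toric : forall X p, res p = 0 -> tor X p = 0.

Definition toric_kernel X : {pred A} := fun x => tor X (sec x) == 0.

Lemma toric_res X p q : res p = res q -> tor X p = tor X q.
Proof.
move=> E; apply/eqP; rewrite -subr_eq0 -comp_mpolyB; apply/eqP/res_toric.
by rewrite rmorphB E subrr.
Qed.

Lemma in_toric_kernel X p : (res p \in toric_kernel X) = (tor X p == 0).
Proof. by rewrite -topredE /= /toric_kernel (@toric_res X _ p) ?secK. Qed.

Lemma toric_kernel_ideal X : idealr_closed (toric_kernel X).
Proof.
split.
- by rewrite -(rmorph0 res) in_toric_kernel /toric comp_mpoly0.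
- by rewrite -(rmorph1 res) in_toric_kernel /toric comp_mpoly1 oner_eq0.
- move=> a x y; rewrite -(secK a) -(secK x) -(secK y) !in_toric_kernel.
  rewrite -rmorphM -rmorphD in_toric_kernel => /eqP tx /eqP ty.
  rewrite /toric comp_mpolyD rmorphM /= -![comp_mpoly _ _]/(tor X _).
  by rewrite tx ty mulr0 addr0.
Qed.

Lemma toric_kernel_prime X : prime_idealr_closed (toric_kernel X).
Proof.
move=> x y; rewrite -(secK x) -(secK y) -rmorphM !in_toric_kernel.
by rewrite /toric rmorphM /= mulf_eq0.
Qed.

HB.instance Definition _ X := isIdealr.Build A (toric_kernel X) (toric_kernel_ideal X).
HB.instance Definition _ X :=
  isPrimeIdealrClosed.Build A (toric_kernel X) (@toric_kernel_prime X).

Definition toric_prime X : prime_idealr A := toric_kernel X.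

(** The map for a smaller set of nodes factors through the one for a larger set, so
    that the kernels are nested. *)
Lemma toric_sub (X Y : {set 'I_(L + L)}) p : Y \subset X -> tor Y p =
  tor X p \mPo [tuple if j \in Y then 'X_j else 0 | j < L + L].
Proof.
move=> /subsetP YX; rewrite /toric !(comp_mpolyEX p) raddf_sum; apply: eq_bigr => m _ /=.
rewrite comp_mpolyZ; congr (_ *: _); rewrite !comp_mpolyX rmorph_prod.
apply: eq_bigr => i _; rewrite rmorphXn /=; congr (_ ^+ _); rewrite !tnth_mktuple.
rewrite /toric_var; case: (boolP (rnode i \in Y)) => rY.
  case: (boolP (cnode i \in Y)) => cY /=.
    by rewrite !YX // rmorphM /= !comp_mpolyXU -!tnth_nth !tnth_mktuple rY cY.
  case: ifP => _; last by rewrite comp_mpoly0.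
  by rewrite rmorphM /= !comp_mpolyXU -!tnth_nth !tnth_mktuple (negbTE cY) mulr0.
case: ifP => _ /=; last by rewrite comp_mpoly0.
by rewrite rmorphM /= !comp_mpolyXU -!tnth_nth !tnth_mktuple (negbTE rY) mul0r.
Qed.

(** Each new node makes one more variable nonzero, that of the edge that attached
    the node. *)
Theorem toric_prime_chain : (0 < n)%N ->
  exists Q : nat -> prime_idealr A, prime_chain (n - #|star rw cl setT|) Q.
Proof.
move=> n0; have cN := card_star n0; set d := (n - _)%N in cN *.
pose i0 := Ordinal n0.
exists (fun i => toric_prime (flag i0 (d - i))) => i lt.
have [sub [j [rj cj nj]]] := @flag_step i0 (d - i.+1) ltac:(lia).
have E : (d - i.+1).+1 = (d - i)%N by lia.
rewrite E in sub rj cj; split.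
  move=> x; rewrite -(secK x) !in_toric_kernel (toric_sub _ sub) => /eqP ->.
  by rewrite comp_mpoly0.
exists (res 'X_j).
  by rewrite in_toric_kernel toricXU /toric_var (negbTE nj).
rewrite in_toric_kernel toricXU /toric_var rj cj mulf_neq0 //;
  by rewrite -msupp_eq0 msuppX.
Qed.

End ToricPrimes.
End Nodes.

(** * The numerator of the Hilbert series *)

Section ResidueMorphism.
Variables (K : fieldType) (P : {fset cell}).
Local Notation residue := (@residue K P).

Lemma residue_zmod : zmod_morphism residue.
Proof. by move=> p q; rewrite -[- q]scaleN1r residueD residueZ scaleN1r. Qed.

Lemma residue_monoid : monoid_morphism residue.
Proof. by split; [exact: residue1 | exact: residueM]. Qed.

Lemma residue_scalable : scalable residue.
Proof. exact: residueZ. Qed.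

HB.instance Definition _ := GRing.isZmodMorphism.Build
  (vertex_ring K P) (coordinate_ring K P) residue residue_zmod.
HB.instance Definition _ := GRing.isMonoidMorphism.Build
  (vertex_ring K P) (coordinate_ring K P) residue residue_monoid.
HB.instance Definition _ := GRing.isScalable.Build K
  (vertex_ring K P) (coordinate_ring K P) *:%R residue residue_scalable.

End ResidueMorphism.

Section Numerator.
Variables (K : fieldType) (P : {fset cell}).
Local Notation n := #|{: vertices P}|.
Variables (rw cl : 'I_n -> nat).
Local Notation pt i := (val (enum_val (i : 'I_n))).
Hypothesis n0 : (0 < n)%N.
Hypothesis rwcl_inj : forall i j, rw i = rw j -> cl i = cl j -> i = j.
Hypothesis gE : gamma_free rw cl [set: 'I_n].
Hypothesis corner_unique : forall i j, last_in_row rw cl i -> last_in_col rw cl i ->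
  last_in_row rw cl j -> last_in_col rw cl j -> i = j.
Hypothesis inner_labels : forall i j k l, inner_interval P (pt i) (pt j) ->
  pt k = ((pt j).1, (pt i).2) -> pt l = ((pt i).1, (pt j).2) ->
  [/\ rw k = rw i, cl k = cl j, rw l = rw j & cl l = cl i].
(** Any full rectangle of entries spans an inner interval, a property of polyominoes
    without holes. *)
Hypothesis labels_inner : forall i j k l, rw k = rw i -> cl k = cl j ->
  rw l = rw j -> cl l = cl i ->
  [/\ pt k = ((pt j).1, (pt i).2), pt l = ((pt i).1, (pt j).2) &
      ((pt i).1 < (pt j).1)%N -> ((pt i).2 < (pt j).2)%N ->
      inner_interval P (pt i) (pt j)].

Let pt_inj i j : pt i = pt j -> i = j.
Proof. by move/val_inj/enum_val_inj. Qed.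

Lemma generator_in_ideal (p : vertex_ring K P) :
  inner_binomial p -> p \in @polyomino_ideal K P.
Proof.
move=> gp; apply/asboolP; exists [:: (1, p)]; split; last first.
  by rewrite big_seq1 mul1r.
by move=> q; rewrite inE => /eqP ->.
Qed.

(** Up to the names of the corners this is a generator, or zero when the four
    corners are not distinct. *)
Lemma square_in_ideal i j k l : rw k = rw i -> cl k = cl j -> rw l = rw j ->
  cl l = cl i ->
  ('X_i * 'X_j - 'X_k * 'X_l : vertex_ring K P) \in @polyomino_ideal K P.
Proof.
have key i' j' k' l' : rw k' = rw i' -> cl k' = cl j' -> rw l' = rw j' -> cl l' = cl i' ->
    ((pt i').1 < (pt j').1)%N -> ((pt i').2 < (pt j').2)%N ->
    ('X_i' * 'X_j' - 'X_k' * 'X_l' : vertex_ring K P) \in @polyomino_ideal K P.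
  move=> rk ck rl cll lt1 lt2; have [Ek El inn] := labels_inner rk ck rl cll.
  apply: generator_in_ideal.
  exists (enum_val i'), (enum_val j'), (enum_val l'), (enum_val k'); split=> //.
    exact: inn.
  by rewrite /vertex_var !enum_valK ['X_l' * _]mulrC.
have idealN p : (- p \in @polyomino_ideal K P) = (p \in @polyomino_ideal K P).
  by rewrite rpredN.
move=> rk ck rl cll; have [Ek El inn] := labels_inner rk ck rl cll.
have [E1|ne1] := eqVneq (pt i).1 (pt j).1.
  have -> : k = i by apply: pt_inj; rewrite Ek -E1 -surjective_pairing.
  have -> : l = j by apply: pt_inj; rewrite El E1 -surjective_pairing.
  by rewrite subrr rpred0.
have [E2|ne2] := eqVneq (pt i).2 (pt j).2.
  have -> : k = j by apply: pt_inj; rewrite Ek E2 -surjective_pairing.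
  have -> : l = i by apply: pt_inj; rewrite El -E2 -surjective_pairing.
  by rewrite ['X_j * _]mulrC subrr rpred0.
move: ne1 ne2; rewrite !neq_ltn => /orP[lt1|lt1] /orP[lt2|lt2].
- exact: key.
- rewrite -idealN opprB ['X_k * _]mulrC ['X_i * _]mulrC.
  by apply: key; rewrite ?rk ?ck ?rl ?cll // Ek El.
- rewrite -idealN opprB.
  by apply: key; rewrite ?rk ?ck ?rl ?cll // Ek El.
- by rewrite ['X_i * _]mulrC ['X_k * _]mulrC; apply: key.
Qed.

Lemma residue_square a b c d w : rw c = rw a -> cl c = cl b -> rw d = rw b ->
  cl d = cl a ->
  @residue K P ('X_a * 'X_b * w) = residue ('X_c * 'X_d * w).
Proof.
move=> rc cc rd cd; rewrite [LHS]residueM [RHS]residueM; congr (_ * _).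
by apply/eqP; rewrite eq_residue square_in_ideal.
Qed.

Lemma residue_toric X p : @residue K P p = 0 -> @toric K n rw cl X p = 0.
Proof.
rewrite -residue0 => /eqP; rewrite eq_residue subr0 => /asboolP[s [Gs ->]].
rewrite /toric raddf_sum big_seq big1 //= => q /Gs [a [b [c [d [inn Ec Ed ->]]]]].
rewrite rmorphM rmorphB !rmorphM /= -![comp_mpoly _ _]/(toric X _) !toricXU.
have [|||r1 r2 r3 r4] := @inner_labels (enum_rank a) (enum_rank b) (enum_rank d) (enum_rank c);
  rewrite ?enum_rankK //.
by rewrite [X in _ - X]mulrC -(toric_square K X r1 r2 r3 r4) subrr mulr0.
Qed.

(** A crude bound; only its independence of [N] matters. *)
Lemma count_nmatchings N : (\sum_(k < N.+1) nmatchings rw cl (star rw cl setT) k <=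
  (n.+1 * 2 ^ n)%:R)%R.
Proof.
have le k : nmatchings rw cl (star rw cl setT) k <= ((k <= n) * 2 ^ n)%:R.
  rewrite /nmatchings -natz ler_nat; case: (leqP k n) => lt; rewrite ?mul1n ?mul0n.
    apply: leq_trans (max_card _) _.
    by rewrite -cardsT -powersetT card_powerset cardsT card_ord.
  rewrite leqn0 cards_eq0; apply/eqP/setP => s; rewrite !inE; apply/negbTE.
  apply: contraTN lt => /andP[/eqP <- _]; rewrite -leqNgt.
  by apply: leq_trans (max_card _) _; rewrite card_ord.
apply: (@le_trans _ _ (\sum_(k < N.+1) ((k <= n) * 2 ^ n)%:R)); first exact: ler_sum.
rewrite -natr_sum ler_nat -big_distrl /= leq_mul2r; apply/orP; right.
rewrite -(big_mkord xpredT (fun k => nat_of_bool (k <= n)%N)).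
elim: N.+1 => [|M IH]; first by rewrite big_geq.
rewrite big_nat_recr //=; case: (leqP M n) => [le'|lt]; last by rewrite addn0.
rewrite addn1 ltnS; apply: leq_trans le'.
rewrite -[X in (_ <= X)%N]subn0 -[X in (_ <= X)%N]muln1 -sum_nat_const_nat.
by apply: leq_sum => k _; case: (k <= n)%N.
Qed.

(** The count of normal monomials has a summable difference of order
    [n - #|star rw cl setT|], the star having finitely many matchings. *)
Lemma coordinate_ring_krull_dim :
  krull_dim (coordinate_ring K P) (n - #|star rw cl setT|).
Proof.
split; first exact: (toric_prime_chain rwcl_inj corner_unique (@residue_repr K P) residue_toric n0).
move=> e Q; apply: (@prime_chain_bound K n _ (@residue K P) _ (@residue_repr K P)
  (fun k => enum_fset (normal_mons rw cl setT k)) _ (n.+1 * 2 ^ n)%N).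
  move=> m; have [m' m'N E] := residue_normal gE residue_square (erefl (mdeg m)).
  by exists m'.
move=> N; have := @sum_le_iter_diff (n.+1 * 2 ^ n)%:R (n - #|star rw cl setT|)
  (nmons rw cl setT) (ler0n _ _) _ N.
rewrite -{1}[n in (n - _)%N]card_ord -cardsT iter_diff_nmons //.
move=> /(_ count_nmatchings).
rewrite -natrX -natrM -(ler_nat int) natr_sum; apply: le_trans.
by apply: ler_sum => k _; rewrite /nmons natz.
Qed.

(** The exponent of [1 - t] in the series is the number of differences that turns
    the count of normal monomials into that of normal matchings. *)
Theorem hilbert_numeratorE (h : {poly int}) : hilbert_numerator K P h <->
  forall k, h`_k = nmatchings rw cl (star rw cl setT) k.
Proof.
have dims := normal_mons_dim rwcl_inj gE (@residue_toric setT) residue_square.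
have numer k : nmatchings rw cl (star rw cl setT) k =
    \sum_(i < k.+1) ((1 - 'X) ^+ (n - #|star rw cl setT|) : {poly int})`_i *
      (#|` normal_mons rw cl setT (k - i)|)%:Z.
  by rewrite -iter_diff_nmons // iter_diffE cardsT card_ord.
split=> [[d [HF [[kd1 kd2] hdim hk]]] k|hk].
  have [[Q cQ] kd] := coordinate_ring_krull_dim.
  have Ed : d = (n - #|star rw cl setT|)%N.
    case: kd1 => Q' cQ'; apply/eqP; rewrite eqn_leq.
    by apply/andP; split; [exact: kd cQ'|exact: kd2 cQ].
  rewrite hk numer Ed; apply: eq_bigr => i _.
  by rewrite (subspace_dim_unique (hdim (k - i)%N) (dims (k - i)%N)).
exists (n - #|star rw cl setT|)%N, (fun k => #|` normal_mons rw cl setT k|); split=> //.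
  exact: coordinate_ring_krull_dim.
by move=> k; rewrite hk numer.
Qed.

End Numerator.

Local Close Scope ring_scope.

(** * Strips of a simple polyomino *)

Section Runs.
Variable f : nat -> bool.

(** The left end of the run of [f] that ends just before [x], or [x] itself when
    that run is empty: the cells of a run and the end point on its right have the
    same value. *)
Fixpoint lend x := if x is x'.+1 then if f x' then lend x' else x else 0.

Lemma lend_le x : lend x <= x.
Proof. by elim: x => //= x IH; case: (f x) => //; apply: leqW. Qed.

Lemma lend_run x z : lend x <= z < x -> f z.
Proof.
elim: x => [|x IH] //=.
case fx: (f x); last by case/andP=> /leq_trans H /H; rewrite ltnn.
by rewrite ltnS [z <= x]leq_eqVlt => /andP[le /predU1P[->//|lt]]; apply: IH; rewrite le.
Qed.

Lemma lend_stop x : 0 < lend x -> ~~ f (lend x).-1.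
Proof. by elim: x => //= x IH; case fx: (f x) => //=; rewrite fx. Qed.

Lemma lend_gt x z : ~~ f z -> z < x -> z < lend x.
Proof.
move=> fz lt; rewrite ltnNge; apply: contra fz => le.
by apply: (@lend_run x); rewrite le.
Qed.

Lemma lend_const x x' : x <= x' -> (forall z, x <= z < x' -> f z) -> lend x' = lend x.
Proof.
elim: x' => [|x' IH]; first by rewrite leqn0 => /eqP ->.
rewrite leq_eqVlt => /predU1P[-> //|lt] H /=.
rewrite (H x') ?ltnSn ?andbT // IH // => z /andP[z1 z2]; apply: H.
by rewrite z1 ltnW.
Qed.

Lemma lend_eq x x' z : lend x = lend x' -> x <= z < x' -> f z.
Proof.
move=> E /andP[z1 z2]; apply: (@lend_run x'); rewrite z2 andbT -E.
exact: leq_trans (lend_le _) z1.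
Qed.

Lemma lend_same a b : f a.+1 -> f b.+1 -> (lend a.+1 == lend b.+1) =
  all (fun i => f i.+1) (index_iota (minn a b) (maxn a b).+1).
Proof.
wlog le : a b / a <= b => [H fa fb|_ fb].
  case/orP: (leq_total a b) => le; first exact: H.
  by rewrite eq_sym minnC maxnC; apply: H.
rewrite (minn_idPl le) (maxn_idPr le); apply/eqP/allP => [El x|H].
  rewrite mem_index_iota ltnS [x <= b]leq_eqVlt => /andP[ax /predU1P[-> //|xb]].
  by apply: (lend_eq El); rewrite !ltnS ax xb.
apply/esym/lend_const => [|[//|x] /andP[]] //; rewrite !ltnS => ax xb.
by apply: H; rewrite mem_index_iota ax ltnS ltnW.
Qed.

End Runs.

(** Cells are addressed by their lower left corners. The symmetry between rows and
    columns is that of [transpose]. *)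
Notation region := (nat -> nat -> bool).

Definition transpose (A : region) : region := fun x y => A y x.
Definition swap (u : point) : point := (u.2, u.1).

(** The edge from [(x, y)] to [(x, y + 1)] lies between the cells [(x - 1, y)] and
    [(x, y)]; likewise [hedge A x y] is about the edge from [(x, y)] to
    [(x + 1, y)]. *)
Definition vedge (A : region) x y := A x y || A x.-1 y.
Definition hedge (A : region) x y := vedge (transpose A) y x.

Definition path_in (B : region) (c d : cell) := exists s,
  [/\ path share_edge c s, last c s = d & all (fun e => B e.1 e.2) (c :: s)].

(** The axes are kept free of cells, so that every run of cells has a cell of the
    complement at both of its ends. *)
Record simple_region (A : region) : Prop := SimpleRegion {
  axis_x : forall y, A 0 y = false;
  axis_y : forall x, A x 0 = false;
  bounded : exists N, forall x y, A x y -> x < N /\ y < N;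
  connected : forall c d, A c.1 c.2 -> A d.1 d.2 -> path_in A c d;
  coconnected : forall c d, ~~ A c.1 c.2 -> ~~ A d.1 d.2 ->
    path_in (fun x y => ~~ A x y) c d }.

Lemma path_in_transpose (B : region) c d : path_in B (swap c) (swap d) ->
  path_in (transpose B) c d.
Proof.
move=> [s [p l a]]; exists (map swap s).
have share_swap : {mono swap : x y / share_edge x y}.
  by move=> x y; rewrite /share_edge orbC /=.
have swapK : cancel swap swap by case.
split.
- by rewrite -(swapK c) (mono_path share_swap).
- by rewrite -(swapK c) last_map l swapK.
- by rewrite -(swapK c) -map_cons all_map.
Qed.

Lemma simple_transpose A : simple_region A -> simple_region (transpose A).
Proof.
move=> [a0 a1 [N bN] con coc]; split=> //.
- by exists N => x y /bN[].
- by move=> c d Ac Ad; apply/path_in_transpose/con.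
- by move=> c d Ac Ad; apply: (@path_in_transpose (fun x y => ~~ A x y)); apply: coc.
Qed.

(** A path of cells outside the region from the right end of a maximal
    horizontal run of cells to its left end closes up, through the run, to
    a loop. The parity of the number of vertical steps of the path to the right
    of a point changes exactly along the vertical edges of the cells of the run:
    this is the separation of the plane by a strip. *)
Section Cut.
Variables (A : region) (sA : simple_region A).

Definition vcross x y (c d : cell) :=
  [&& c.1 == d.1, x <= c.1 & (c.2.+1 == y) && (d.2 == y) || (d.2.+1 == y) && (c.2 == y)].

Fixpoint vparity x y c s :=
  if s is d :: s' then vcross x y c d (+) vparity x y d s' else false.

Lemma vcross_hedge x y c d : ~~ A c.1 c.2 -> ~~ A d.1 d.2 -> hedge A x y ->
  vcross x.+1 y c d = vcross x y c d.
Proof.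
move: c d => [c1 c2] [d1 d2] /= nc nd; rewrite /hedge /vedge /transpose /vcross /=.
case: (c1 =P d1) => //= E; subst d1.
have [->|ne] := eqVneq x c1; last by rewrite ltn_neqAle ne.
rewrite ltnn leqnn /= => /orP H; apply/esym/negbTE/negP.
by case/orP=> /andP[/eqP E1 /eqP E2]; subst y; rewrite E2 in nd nc *; move: H; rewrite /= ?(negbTE nc) ?(negbTE nd); case.
Qed.

Definition ray x y (c : cell) := (c.2 == y) && (x <= c.1).

(** The steps counted at [y] and [y.+1] are those into or out of the ray of cells
    from below and from above. The path cannot use its open end, between the cells
    [(x - 1, y)] and [(x, y)], since one of these is in the region. *)
Lemma vcross_vedge x y c d : ~~ A c.1 c.2 -> ~~ A d.1 d.2 -> vedge A x y ->
  share_edge c d ->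
  vcross x y c d (+) vcross x y.+1 c d = ray x y c (+) ray x y d.
Proof.
move: c d => [c1 c2] [d1 d2] /= nc nd; rewrite /vedge /vcross /ray /share_edge /= => H.
case/orP=> /andP[/eqP E].
  subst d1; rewrite eqxx /=; case: (x <= c1); rewrite /= ?andbF // !andbT !eqSS.
  case/orP=> /eqP E; subst.
    have -> : (c2.+2 == y) && (c2 == y) = false by apply/negbTE/negP; lia.
    have -> : (c2.+1 == y) && (c2 == y.+1) = false by apply/negbTE/negP; lia.
    by rewrite !andbb !orbF addbC.
  have -> : (d2.+2 == y) && (d2 == y) = false by apply/negbTE/negP; lia.
  have -> : (d2.+1 == y) && (d2 == y.+1) = false by apply/negbTE/negP; lia.
  by rewrite !andbb !orFb.
subst d2 => H1; have -> : (c1 == d1) = false by apply/negbTE/negP; move: H1; lia.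
rewrite /=; have [E2|ne] := eqVneq c2 y; last by [].
rewrite /=; apply/esym; subst c2.
case: (leqP x c1) => l1; case: (leqP x d1) => l2 //=.
  have E1 : c1.-1 = d1 by lia.
  have E2 : x = c1 by lia.
  by move: H; rewrite E2 E1 (negbTE nc) (negbTE nd).
have E1 : d1.-1 = c1 by lia.
have E2 : x = d1 by lia.
by move: H; rewrite E2 E1 (negbTE nc) (negbTE nd).
Qed.

Lemma vparity_hedge x y c s : all (fun e => ~~ A e.1 e.2) (c :: s) -> hedge A x y ->
  vparity x.+1 y c s = vparity x y c s.
Proof.
elim: s c => //= d s IH c /and3P[nc nd al] H.
by rewrite vcross_hedge // IH //= nd.
Qed.

Lemma vparity_vedge x y c s : all (fun e => ~~ A e.1 e.2) (c :: s) -> vedge A x y ->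
  path share_edge c s ->
  vparity x y c s (+) vparity x y.+1 c s = ray x y c (+) ray x y (last c s).
Proof.
elim: s c => [|d s IH] c; first by rewrite /= addbb.
move=> /= /and3P[nc nd al] H /andP[sh p].
have E1 : all (fun e => ~~ A e.1 e.2) (d :: s) by rewrite /= nd al.
by rewrite addbACA (vcross_vedge nc nd H sh) (IH d E1 H p) -addbA addKb.
Qed.

Theorem cut_exists (c : cell) : A c.1 c.2 -> ~~ A c.1.-1 c.2 ->
  exists s : region,
    (forall x y, hedge A x y -> s x.+1 y = s x y) /\
    (forall x y, vedge A x y ->
       s x y.+1 = s x y (+) (c == (lend (A^~ y) x, y))).
Proof.
move: c => [l b] /= Al Al1; have [N bN] := bounded sA.
have ex : exists z, (l <= z) && ~~ A z b.
  exists (l + N); rewrite leq_addr /=; apply/negP => /bN[]; rewrite ltnNge.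
  by rewrite leq_addl.
case: (ex_minnP ex) => hi /andP[lhi Ahi] minhi.
have l0 : 0 < l by rewrite lt0n; apply: contraTneq Al => ->; rewrite (axis_x sA).
have [s [ps ls als]] := coconnected sA (c := (hi, b)) (d := (l.-1, b)) Ahi Al1.
exists (fun x y => vparity x y (hi, b) s); split=> x y H.
  exact: vparity_hedge.
apply: (canRL (addKb _)); rewrite vparity_vedge // ls /ray /= xpair_eqE.
case: (b =P y) => [<-|_]; rewrite ?andbF //= andbT.
case: (ltnP x l) => xl.
  have -> : x <= hi by lia.
  have -> : x <= l.-1 by lia.
  by apply/esym/negbTE; rewrite neq_ltn orbC (leq_ltn_trans (lend_le _ _)).
have -> : (x <= l.-1) = false by lia.
rewrite addbF; case: (leqP x hi) => xhi.
  rewrite (lend_const xl) ?eqxx // => [|z /andP[z1 z2]].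
    have := @lend_gt (A^~ b) l l.-1 Al1; rewrite prednK // => /(_ (leqnn _)) ?.
    by apply/esym/eqP; have := lend_le (A^~ b) l; lia.
  by apply: contraLR z2 => Az; rewrite -leqNgt; apply: leq_trans xhi _ ; apply: minhi; rewrite z1.
by apply/esym/negbTE; rewrite neq_ltn; apply/orP; left; apply: leq_ltn_trans (lend_gt Ahi xhi).
Qed.

End Cut.

(** * Cuts and depths *)

Section Steps.
Variable A : region.
Implicit Types u v w : point.

Definition vstep u v := (u.1 == v.1) &&
  ((v.2 == u.2.+1) && vedge A u.1 u.2 || (u.2 == v.2.+1) && vedge A v.1 v.2).

(** A strip, that is a maximal horizontal run of cells, is named by its left end cell. *)
Definition strip x y : cell := (lend (A^~ y) x, y).
Definition crossed u v : cell := strip u.1 (minn u.2 v.2).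

Lemma vstep_height u v : vstep u v ->
  (u.2 == (crossed u v).2) || (u.2 == (crossed u v).2.+1).
Proof. by case/andP=> _ /orP[]/andP[/eqP E _]; rewrite /crossed /=; lia. Qed.

(** A row, that is a maximal horizontal run of edges, is named by its leftmost point. *)
Definition row_id u : point := (lend (hedge A ^~ u.2) u.1, u.2).

Lemma vstep_sym u v : vstep u v = vstep v u.
Proof. by rewrite /vstep eq_sym orbC; case: eqP => //= ->. Qed.

Lemma crossed_sym u v : vstep u v -> crossed u v = crossed v u.
Proof. by rewrite /crossed minnC => /andP[/eqP ->]. Qed.

End Steps.

Definition hstep A u v := vstep (transpose A) (swap u) (swap v).
Definition col_id A u := row_id (transpose A) (swap u).
Definition step A u v := vstep A u v || hstep A u v.

Lemma hstepE A u v : hstep A u v = (u.2 == v.2) &&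
  ((v.1 == u.1.+1) && hedge A u.1 u.2 || (u.1 == v.1.+1) && hedge A v.1 v.2).
Proof. by []. Qed.

Lemma step_transpose A u v : step (transpose A) (swap u) (swap v) = step A u v.
Proof. by rewrite /step orbC; case: u v => [? ?] [? ?]. Qed.

(** Connection to [v0] along the edges of the region. The set [Q] to be avoided
    serves to speak about the first point where a path enters a set. *)
Inductive reach A (v0 : point) (Q : pred point) : point -> Prop :=
| reach_root : ~~ Q v0 -> reach A v0 Q v0
| reach_step u v : reach A v0 Q u -> step A u v -> ~~ Q v -> reach A v0 Q v.

Lemma reachN A v0 Q u : reach A v0 Q u -> ~~ Q u.
Proof. by case. Qed.

Lemma first_entry A v0 (Q Q' : pred point) w : reach A v0 Q w -> Q' w -> ~~ Q' v0 ->
  exists u v, [/\ reach A v0 (predU Q Q') u, step A u v, ~~ Q v & Q' v].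
Proof.
move=> rw' Qw Q0.
have [//|] : (exists u v, [/\ reach A v0 (predU Q Q') u, step A u v, ~~ Q v & Q' v])
    \/ reach A v0 (predU Q Q') w.
  elim: rw' {Qw} => [nQ|u v ru IH st nQv].
    by right; apply: reach_root; rewrite /= negb_or nQ.
  case: IH => [|ru']; first by left.
  case: (boolP (Q' v)) => Qv; first by left; exists u, v.
  by right; apply: reach_step ru' st _; rewrite /= negb_or nQv.
by move/reachN; rewrite /= Qw orbT.
Qed.

(** For every strip, a two-colouring of the points that changes exactly across it. *)
Definition strip_cuts (A : region) (cut : cell -> region) := forall c,
  A c.1 c.2 -> ~~ A c.1.-1 c.2 ->
  (forall x y, hedge A x y -> cut c x.+1 y = cut c x y) /\
  (forall x y, vedge A x y -> cut c x y.+1 = cut c x y (+) (c == strip A x y)).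

Section Depth.
Variables (A : region) (sA : simple_region A) (v0 : point).
Variable cut : cell -> region.
Hypothesis cutP : strip_cuts A cut.
Variable N : nat.
Hypothesis bN : forall x y, A x y -> x < N /\ y < N.
Implicit Types (u v w : point) (c : cell).

Definition strip_end c := A c.1 c.2 && ~~ A c.1.-1 c.2.

(** Whether the strip [c] separates [u] from the root [v0]. *)
Definition far c u := cut c u.1 u.2 (+) cut c v0.1 v0.2.

Definition depth u := \sum_(c : 'I_N * 'I_N | strip_end (val c.1, val c.2))
  far (val c.1, val c.2) u.

Lemma far0 c : far c v0 = false.
Proof. exact: addbb. Qed.

Lemma strip_endP x y : vedge A x y -> strip_end (strip A x y).
Proof.
move=> H; rewrite /strip_end /strip /=.
have Al : A (lend (A^~ y) x) y.
  have := lend_le (A^~ y) x; rewrite leq_eqVlt => /predU1P[E|lt].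
    rewrite E; case/orP: H => // A1; case: x E A1 => //= x + A1; rewrite A1 => E.
    by have := lend_le (A^~ y) x; rewrite E ltnn.
  by apply: (@lend_run (A^~ y) x); rewrite leqnn.
rewrite Al; apply: (@lend_stop (A^~ y)); rewrite lt0n.
by apply: contraTneq Al => ->; rewrite (axis_x sA).
Qed.

Lemma crossed_end u v : vstep A u v -> strip_end (crossed A u v).
Proof.
case/andP=> /eqP E /orP[]/andP[/eqP E2 H]; rewrite /crossed E2.
  by rewrite (minn_idPl (leqnSn _)) strip_endP.
by rewrite (minn_idPr (leqnSn _)) E strip_endP.
Qed.

Lemma far_vstep c u v : strip_end c -> vstep A u v ->
  far c v = far c u (+) (c == crossed A u v).
Proof.
move=> /andP[c1 c2]; have [_ cv] := cutP c1 c2; case: u v => [x y] [x' y'].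
case/andP=> /= /eqP <- /orP[]/andP[/eqP -> /cv]; rewrite /far /crossed /= => ->.
  by rewrite (minn_idPl (leqnSn _)) addbAC.
by rewrite (minn_idPr (leqnSn _)) [in RHS]addbAC addbK.
Qed.

Lemma far_hstep c u v : strip_end c -> hstep A u v -> far c v = far c u.
Proof.
move=> /andP[c1 c2]; have [ch _] := cutP c1 c2; case: u v => [x y] [x' y'].
by rewrite hstepE /far => /andP[/= /eqP <- /orP[]/andP[/eqP -> /ch ->]].
Qed.

Lemma row_id_y u v : row_id A u = row_id A v -> u.2 = v.2.
Proof. by case. Qed.

Lemma row_idP u v : row_id A u = row_id A v -> forall z, u.1 <= z < v.1 -> hedge A z u.2.
Proof. by case=> + E; rewrite -E => H z; apply: lend_eq. Qed.

Lemma row_id_run y x x' : x <= x' -> (forall z, x <= z < x' -> hedge A z y) ->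
  row_id A (x', y) = row_id A (x, y).
Proof. by move=> le H; rewrite /row_id /= (lend_const le). Qed.

Lemma row_id_hstep u v : hstep A u v -> row_id A u = row_id A v.
Proof.
case: u v => [x y] [x' y']; rewrite hstepE => /andP[/= /eqP <- /orP[]/andP[/eqP -> H]].
  by apply/esym/row_id_run => // z; rewrite ltnS -eqn_leq => /eqP <-.
by apply/row_id_run => // z; rewrite ltnS -eqn_leq => /eqP <-.
Qed.

Lemma far_row c u v : strip_end c -> row_id A u = row_id A v -> far c u = far c v.
Proof.
move=> ec; wlog le : u v / u.1 <= v.1 => [H E|E].
  by case/orP: (leq_total u.1 v.1) => le; [apply: H|apply/esym/H].
have [] : u.2 = v.2 /\ forall z, u.1 <= z < v.1 -> hedge A z u.2.
  by split; [apply: row_id_y|apply: row_idP].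
case: u v le {E} => [x y] [x' y'] /= le <-.
elim: x' le => [|x' IH]; first by rewrite leqn0 => /eqP ->.
rewrite leq_eqVlt => /predU1P[-> //|lt] H; rewrite ltnS in lt.
rewrite IH // => [|z /andP[z1 z2]]; last by apply: H; rewrite z1 ltnW.
by apply/esym/(far_hstep ec); rewrite hstepE /= !eqxx H // lt ltnSn.
Qed.

(** A vertical segment only crosses a horizontal strip at the height of that
    strip. *)
Lemma far_segment c x y y' : strip_end c -> y <= y' ->
  (forall z, y <= z < y' -> vedge A x z) ->
  far c (x, y') = far c (x, y) (+) ((y <= c.2 < y') && (c == strip A x c.2)).
Proof.
move=> ec; elim: y' => [|y' IH].
  by rewrite leqn0 => /eqP -> _; rewrite ltn0 andbF addbF.
rewrite leq_eqVlt => /predU1P[-> _|lt H].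
  have -> : (y'.+1 <= c.2 < y'.+1) = false by apply/negbTE/negP; lia.
  by rewrite addbF.
rewrite ltnS in lt; have H' z : y <= z < y' -> vedge A x z.
  by case/andP=> z1 z2; apply: H; rewrite z1 ltnW.
have st : vstep A (x, y') (x, y'.+1).
  by rewrite /vstep /= !eqxx H // lt ltnSn.
rewrite (far_vstep ec st) (IH lt H') -addbA; congr (_ (+) _).
rewrite /crossed /= (minn_idPl (leqnSn _)).
have [E|ne] := eqVneq c.2 y'; last first.
  have -> : (c == strip A x y') = false by apply: contraNF ne => /eqP ->.
  by rewrite addbF ltnS [c.2 <= y']leq_eqVlt (negbTE ne).
by rewrite E lt ltnn ltnSn.
Qed.

Lemma column_edge u v : col_id A u = col_id A v ->
  forall y, minn u.2 v.2 <= y < maxn u.2 v.2 -> vedge A u.1 y.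
Proof.
case=> H E y; rewrite -E in H.
case: (leqP u.2 v.2) => le; last by apply: lend_eq.
by apply: lend_eq; rewrite H.
Qed.

Lemma far_column c u v : strip_end c -> col_id A u = col_id A v ->
  far c v = far c u (+) ((minn u.2 v.2 <= c.2 < maxn u.2 v.2) && (c == strip A u.1 c.2)).
Proof.
move=> ec; wlog le : u v / u.2 <= v.2 => [H E|E].
  case/orP: (leq_total u.2 v.2) => le; first exact: H.
  have E1 : u.1 = v.1 by case: E.
  by rewrite (H v u) // E1 minnC maxnC addbK.
have E1 : u.1 = v.1 by case: E.
have H := column_edge E; rewrite (minn_idPl le) (maxn_idPr le) in H *.
by have := far_segment ec le H; rewrite {1}E1 -!surjective_pairing.
Qed.

Lemma depth_row u v : row_id A u = row_id A v -> depth u = depth v.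
Proof. by move=> E; apply: eq_bigr => c ec; rewrite (far_row ec E). Qed.

Lemma depth0 : depth v0 = 0.
Proof. by rewrite /depth big1 // => c _; rewrite far0. Qed.

Lemma strip_end_ord c : strip_end c -> exists d : 'I_N * 'I_N, c = (val d.1, val d.2).
Proof.
by case: c => x y /andP[/bN[lx ly] _]; exists (Ordinal lx, Ordinal ly).
Qed.

Lemma depth_vstep u v : vstep A u v ->
  depth v + far (crossed A u v) u = depth u + far (crossed A u v) v.
Proof.
move=> st; have ec := crossed_end st; have [d Ed] := strip_end_ord ec.
have split w : depth w = far (crossed A u v) w +
    \sum_(c : 'I_N * 'I_N | strip_end (val c.1, val c.2) && (c != d)) far (val c.1, val c.2) w.
  by rewrite /depth (bigD1 d) /= -Ed.
rewrite (split u) (split v) addnAC [RHS]addnAC; congr (_ + _); first exact: addnC.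
apply: eq_bigr => c /andP[ec' ne]; rewrite (far_vstep ec' st).
case: eqP => [|_]; last by rewrite addbF.
rewrite Ed => -[] /val_inj E1 /val_inj E2.
by move: ne; rewrite [c]surjective_pairing E1 E2 -surjective_pairing eqxx.
Qed.

(** The strip crossed by the step separates [u] from the root, hence [v] is one step
    closer. Vertical steps lead from row to row, and the parents of the rows form
    a tree. *)
Definition parent u v := vstep A u v && far (crossed A u v) u.

Lemma far_parent u v : parent u v -> far (crossed A u v) v = false.
Proof.
case/andP=> st f; rewrite (far_vstep (crossed_end st) st) f eqxx; exact: addbb.
Qed.

Lemma depth_parent u v : parent u v -> depth u = (depth v).+1.
Proof.
move=> p; have := far_parent p; case/andP: p => st f f'.
by have := depth_vstep st; rewrite f f'; lia.
Qed.

(** A vertical step crosses exactly one strip, its own. *)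
Lemma parent_total u v : vstep A u v -> parent u v || parent v u.
Proof.
move=> st; rewrite /parent -(vstep_sym A u v) st -(crossed_sym st) /=.
by rewrite (far_vstep (crossed_end st) st) eqxx addbT orbN.
Qed.

Lemma parent_depth u v : vstep A u v -> depth v < depth u -> parent u v.
Proof.
by move=> st lt; case/orP: (parent_total st) => // /depth_parent; lia.
Qed.

(** Each side of a strip is contained in a single row. *)
Lemma same_side u u' w w' : vstep A u u' -> vstep A w w' ->
  crossed A u u' = crossed A w w' ->
  far (crossed A u u') u = far (crossed A u u') w ->
  row_id A u = row_id A w /\ row_id A u' = row_id A w'.
Proof.
move=> st st' E.
have key x x' b : lend (A^~ b) x = lend (A^~ b) x' ->
    row_id A (x, b) = row_id A (x', b) /\ row_id A (x, b.+1) = row_id A (x', b.+1).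
  wlog le : x x' / x <= x' => [H H'|H].
    case/orP: (leq_total x x') => le; first exact: H.
    by have [-> ->] := H x' x le (esym H').
  split; apply/esym/row_id_run => // z /(lend_eq H) Az;
    by rewrite /hedge /vedge /transpose /= Az ?orbT.
have ec := crossed_end st.
case: u u' w w' st st' E ec => [x y] [x1 y1] [x' y'] [x1' y1'].
move=> st st'; move: (st) (st'); rewrite /vstep /crossed /strip /=.
move=> /andP[/eqP <- H] /andP[/eqP <- H'] [El Em] ec.
have ff b z : strip_end (lend (A^~ b) z, b) -> vedge A z b ->
    far (lend (A^~ b) z, b) (z, b.+1) = ~~ far (lend (A^~ b) z, b) (z, b).
  move=> e ve; have st1 : vstep A (z, b) (z, b.+1) by rewrite /vstep /= !eqxx ve.
  rewrite (far_vstep e st1) /crossed /strip /= (minn_idPl (leqnSn _)) eqxx.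
  exact: addbT.
case/orP: H => /andP[/eqP Ey ve]; case/orP: H' => /andP[/eqP Ey' ve']; subst;
  rewrite ?(minn_idPl (leqnSn _)) ?(minn_idPr (leqnSn _)) in El Em ec *; subst.
- by move=> _; apply: key.
- have [K1 K2] := key _ _ _ El; rewrite (far_row ec K1).
  by rewrite El in ec *; rewrite (ff _ _ ec ve'); case: far.
- have [K1 K2] := key _ _ _ El; rewrite (far_row ec K2).
  by rewrite El in ec *; rewrite (ff _ _ ec ve'); case: far.
- by move=> _; have [] := key _ _ _ El.
Qed.

Lemma parent_side u u' w w' : parent u u' -> parent w w' ->
  crossed A u u' = crossed A w w' ->
  row_id A u = row_id A w /\ row_id A u' = row_id A w'.
Proof.
move=> /andP[s1 f1] /andP[s2 f2] E; apply: same_side => //.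
by rewrite f1 E f2.
Qed.

(** Suppose that two strips next to a row separate it from the root. A path from the
    root to the row crosses one of them first, and arrives in this very row while
    still on the near side of the other strip. *)
Lemma parent_strip u u' w w' : reach A v0 pred0 u -> row_id A u = row_id A w ->
  parent u u' -> parent w w' -> crossed A u u' = crossed A w w'.
Proof.
set c := crossed A u u'; set d := crossed A w w' => ru E pu pw.
have [su fu] := andP pu; have [sw fw] := andP pw.
have ec := crossed_end su; have ed := crossed_end sw.
apply/eqP; apply: contraT => ne.
have [a [b [ra st _ Qb]]] := first_entry (Q' := [pred z | far c z || far d z]) ru
  (introT orP (or_introl fu)) (ltac:(by rewrite /= !far0)).
have := reachN ra; rewrite /= negb_or => /andP[fca fda].
case/orP: st => st; last first.
  by move: Qb; rewrite /= !(far_hstep _ st) // (negbTE fca) (negbTE fda).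
have st' : vstep A b a by rewrite vstep_sym.
move: Qb; rewrite /= !(far_vstep _ st) // (negbTE fca) (negbTE fda) /=.
have fb e : e = crossed A a b -> strip_end e -> ~~ far e a -> far e b.
  by move=> Ee ee nf; rewrite (far_vstep ee st) Ee eqxx -Ee (negbTE nf).
case/orP=> /eqP Ee.
- have pb : parent b a by rewrite /parent st' -(crossed_sym st) -Ee fb.
  have [Er _] := parent_side pu pb (etrans Ee (crossed_sym st)).
  have := far_row ed (etrans (esym E) Er); rewrite fw (far_vstep ed st) (negbTE fda) -Ee.
  by rewrite eq_sym (negbTE ne).
- have pb : parent b a by rewrite /parent st' -(crossed_sym st) -Ee fb.
  have [Er _] := parent_side pw pb (etrans Ee (crossed_sym st)).
  have := far_row ec (etrans E Er); rewrite fu (far_vstep ec st) (negbTE fca) -Ee.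
  by rewrite (negbTE ne).
Qed.

(** A path from the root enters the row by a vertical step. If this step led towards
    the root, the path would have crossed the same strip before, in the other
    direction, and so would have visited the row already. *)
Lemma row_has_parent w : reach A v0 pred0 w -> row_id A w != row_id A v0 ->
  exists u u', row_id A u = row_id A w /\ parent u u'.
Proof.
move=> rw' ne.
have [a [b [ra st _ /= /eqP Eb]]] := first_entry (Q' := [pred z | row_id A z == row_id A w]) rw'
  (eqxx _) (ltac:(by rewrite /= eq_sym)).
have := reachN ra => /= na.
case/orP: st => st; last by move: na; rewrite (row_id_hstep st) Eb eqxx.
have st' : vstep A b a by rewrite vstep_sym.
case/orP: (parent_total st') => [pb|pa]; first by exists b, a.
have [_ fa] := andP pa; have ec := crossed_end st.
have [p [q [rp stp nq fq]]] := first_entry (Q' := [pred z | far (crossed A a b) z]) ra fa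
  (ltac:(by rewrite /= far0)).
have := reachN rp; rewrite /= negb_or => /andP[np fp].
case/orP: stp => stp; last by move: fq; rewrite /= (far_hstep ec stp) (negbTE fp).
have stp' : vstep A q p by rewrite vstep_sym.
have Ec : crossed A a b = crossed A p q.
  by apply/eqP; move: fq; rewrite /= (far_vstep ec stp) (negbTE fp).
have pq : parent q p by rewrite /parent stp' -(crossed_sym stp) -Ec.
have [_ Er] := parent_side pa pq (etrans Ec (crossed_sym stp)).
by move: np; rewrite -Er Eb eqxx.
Qed.

(** The rows of [u] and [z] are separated by a single strip, so the column from [u]
    to [z] crosses no other one. *)
Lemma parent_closed u w w' z : row_id A u = row_id A w -> parent w w' ->
  col_id A z = col_id A u -> row_id A z = row_id A w' -> parent u z.
Proof.
move=> Eu pw Ecol Ez.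
have Ew c : strip_end c -> far c u = far c z (+) (c == crossed A w w').
  move=> ec; rewrite (far_row ec Eu) (far_row ec Ez); case/andP: pw => st _.
  by rewrite (far_vstep ec st) addbK.
have x1 : u.1 = z.1 by case: Ecol.
have ved := column_edge (esym Ecol).
have ec0 := crossed_end (andP pw).1.
have ne : u.2 != z.2.
  apply/eqP => E; have := Ew _ ec0; rewrite eqxx [u]surjective_pairing x1 E -surjective_pairing.
  by case: far.
have cr y : minn u.2 z.2 <= y < maxn u.2 z.2 -> y = (crossed A w w').2.
  move=> yr; have ec := strip_endP (ved y yr).
  have := Ew _ ec; rewrite (far_column ec (esym Ecol)) /= yr eqxx /=.
  by have [/(congr1 snd) //|_] := eqVneq (strip A u.1 y) (crossed A w w'); case: far.
have mm : maxn u.2 z.2 = (minn u.2 z.2).+1.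
  have lt : minn u.2 z.2 < maxn u.2 z.2 by lia.
  have E1 := cr (minn u.2 z.2); have E2 := cr (minn u.2 z.2).+1.
  have {}E1 := E1 (ltac:(by rewrite leqnn lt)).
  case: (ltnP (minn u.2 z.2).+1 (maxn u.2 z.2)) => lt2; last by lia.
  have {}E2 := E2 (ltac:(by rewrite leqnSn lt2)).
  by lia.
have st : vstep A u z.
  rewrite /vstep x1 eqxx -x1 /=.
  have := ved (minn u.2 z.2); rewrite leqnn mm ltnSn => /(_ isT).
  case: (ltngtP u.2 z.2) mm ne => // lt.
    by move=> -> _ ->; rewrite eqxx.
  by move=> -> _ ->; rewrite eqxx orbT.
apply: parent_depth => //.
by rewrite (depth_row Eu) (depth_parent pw) (depth_row Ez).
Qed.

Lemma reach_vstep u v : reach A v0 pred0 u -> vstep A u v -> reach A v0 pred0 v.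
Proof. by move=> ru st; apply: reach_step ru _ _ => //; rewrite /step st. Qed.

Lemma parent_unique u v w : reach A v0 pred0 u -> parent u v -> parent u w -> v = w.
Proof.
move=> ru pv pw; have [] := parent_strip ru (erefl _) pv pw.
case: u v w pv pw {ru} => [x y] [x1 y1] [x2 y2] /andP[/andP[/= /eqP <- H1] _].
by move=> /andP[/andP[/= /eqP <- H2] _] _ E; congr pair; move: H1 H2 E; lia.
Qed.

(** Between two distinct points without parent there would be a point with two parents. *)
Lemma valley_unique v w : reach A v0 pred0 v -> col_id A v = col_id A w ->
  (forall z, ~~ parent v z) -> (forall z, ~~ parent w z) -> v = w.
Proof.
wlog le : v w / v.2 <= w.2 => [H rv E nv nw|rv E nv nw].
  case/orP: (leq_total v.2 w.2) => le; first exact: H.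
  apply/esym/H => //; have := column_edge (esym E); rewrite (minn_idPl le) (maxn_idPr le).
  have E1 : v.1 = w.1 by case: E.
  case: v w le rv E1 {H nv nw E} => [x y] [x' y'] /= le rv E1; rewrite -{}E1 {x'}.
  move: rv; rewrite -(subnKC le); elim: (y - y') => [|d IH]; rewrite ?addn0 // addnS => rv H.
  apply: IH => [|z /andP[z1 z2]]; last by apply: H; rewrite z1 ltnW.
  by apply: reach_vstep rv _; rewrite vstep_sym /vstep /= !eqxx H // leq_addr ltnSn.
have E1 : v.1 = w.1 by case: E.
have := column_edge E; rewrite (minn_idPl le) (maxn_idPr le).
case: v w le rv E1 nv nw {E} => [x y] [x' y'] /= le rv E1; rewrite -{}E1 {x'}.
rewrite -(subnKC le); case: (y' - y) => [|d] nv nw H; first by rewrite addn0.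
have climb k : k <= d -> reach A v0 pred0 (x, y + k) /\ parent (x, y + k.+1) (x, y + k).
  elim: k => [|k IH] lk.
    rewrite addn0 addn1; split=> //.
    have st : vstep A (x, y) (x, y.+1) by rewrite /vstep /= !eqxx H // leqnn; lia.
    by case/orP: (parent_total st) => //; rewrite (negbTE (nv _)).
  have [rk pk] := IH (ltnW lk).
  have rk1 : reach A v0 pred0 (x, y + k.+1).
    by apply: reach_vstep rk _; rewrite vstep_sym; case/andP: pk.
  split=> //; have st : vstep A (x, y + k.+1) (x, y + k.+2).
    by rewrite /vstep /= !addnS !eqxx -addnS H //; lia.
  case/orP: (parent_total st) => // p2.
  by have [] := parent_unique rk1 pk p2; lia.
by have [_ p] := climb d (leqnn _); move: (nw (x, y + d)); rewrite p.
Qed.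

(** A point has at most two vertical neighbours. *)
Lemma parent_fork w1 w2 v z : parent w1 v -> parent w2 v -> w1 != w2 -> ~~ parent v z.
Proof.
move=> p1 p2; apply: contraNN => p3.
have d1 := depth_parent p1; have d2 := depth_parent p2; have d3 := depth_parent p3.
have [E1|n1] := eqVneq w1 z; first by move: d1 d3; rewrite E1; lia.
have [E2|n2] := eqVneq w2 z; first by move: d2 d3; rewrite E2; lia.
case/andP: p1 => /andP[/eqP x1 y1] _; case/andP: p2 => /andP[/eqP x2 y2] _.
case/andP: p3 => /andP[/eqP x3 y3] _.
case: w1 w2 z v x1 x2 x3 y1 y2 y3 n1 n2 {d1 d2 d3} => [a1 b1] [a2 b2] [a3 b3] [a b] /=.
by move=> -> -> <- y1 y2 y3; rewrite !xpair_eqE eqxx /=; lia.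
Qed.

Lemma root_fork w1 w2 : ~~ vedge A v0.1 v0.2.-1 || (v0.2 == 0) ->
  parent w1 v0 -> parent w2 v0 -> w1 = w2.
Proof.
move=> bot /andP[/andP[/eqP x1 y1] _] /andP[/andP[/eqP x2 y2] _].
have up w : (v0.2 == w.2.+1) && vedge A w.1 w.2 || (w.2 == v0.2.+1) && vedge A v0.1 v0.2 ->
    w.1 = v0.1 -> w.2 = v0.2.+1.
  move=> + Ex; case/orP=> /andP[/eqP Ey ve] //.
  by move: bot; rewrite Ey /= -Ex ve.
have := up _ y1 x1; have := up _ y2 x2.
by case: w1 w2 x1 x2 {y1 y2} => [a b] [c d] /= -> -> -> ->.
Qed.

End Depth.

Section Mixed.
Variables (A : region) (sA : simple_region A) (v0 : point) (cut cut' : cell -> region).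
Hypothesis cutP : strip_cuts A cut.
Let A' := transpose A.
Hypothesis cut'P : strip_cuts A' cut'.
Variable N : nat.
Hypothesis bN : forall x y, A x y -> x < N /\ y < N.

Let sA' : simple_region A'.
Proof. exact: simple_transpose. Qed.

Local Notation far' := (far (swap v0) cut').
Local Notation far := (far v0 cut).
Local Notation vparent := (parent A v0 cut).
Local Notation hparent := (fun u v => parent A' (swap v0) cut' (swap u) (swap v)).

(** If a point is closest to the root in its row, then a path from the root to the
    strip that separates the row from the root meets the column of the point, still
    on the near side. So the column crosses the strip, which lies next to the row,
    and it does so at the point. *)
Lemma vparent_exists v : reach A v0 pred0 v -> (forall z, ~~ hparent v z) ->
  row_id A v != row_id A v0 -> exists z, vparent v z.
Proof.
move=> rv nv ne; have [u [u' [Eu pu]]] := row_has_parent sA cutP rv ne.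
(* [s] separates the row of [v] from the root; [a] to [b] is the first step over it *)
set s := crossed A u u' in pu; have [su fu] := andP pu.
have es := crossed_end sA su.
have fv : far s v by rewrite -(far_row v0 cutP es Eu).
have [a [b [ra st _ fb]]] := first_entry (Q' := [pred z | far s z]) rv fv
  (ltac:(by rewrite /= far0)).
have := reachN ra; rewrite /= => na.
case/orP: st => st; last by move: fb; rewrite /= (far_hstep v0 cutP es st) (negbTE na).
have Es : s = crossed A a b.
  by apply/eqP; move: fb; rewrite /= (far_vstep v0 cutP es st) (negbTE na).
have st' : vstep A b a by rewrite vstep_sym.
have pb : vparent b a.
  by rewrite /parent st' -(crossed_sym st) -Es.
have [Eb _] := parent_side sA cutP pu pb (etrans Es (crossed_sym st)).
have [Ebv|nbv] := eqVneq b v; first by exists a; rewrite -Ebv.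
have Evb : row_id A v = row_id A b by rewrite -Eu.
have y_eq := row_id_y Evb.
have nx : v.1 != b.1.
  apply: contraNneq nbv => E.
  by rewrite [b]surjective_pairing [v]surjective_pairing E y_eq.
have row_edge x : minn v.1 b.1 <= x < maxn v.1 b.1 -> hedge A x v.2.
  exact: (@column_edge A' (swap v) (swap b) Evb x).
(* the neighbour of [v] in the direction of [b], across the vertical strip [t] *)
pose v1 : point := (if v.1 < b.1 then v.1.+1 else v.1.-1, v.2).
have hs : hstep A v v1.
  rewrite hstepE /v1 /= eqxx; case: ltnP => lt /=.
    by rewrite eqxx row_edge // ; lia.
  have lt' : b.1 < v.1 by rewrite ltn_neqAle eq_sym nx.
  have vpos : 0 < v.1 := leq_ltn_trans (leq0n _) lt'.
  by rewrite (prednK vpos) eqxx (row_edge v.1.-1) ?orbT //; lia.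
set t := crossed A' (swap v) (swap v1).
have et : strip_end A' t := crossed_end sA' hs.
have ftv : far' t (swap v) = false.
  by apply/negbTE; apply: contra (nv v1) => f; rewrite /parent f andbT.
have ftb : far' t (swap b).
  rewrite (@far_column A' (swap v0) cut' cut'P t (swap v) (swap b) et Evb) ftv /=.
  rewrite /t /crossed /= eqxx andbT /v1 /=.
  move: nx; move: (v.1) (b.1); clear => x y ne.
  by case: (ltnP x y) => lt; lia.
have fta : far' t (swap a).
  by rewrite -(@far_hstep A' (swap v0) cut' cut'P t (swap a) (swap b) et st).
(* the path crosses [t] before it reaches [a], from a point [p] of the column of [v] *)
have [p [q [rp stp nq fq]]] := first_entry (Q' := [pred z | far' t (swap z)]) ra fta
  (ltac:(by rewrite /= far0)).
have := reachN rp; rewrite /= negb_or => /andP[nps npt].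
case/orP: stp => stp.
  by move: fq; rewrite /= (@far_hstep A' (swap v0) cut' cut'P t (swap p) (swap q) et stp) (negbTE npt).
have Et : t = crossed A' (swap p) (swap q).
  apply/eqP; move: fq.
  by rewrite /= (@far_vstep A' (swap v0) cut' cut'P t (swap p) (swap q) et stp) (negbTE npt).
have [Ecol _] := same_side (v0 := swap v0) sA' cut'P hs stp Et (etrans ftv (esym (negbTE npt))).
have Epv : col_id A p = col_id A v by [].
have := far_column v0 cutP es Epv; rewrite fv (negbTE nps) /= => /esym/andP[rng /eqP Es2].
have ve := column_edge Epv rng.
have px : p.1 = v.1 by case: Epv.
rewrite px in Es2 ve.
have vy : (v.2 == s.2) || (v.2 == s.2.+1).
  by rewrite -(row_id_y Eu); apply: vstep_height.
have go z : vstep A v z -> minn v.2 z.2 = s.2 -> vparent v z.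
  by move=> stz E; rewrite /parent stz /crossed E -Es2.
case: (eqVneq v.2 s.2) vy => [E _|_ /= /eqP E].
  exists (v.1, v.2.+1); apply: go; last by rewrite /= E; apply/minn_idPl.
  by rewrite /vstep /= !eqxx E ve.
exists (v.1, s.2); apply: go; last by rewrite /= E; apply/minn_idPr.
by rewrite /vstep /= E !eqxx ve orbT.
Qed.

End Mixed.

(** * An ordering without forbidden minors *)

Section Tree.
Variables (T : finType) (I : eqType).
Implicit Types (v w z : T).

(** The entries of a matrix whose rows and columns are the nodes of two rooted trees,
    with depths [dR] and [dC]: [vp] leads, in a column, to the entry in the parent
    row, and [hp], in a row, to the entry in the parent column. By [vp_valley] each
    column meets a subtree of the tree of rows, whose node closest to the root is
    called its valley; by [vp_fork] two branches can meet only there. *)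
Record tree_product (rid cid : T -> I) (dR dC : T -> nat) (vp hp : rel T) : Prop :=
  TreeProduct {
  ids_inj : forall v w, rid v = rid w -> cid v = cid w -> v = w;
  vp_cid : forall v w, vp v w -> cid v = cid w;
  hp_rid : forall v w, hp v w -> rid v = rid w;
  vp_depth : forall v w, vp v w -> dR v = (dR w).+1;
  hp_depth : forall v w, hp v w -> dC v = (dC w).+1;
  rid_depth : forall v w, rid v = rid w -> dR v = dR w;
  cid_depth : forall v w, cid v = cid w -> dC v = dC w;
  vp_rid : forall v v' w w', vp v v' -> vp w w' -> rid v = rid w -> rid v' = rid w';
  hp_cid : forall v v' w w', hp v v' -> hp w w' -> cid v = cid w -> cid v' = cid w';
  vp_closed : forall v w w' z, rid v = rid w -> vp w w' -> cid z = cid v ->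
    rid z = rid w' -> vp v z;
  hp_closed : forall v w w' z, cid v = cid w -> hp w w' -> rid z = rid v ->
    cid z = cid w' -> hp v z;
  vp_valley : forall v w, cid v = cid w -> (forall z, ~~ vp v z) ->
    (forall z, ~~ vp w z) -> v = w;
  hp_valley : forall v w, rid v = rid w -> (forall z, ~~ hp v z) ->
    (forall z, ~~ hp w z) -> v = w;
  vp_fork : forall v w1 w2 z, vp w1 v -> vp w2 v -> w1 != w2 -> ~~ vp v z;
  hp_fork : forall v w1 w2 z, hp w1 v -> hp w2 v -> w1 != w2 -> ~~ hp v z;
  orphan_root : forall v, (forall z, ~~ vp v z) -> (forall z, ~~ hp v z) ->
    dR v = 0 /\ dC v = 0 }.

Lemma tree_product_sym rid cid dR dC vp hp :
  tree_product rid cid dR dC vp hp -> tree_product cid rid dC dR hp vp.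
Proof.
move=> [H1 H2 H3 H4 H5 H6 H7 H8 H9 H10 H11 H12 H13 H14 H15 H16]; split=> //.
  by move=> v w E1 E2; apply: H1.
by move=> v nh nv; have [] := H16 v nv nh.
Qed.

Section OneSide.
Variables (rid cid : T -> I) (dR dC : T -> nat) (vp hp : rel T).
Hypothesis tp : tree_product rid cid dR dC vp hp.

Inductive hchain v : T -> Prop :=
| hchain_refl : hchain v v
| hchain_step w z : hp v w -> hchain w z -> hchain v z.

Lemma hchain_rid v w : hchain v w -> rid v = rid w.
Proof. by elim=> // x y z /(hp_rid tp) ->. Qed.

Lemma hchain_trans v w z : hchain v w -> hchain w z -> hchain v z.
Proof. by elim=> // x y w' h _ IH /IH; apply: hchain_step. Qed.

Lemma hchain1 v w : hp v w -> hchain v w.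
Proof. by move=> h; apply: hchain_step h _; apply: hchain_refl. Qed.

Lemma hchain_depth v w : hchain v w -> dC w <= dC v.
Proof. by elim=> // x y z /(hp_depth tp) -> _ /leqW. Qed.

Lemma hp_dec v : (exists w, hp v w) \/ (forall w, ~~ hp v w).
Proof. by case: (pickP (hp v)) => [w h|h]; [left; exists w|right=> w; rewrite h]. Qed.

(** The depth, in the tree of columns, of the valley of the row of [v]. *)
Definition reach_depth v := dC [arg min_(w < v | rid w == rid v) dC w].

Lemma reach_depth_le v w : rid v = rid w -> reach_depth v <= dC w.
Proof.
rewrite /reach_depth; case: arg_minnP => // m _ minm E.
by apply: minm; rewrite E.
Qed.

Lemma reach_depth_attained v : exists m,
  [/\ rid m = rid v, dC m = reach_depth v & forall z, ~~ hp m z].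
Proof.
rewrite /reach_depth; case: arg_minnP => // m /eqP Em minm; exists m; split=> // z.
apply/negP => h; have := minm z; rewrite -(hp_rid tp h) Em (hp_depth tp h) eqxx.
by move=> /(_ isT); rewrite ltnn.
Qed.

Lemma reach_depth_row v w : rid v = rid w -> reach_depth v = reach_depth w.
Proof.
move=> E; have [m [Em E1 _]] := reach_depth_attained v.
have [m' [Em' E2 _]] := reach_depth_attained w.
apply/eqP; rewrite eqn_leq; apply/andP; split.
  by rewrite -E2; apply: reach_depth_le; rewrite Em'.
by rewrite -E1; apply: reach_depth_le; rewrite Em.
Qed.

Lemma valley_depth v : (forall z, ~~ hp v z) -> dC v = reach_depth v.
Proof.
move=> nv; have [m [Em <- nm]] := reach_depth_attained v.
by rewrite (hp_valley tp Em nm nv).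
Qed.

Lemma hchain_valley v : exists m, hchain v m /\ forall z, ~~ hp m z.
Proof.
have [N] := ubnP (dC v); elim: N v => // N IH v lt.
case: (hp_dec v) => [[w h]|h]; last by exists v; split=> //; apply: hchain_refl.
have [|m [c nm]] := IH w; first by have := hp_depth tp h; lia.
by exists m; split=> //; apply: hchain_step h c.
Qed.

(** The valley of a row other than the root row has a parent, by [orphan_root], and
    this parent lies in the parent row. *)
Lemma vp_reach_depth v w : vp v w -> reach_depth w <= reach_depth v.
Proof.
move=> h; have [m [Em <- nm]] := reach_depth_attained v.
have dm : dR m != 0 by rewrite (rid_depth tp Em) (vp_depth tp h).
have [z hz] : exists z, vp m z.
  case: (pickP (vp m)) => [z hz|H]; first by exists z.
  have [d0 _] := orphan_root tp (fun z => negbT (H z)) nm.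
  by rewrite d0 in dm.
rewrite (cid_depth tp (vp_cid tp hz)); apply: reach_depth_le.
by apply/esym; exact: (vp_rid tp hz h Em).
Qed.

(** Following [hp] from both points, one meets the other, or both end in the valley
    of the row. *)
Lemma row_fork v w : rid v = rid w -> [\/ hchain v w, hchain w v |
  exists m p q, [/\ p != q, hchain v p /\ hp p m & hchain w q /\ hp q m]].
Proof.
have [N] := ubnP (dC v + dC w); elim: N v w => // N IH v w lt E.
have [->|ne] := eqVneq v w; first by constructor 1; apply: hchain_refl.
wlog le : v w lt E ne / dC w <= dC v => [H|].
  case/orP: (leq_total (dC w) (dC v)) => le; first exact: H.
  have lt' : dC w + dC v < N.+1 by rewrite addnC.
  have ne' : w != v by rewrite eq_sym.
  case: (H w v lt' (esym E) ne' le) => [c|c|[m [p [q [pq cp cq]]]]].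
  - by constructor 2.
  - by constructor 1.
  - by constructor 3; exists m, q, p; rewrite eq_sym.
case: (hp_dec v) => [[v' h]|nv]; last first.
  have [m [c nm]] := hchain_valley w.
  by constructor 2; rewrite (hp_valley tp _ nv nm) // -(hchain_rid c).
have [||c|c|[m [p [q [pq [cp hp_p] cq]]]]] := IH v' w.
- by have := hp_depth tp h; lia.
- by rewrite -(hp_rid tp h).
- by constructor 1; apply: hchain_step h c.
- have [[q [cq hq]]|Ew] : (exists q, hchain w q /\ hp q v') \/ w = v'.
    elim: c {lt E ne le IH h} => [x|x y z hxy _]; first by right.
    case=> [[q [cq hq]]|E]; left; last by exists x; split; [exact: hchain_refl|rewrite -E].
    by exists q; split=> //; apply: hchain_step hxy cq.
  + have [<-|nvq] := eqVneq q v; first by constructor 2.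
    constructor 3; exists v', v, q; split=> //; first by rewrite eq_sym.
    by split=> //; apply: hchain_refl.
  + by constructor 1; rewrite Ew; apply: hchain1.
- by constructor 3; exists m, p, q; split=> //; split=> //; apply: hchain_step h cp.
Qed.

(** The row of [w] comes at least as close to the root column as [z]. So it goes on
    along the columns that the row of [v] passes on its way to [z]. *)
Lemma transport v z w : hchain v z -> cid w = cid v -> reach_depth w <= dC z ->
  exists2 f, rid f = rid w & cid f = cid z.
Proof.
move=> c; elim: c w => [x|x y {}z h c IH] w E le; first by exists w.
have dw : reach_depth w < dC w.
  rewrite (cid_depth tp E) (hp_depth tp h) ltnS.
  exact: leq_trans le (hchain_depth c).
case: (hp_dec w) => [[w' hw]|nw]; last by rewrite (valley_depth nw) ltnn in dw.
have Ew := hp_rid tp hw.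
have [||f Ef Ef'] := IH w'.
- by exact: (hp_cid tp hw h E).
- by rewrite -(reach_depth_row Ew).
- by exists f; rewrite ?Ef.
Qed.

End OneSide.

Section Labels.
Variables (rid cid : T -> I) (dR dC : T -> nat) (vp hp : rel T).
Hypothesis tp : tree_product rid cid dR dC vp hp.
Let tp' := tree_product_sym tp.

Local Notation kR := (reach_depth rid dC).
Local Notation kC := (reach_depth cid dR).

Lemma vchain_reach_depth v w : hchain vp v w -> kR w <= kR v.
Proof. by elim=> // x y z h _ IH; apply: leq_trans IH (vp_reach_depth tp h). Qed.

Lemma hchain_reach_depth v w : hchain hp v w -> kC w <= kC v.
Proof. by elim=> // x y z h _ IH; apply: leq_trans IH (vp_reach_depth tp' h). Qed.

(** The root does not lie between two children in its column. *)
Hypothesis root_end : forall r w1 w2, dR r = 0 -> dC r = 0 -> vp w1 r -> vp w2 r ->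
  w1 = w2.

(** The case of [no_gamma] that [transport] does not settle: the ways of [e] and
    [b] to the valley join from two sides in their column, and so do those of [e]
    and [a] in their row. All these ways can be transported, so that an entry [g]
    has two children in its column and two in its row. By [vp_fork] and [hp_fork] it has no parent at all, so it is
    the root, with two children in its column. *)
Lemma no_double_fork e a b n q1 q2 m p1 p2 :
  rid a = rid e -> cid b = cid e -> kR b <= kR e -> kC a <= kC e ->
  q1 != q2 -> hchain vp e q1 -> vp q1 n -> hchain vp b q2 -> vp q2 n ->
  p1 != p2 -> hchain hp e p1 -> hp p1 m -> hchain hp a p2 -> hp p2 m -> False.
Proof.
move=> ra cb le1 le2 nq c1 h1 c2 h2 np d1 g1 d2 g2.
have en : hchain vp e n by apply: hchain_trans c1 (hchain1 h1).
have em : hchain hp e m by apply: hchain_trans d1 (hchain1 g1).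
have kn : kR e <= dC m by apply: reach_depth_le; exact: (hchain_rid tp em).
have km : kC e <= dR n by apply: reach_depth_le; exact: (hchain_rid tp' en).
have row x : hchain vp e x \/ hchain vp b x -> exists2 f, rid f = rid x & cid f = cid m.
  move=> cx; apply: (transport tp em).
    by case: cx => /(hchain_rid tp') <-.
  case: cx => /vchain_reach_depth le; apply: leq_trans le _ => //.
  exact: leq_trans le1 kn.
have col x : hchain hp e x \/ hchain hp a x -> exists2 f, cid f = cid x & rid f = rid n.
  move=> cx; apply: (transport tp' en).
    by case: cx => /(hchain_rid tp) <-.
  case: cx => /hchain_reach_depth le; apply: leq_trans le _ => //.
  exact: leq_trans le2 km.
have [g rg cg] := row n (or_introl en).
have [u1 ru1 cu1] := row q1 (or_introl c1); have [u2 ru2 cu2] := row q2 (or_intror c2).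
have [w1 cw1 rw1] := col p1 (or_introl d1); have [w2 cw2 rw2] := col p2 (or_intror d2).
have v1 : vp u1 g by apply: (vp_closed tp ru1 h1); rewrite ?cg ?cu1 ?rg.
have v2 : vp u2 g by apply: (vp_closed tp ru2 h2); rewrite ?cg ?cu2 ?rg.
have x1 : hp w1 g by apply: (hp_closed tp cw1 g1); rewrite ?rg ?rw1 ?cg.
have x2 : hp w2 g by apply: (hp_closed tp cw2 g2); rewrite ?rg ?rw2 ?cg.
have nu : u1 != u2.
  apply: contra nq => /eqP E; apply/eqP/(ids_inj tp); first by rewrite -ru1 E.
  by rewrite (vp_cid tp h1) (vp_cid tp h2).
have nw : w1 != w2.
  apply: contra np => /eqP E; apply/eqP/(ids_inj tp); last by rewrite -cw1 E.
  by rewrite (hp_rid tp g1) (hp_rid tp g2).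
have [r1 r2] := orphan_root tp (fun z => vp_fork tp z v1 v2 nu)
  (fun z => hp_fork tp z x1 x2 nw).
by move: nu; rewrite (root_end r1 r2 v1 v2) eqxx.
Qed.

Definition label_base := (\max_v dR v + \max_v dC v + #|T|).+1.
Local Notation M := label_base.

Definition class_index (id : T -> I) v := find (fun w => id w == id v) (enum T).

(** Rows whose valley is closer to the root column are later; among equally close
    ones, those closer to the root are later. The third digit only separates
    distinct rows. *)
Definition label (id : T -> I) (d k : T -> nat) v :=
  ((M.-1 - k v) * M + (M.-1 - d v)) * M + class_index id v.

Lemma class_index_lt id v : class_index id v < M.
Proof.
by apply: leq_ltn_trans (find_size _ _) _; rewrite -cardE ltnS leq_addl.
Qed.

Lemma class_index_inj id v w : class_index id v = class_index id w -> id v = id w.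
Proof.
have h x : has (fun w => id w == id x) (enum T).
  by apply/hasP; exists x; rewrite ?mem_enum.
move=> E; have /eqP <- := nth_find v (h v); have /eqP <- := nth_find v (h w).
by rewrite -/(class_index id v) -/(class_index id w) E.
Qed.

Lemma digit_lt a i b j : i < M -> j < M ->
  (a * M + i < b * M + j) = (a < b) || (a == b) && (i < j).
Proof.
move=> iM jM; case: (ltngtP a b) => [lt|lt|->] /=; last by rewrite ltn_add2l.
  have : a.+1 * M <= b * M by rewrite leq_mul2r lt orbT.
  by rewrite mulSn; lia.
have : b.+1 * M <= a * M by rewrite leq_mul2r lt orbT.
by rewrite mulSn; lia.
Qed.

Lemma label_lt id d k v w : k v < M -> k w < M -> d v < M -> d w < M ->
  label id d k v < label id d k w =
  [|| k w < k v, (k v == k w) && (d w < d v) |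
      [&& k v == k w, d v == d w & class_index id v < class_index id w]].
Proof.
move=> kv kw dv dw; have iv := class_index_lt id v; have iw := class_index_lt id w.
have E : forall x y, x < M -> y < M -> (M.-1 - x == M.-1 - y) = (x == y) by lia.
rewrite /label !digit_lt //; [|lia|lia].
have -> : (M.-1 - k v < M.-1 - k w) = (k w < k v) by lia.
have -> : (M.-1 - d v < M.-1 - d w) = (d w < d v) by lia.
have -> : ((M.-1 - k v) * M + (M.-1 - d v) == (M.-1 - k w) * M + (M.-1 - d w)) =
  (k v == k w) && (d v == d w).
  apply/eqP/andP => [H|[/eqP -> /eqP -> //]].
  have := digit_lt (M.-1 - k v) (i := M.-1 - d v) (M.-1 - k w) (j := M.-1 - d w).
  have := digit_lt (M.-1 - k w) (i := M.-1 - d w) (M.-1 - k v) (j := M.-1 - d v).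
  rewrite H !ltnn => H1 H2; have {}H1 := H1 _ _; have {}H2 := H2 _ _.
  by move: H1 H2; lia.
by rewrite E // -orbA -andbA.
Qed.

Lemma reach_depth_lt id d v : (forall w, d w < M) -> reach_depth id d v < M.
Proof. by move=> H; apply: H. Qed.

Lemma dR_lt v : dR v < M.
Proof. by rewrite /M ltnS -addnA; apply: leq_trans (leq_addr _ _); apply: leq_bigmax. Qed.

Lemma dC_lt v : dC v < M.
Proof.
by rewrite /M ltnS addnAC; apply: leq_trans (leq_addl _ _); apply: leq_bigmax.
Qed.

Definition row_label := label rid dR kR.
Definition col_label := label cid dC kC.

Lemma label_eq id d k v w : k v < M -> k w < M -> d v < M -> d w < M ->
  (id v = id w -> k v = k w /\ d v = d w) ->
  label id d k v = label id d k w <-> id v = id w.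
Proof.
move=> kv kw dv dw H; split=> [E|E].
  have := label_lt id kv kw dv dw; have := label_lt id kw kv dw dv.
  rewrite E ltnn => /esym/negbT; rewrite !negb_or => /and3P[a1 a2 a3].
  move=> /esym/negbT; rewrite !negb_or => /and3P[b1 b2 b3].
  apply: class_index_inj; move: a1 a2 a3 b1 b2 b3; lia.
have [Ek Ed] := H E; rewrite /label Ek Ed; congr (_ + _).
by apply: eq_find => x; rewrite E.
Qed.

Lemma row_label_eq v w : row_label v = row_label w <-> rid v = rid w.
Proof.
apply: label_eq; rewrite ?dR_lt ?reach_depth_lt //; try exact: dC_lt.
by move=> E; rewrite (reach_depth_row tp E) (rid_depth tp E).
Qed.

Lemma col_label_eq v w : col_label v = col_label w <-> cid v = cid w.
Proof.
apply: label_eq; rewrite ?dC_lt ?reach_depth_lt //; try exact: dR_lt.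
by move=> E; rewrite (reach_depth_row tp' E) (cid_depth tp E).
Qed.

Lemma row_label_lt v w : row_label v < row_label w -> kR w <= kR v.
Proof.
rewrite /row_label label_lt ?dR_lt ?reach_depth_lt //; try exact: dC_lt.
by lia.
Qed.

Lemma col_label_lt v w : col_label v < col_label w -> kC w <= kC v.
Proof.
rewrite /col_label label_lt ?dC_lt ?reach_depth_lt //; try exact: dR_lt.
by lia.
Qed.

Lemma vp_row_label v w : vp v w -> row_label v < row_label w.
Proof.
move=> h; rewrite /row_label label_lt ?dR_lt ?reach_depth_lt //; try exact: dC_lt.
have := vp_reach_depth tp h; have := vp_depth tp h; lia.
Qed.

Lemma hp_col_label v w : hp v w -> col_label v < col_label w.
Proof.
move=> h; rewrite /col_label label_lt ?dC_lt ?reach_depth_lt //; try exact: dR_lt.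
have := vp_reach_depth tp' h; have := hp_depth tp h; lia.
Qed.

Lemma vchain_row_label v w : hchain vp v w -> row_label v <= row_label w.
Proof. by elim=> // x y z /vp_row_label/ltnW h _; apply: leq_trans h. Qed.

Lemma hchain_col_label v w : hchain hp v w -> col_label v <= col_label w.
Proof. by elim=> // x y z /hp_col_label/ltnW h _; apply: leq_trans h. Qed.

(** Unless the forks of [no_double_fork] occur, [a] or [b] lies on the way from [e]
    to a valley, since later labels are closer to the valley, and [transport]
    along this way completes the rectangle. *)
Theorem no_gamma e a b : rid a = rid e -> cid b = cid e ->
  row_label e < row_label b -> col_label e < col_label a ->
  exists2 f, rid f = rid b & cid f = cid a.
Proof.
move=> ra cb lr lc; have le1 := row_label_lt lr; have le2 := col_label_lt lc.
case: (row_fork tp (esym ra)) => [ca|ca|[m [p1 [p2 [np [d1 g1] [d2 g2]]]]]].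
- apply: (transport tp ca cb); apply: leq_trans le1 _.
  by apply: reach_depth_le; apply/esym.
- by have := hchain_col_label ca; rewrite leqNgt lc.
case: (row_fork tp' (esym cb)) => [c|c|[n [q1 [q2 [nq [c1 h1] [c2 h2]]]]]].
- have [|f f1 f2] := transport tp' c ra; last by exists f.
  by apply: leq_trans le2 _; apply: reach_depth_le; apply/esym.
- by have := vchain_row_label c; rewrite leqNgt lr.
by case: (no_double_fork ra cb le1 le2 nq c1 h1 c2 h2 np d1 g1 d2 g2).
Qed.

(** The last entry of a row is its valley. *)
Lemma col_later v : (exists w, rid w = rid v /\ col_label v < col_label w) <-> exists w, hp v w.
Proof.
split=> [[w [E lt]]|[w h]]; last first.
  by exists w; rewrite (hp_rid tp h) hp_col_label.
case: (hp_dec hp v) => // nv; have [m [c nm]] := hchain_valley tp w.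
have := hchain_col_label c; rewrite -(hp_valley tp _ nv nm); first by rewrite leqNgt lt.
by rewrite -(hchain_rid tp c).
Qed.

Lemma row_later v : (exists w, cid w = cid v /\ row_label v < row_label w) <-> exists w, vp v w.
Proof.
split=> [[w [E lt]]|[w h]]; last first.
  by exists w; rewrite (vp_cid tp h) vp_row_label.
case: (hp_dec vp v) => // nv; have [m [c nm]] := hchain_valley tp' w.
have := vchain_row_label c; rewrite -(vp_valley tp _ nv nm); first by rewrite leqNgt lt.
by rewrite -(hchain_rid tp' c).
Qed.

End Labels.
End Tree.

(** * Rectangles of edges, and the shift away from the axes *)

Section PathIn.
Variable B : region.

Lemma path_in_refl c : B c.1 c.2 -> path_in B c c.
Proof. by exists [::]; rewrite /= andbT. Qed.

Lemma path_in_trans d c e : path_in B c d -> path_in B d e -> path_in B c e.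
Proof.
move=> [s [p <- a]] [t [q <- b]]; exists (s ++ t); split.
- by rewrite cat_path p.
- by rewrite last_cat.
- by move: a b; rewrite -cat_cons all_cat => -> /= /andP[].
Qed.

Lemma share_edge_sym c d : share_edge c d = share_edge d c.
Proof.
rewrite /share_edge [c.1 == d.1]eq_sym [c.2 == d.2]eq_sym.
by congr (_ && _ || _ && _); rewrite orbC.
Qed.

Lemma path_in_sym c d : path_in B c d -> path_in B d c.
Proof.
move=> [s [p <- a]]; exists (rev (belast c s)); split.
- rewrite rev_path; apply: sub_path p => x y; by rewrite share_edge_sym.
- by case: s {p a} => //= d' s; rewrite rev_cons last_rcons.
- by rewrite -rev_rcons -lastI all_rev.
Qed.

Lemma path_in_edge c d : B c.1 c.2 -> B d.1 d.2 -> share_edge c d -> path_in B c d.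
Proof. by move=> Bc Bd E; exists [:: d]; rewrite /= E Bc Bd. Qed.

End PathIn.

Section Filled.
Variables (A : region) (sA : simple_region A).

(** A path in the complement from a cell of the rectangle to a cell far away would
    cross a boundary edge between two cells outside the region. *)
Lemma rectangle_filled x1 x2 y1 y2 :
  (forall x, x1 <= x < x2 -> hedge A x y1 && hedge A x y2) ->
  (forall y, y1 <= y < y2 -> vedge A x1 y && vedge A x2 y) ->
  forall x y, x1 <= x < x2 -> y1 <= y < y2 -> A x y.
Proof.
move=> Hh Hv x y Hx Hy; apply: contraT => nA.
have [s [p l a]] := coconnected sA (c := (x, y)) (d := (0, 0)) nA
  (negbT (axis_x sA 0)).
suff [l1 l2] : x1 <= (last (x, y) s).1 < x2 /\ y1 <= (last (x, y) s).2 < y2.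
  move: l1 l2; rewrite l /= !leqn0 => /andP[/eqP x10 x2p] /andP[/eqP y10 y2p].
  have := Hh 0; rewrite x10 x2p y10 leqnn /hedge /vedge /transpose /= => /(_ isT).
  by rewrite !(axis_x sA).
elim: s x y Hx Hy p a {l nA} => [|[x' y'] s IH] x y Hx Hy //=.
move=> /andP[sh p] /and3P[nA nA' al].
suff [Hx' Hy'] : x1 <= x' < x2 /\ y1 <= y' < y2 by apply: IH; rewrite //= nA'.
have hx := Hh x Hx; have hy := Hv y Hy.
rewrite /hedge /vedge /transpose /= in nA nA' hx hy.
case/orP: sh => /andP[/= /eqP E H]; subst.
  split=> //; case/orP: H => /eqP E; subst.
    have [E2|ne] := eqVneq y.+1 y2; last by move: Hy ne; lia.
    by subst y2; move: hx; rewrite /= (negbTE nA) (negbTE nA') andbF.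
  have [E2|ne] := eqVneq y'.+1 y1; last by move: Hy ne; lia.
  by subst y1; move: hx; rewrite /= (negbTE nA) (negbTE nA').
split=> //; case/orP: H => /eqP E; subst.
  have [E2|ne] := eqVneq x.+1 x2; last by move: Hx ne; lia.
  by subst x2; move: hy; rewrite /= (negbTE nA) (negbTE nA') andbF.
have [E2|ne] := eqVneq x'.+1 x1; last by move: Hx ne; lia.
by subst x1; move: hy; rewrite /= (negbTE nA) (negbTE nA').
Qed.

End Filled.

(** Moving the polyomino away from the axes, so that each of its strips has
    a cell of the complement at both ends. *)
Definition up (u : point) : point := (u.1.+1, u.2.+1).

Definition shift (P : {fset cell}) : region :=
  fun x y => [&& 0 < x, 0 < y & (x.-1, y.-1) \in P].

Lemma shift_up P c : shift P (up c).1 (up c).2 = (c \in P).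
Proof. by rewrite /shift /= -surjective_pairing. Qed.

Lemma shift_upP P c : shift P c.1 c.2 -> exists2 d, d \in P & c = up d.
Proof. by case: c => [[|x] [|y]] //= H; exists (x, y). Qed.

Lemma share_up c d : share_edge (up c) (up d) = share_edge c d.
Proof. by rewrite /share_edge /= !eqSS. Qed.

Section Shift.
Variables (P : {fset cell}) (hP : polyomino P) (hsimple : simple P).
Local Notation A := (shift P).

Lemma cell_path_up (B : pred cell) (B' : region) c d :
  (forall e, e \in B -> B' (up e).1 (up e).2) -> cell_path B c d ->
  path_in B' (up c) (up d).
Proof.
move=> H [s [p l a]]; exists (map up s); split.
- rewrite path_map; apply: sub_path p => x y; by rewrite /= share_up.
- by rewrite last_map l.
- by rewrite -map_cons all_map; apply: sub_all a => e; apply: H.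
Qed.

Lemma shift_bounded : exists N, forall x y, A x y -> x < N /\ y < N.
Proof.
exists (\max_(c <- P) (c.1 + c.2)).+2 => x y H.
have [[a b] cP [-> ->]] := @shift_upP P (x, y) H.
have := @leq_bigmax_seq _ (enum_fset P) xpredT (fun c : cell => c.1 + c.2) (a, b) cP isT; rewrite /=; lia.
Qed.

Lemma shift_simple : simple_region A.
Proof.
have ax0 y : A 0 y = false by [].
have ax1 x : A x 0 = false by rewrite /shift andbF.
split=> //.
- exact: shift_bounded.
- move=> c d /shift_upP[c' cP ->] /shift_upP[d' dP ->].
  apply: (@cell_path_up (mem P)); last by have [_ con] := hP; apply: con.
  by move=> e eP; rewrite shift_up.
set B : region := fun x y => ~~ A x y.
suff H c : B c.1 c.2 -> path_in B c (0, 0).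
  by move=> c d Bc Bd; apply: path_in_trans (H c Bc) _; apply/path_in_sym/H.
have hax x : path_in B (x, 0) (0, 0).
  elim: x => [|x IH]; first by apply: path_in_refl; rewrite /B ax1.
  apply: path_in_trans IH; apply: path_in_edge; rewrite /B ?ax1 //.
  by rewrite /share_edge /= !eqxx ?orbT.
have vax y : path_in B (0, y) (0, 0).
  elim: y => [|y IH]; first by apply: path_in_refl.
  apply: path_in_trans IH; apply: path_in_edge => //.
  by rewrite /share_edge /= !eqxx ?orbT.
have [N bN] := shift_bounded.
case: c => [[|x] [|y]]; rewrite /= => Bc; [exact: hax|exact: vax|exact: hax|].
have cP : (x, y) \notin P by rewrite -shift_up.
have far : (N, 0) \notin P.
  by apply/negP; rewrite -shift_up => /bN[] /=; lia.
apply: path_in_trans (hax N.+1); apply: (@path_in_trans _ (up (N, 0))).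
  apply: (@cell_path_up (predC (mem P)) B (x, y) (N, 0)); last exact: hsimple.
  by move=> e eP; rewrite /B shift_up.
apply: path_in_edge; rewrite /B ?ax1 ?shift_up //.
by rewrite /share_edge /= !eqxx ?orbT.
Qed.

Let sA := shift_simple.

Lemma verticesP v : reflect
  (exists2 c, c \in P & [\/ v = c, v = (c.1.+1, c.2), v = (c.1, c.2.+1) | v = (c.1.+1, c.2.+1)])
  (v \in vertices P).
Proof.
rewrite /vertices; apply: (iffP (bigfcupP _ _ _ _)) => [[c]|[c cP H]].
  rewrite andbT => cP; rewrite !inE => /orP[/orP[/orP[]|]|] /eqP ->; exists c => //;
  by [constructor 1|constructor 2|constructor 3|constructor 4].
exists c; rewrite ?cP // !inE.
by case: H => ->; rewrite eqxx ?orbT.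
Qed.

Lemma up_vstep v z : vstep A (up v) z -> exists2 w, w \in vertices P & z = up w.
Proof.
have cellv x y : vedge A x y -> exists u w, [/\ u \in vertices P, w \in vertices P,
    (x, y) = up u & (x, y.+1) = up w].
  case/orP=> H.
    have [[a b] cP [-> ->]] := @shift_upP P (x, y) H.
    exists (a, b), (a, b.+1); split=> //; apply/verticesP; exists (a, b) => //.
      by constructor 1.
    by constructor 3.
  have [[a b] cP [E ->]] := @shift_upP P (x.-1, y) H.
  have -> : x = a.+2 by move: H E; case: (x) => // ; lia.
  exists (a.+1, b), (a.+1, b.+1); split=> //; apply/verticesP; exists (a, b) => //.
    by constructor 2.
  by constructor 4.
case: z => [x y] /andP[/= /eqP <- /orP[]/andP[/eqP E /cellv[u [w [u1 u2 u3 u4]]]]].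
  by exists w; rewrite // E -u4.
by exists u.
Qed.

End Shift.

(** * Labelling the vertices of a simple polyomino *)

Section Root.
Variables (P : {fset cell}) (hP : polyomino P) (hsimple : simple P).
Local Notation A := (shift P).
Let sA := shift_simple hP hsimple.

(** The root is the lower left corner of a lowest cell, so that no vertical edge
    leads down from it. *)
Lemma lowest_cell : exists2 c, c \in P & forall d, d \in P -> c.2 <= d.2.
Proof.
have [/fset0Pn[c0 c0P] _] := hP.
have ex : exists y, [exists c : P, (val c).2 == y].
  by exists c0.2; apply/existsP; exists [` c0P]%fset.
case: (ex_minnP ex) => y /existsP[c /eqP Ec] miny.
exists (val c); first exact: valP.
by move=> d dP; rewrite Ec; apply: miny; apply/existsP; exists [` dP]%fset.
Qed.

Lemma reach_cell v0 c : A c.1 c.2 -> reach A v0 pred0 c ->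
  [/\ reach A v0 pred0 (c.1.+1, c.2), reach A v0 pred0 (c.1, c.2.+1) &
      reach A v0 pred0 (c.1.+1, c.2.+1)].
Proof.
case: c => [x y] /= Ac rc.
have r1 : reach A v0 pred0 (x.+1, y).
  apply: reach_step rc _ _ => //; rewrite /step hstepE /hedge /vedge /transpose /= Ac.
  by rewrite !eqxx orbT.
have r2 : reach A v0 pred0 (x, y.+1).
  by apply: reach_step rc _ _ => //; rewrite /step /vstep /vedge /= Ac !eqxx.
split=> //; apply: reach_step r1 _ _ => //.
by rewrite /step /vstep /vedge /= Ac !eqxx orbT.
Qed.

Lemma reach_share v0 c d : A c.1 c.2 -> A d.1 d.2 -> share_edge c d ->
  reach A v0 pred0 c -> reach A v0 pred0 d.
Proof.
move=> Ac Ad sh rc; have [r1 r2 _] := reach_cell Ac rc.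
case: c d sh Ac Ad rc r1 r2 => [x y] [x' y'] /= sh Ac Ad rc r1 r2.
case/orP: sh => /andP[/= /eqP E /orP[]/eqP E']; subst => //.
  apply: reach_step rc _ _ => //.
  by rewrite /step /vstep /vedge /= Ad !eqxx orbT.
apply: reach_step rc _ _ => //.
by rewrite /step hstepE /hedge /vedge /transpose /= Ad !eqxx !orbT.
Qed.

Lemma reach_path v0 c s : path share_edge c s ->
  all (fun e => A e.1 e.2) (c :: s) -> reach A v0 pred0 c -> reach A v0 pred0 (last c s).
Proof.
elim: s c => [|d s IH] c //= /andP[sh p] /and3P[Ac Ad al] rc.
by apply: IH => //=; [rewrite Ad|apply: reach_share rc].
Qed.

Lemma reach_vertex c0 v : c0 \in P -> v \in vertices P -> reach A (up c0) pred0 (up v).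
Proof.
move=> c0P /verticesP[c cP Ev].
have Ac : A (up c).1 (up c).2 by rewrite shift_up.
have rc : reach A (up c0) pred0 (up c).
  have A0 : A (up c0).1 (up c0).2 by rewrite shift_up.
  have [s [p <- a]] := connected sA A0 Ac.
  by apply: reach_path => //; apply: reach_root.
have [r1 r2 r3] := reach_cell Ac rc.
by case: Ev => ->.
Qed.

Lemma reach_transpose B v0 u : reach B v0 pred0 u ->
  reach (transpose B) (swap v0) pred0 (swap u).
Proof.
elim=> [_|x y _ IH st _]; first exact: reach_root.
by apply: reach_step IH _ _; rewrite ?step_transpose.
Qed.

Lemma cuts_exist B (sB : simple_region B) : exists cut, strip_cuts B cut.
Proof.
have /choice[cut Hcut] c : exists s : region, B c.1 c.2 -> ~~ B c.1.-1 c.2 ->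
    (forall x y, hedge B x y -> s x.+1 y = s x y) /\
    (forall x y, vedge B x y -> s x y.+1 = s x y (+) (c == strip B x y)).
  case Bc: (B c.1 c.2); last by exists (fun _ _ => false).
  case Bc': (B c.1.-1 c.2); first by exists (fun _ _ => false).
  have [s Hs] := cut_exists sB (c := c) (ltac:(by rewrite Bc)) (negbT Bc').
  by exists s.
by exists cut.
Qed.

End Root.

Section FarSide.
Variables (B : region) (sB : simple_region B) (r : point) (cut : cell -> region) (N : nat).
Hypothesis cutP : strip_cuts B cut.
Hypothesis bN : forall x y, B x y -> x < N /\ y < N.
Local Notation depth := (depth B r cut N).

(** The depths on the two sides of a strip differ by one; [far_y] and [near_y] are
    the heights of the side away from the root and of the one towards it. *)
Definition upper_far x y := depth (x, y) < depth (x, y.+1).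
Definition far_y x y := if upper_far x y then y.+1 else y.
Definition near_y x y := if upper_far x y then y else y.+1.

Lemma far_sideP x y x' : B x y -> x' = x \/ x' = x.+1 ->
  parent B r cut (x', far_y x y) (x', near_y x y) /\
  crossed B (x', far_y x y) (x', near_y x y) = strip B x y.
Proof.
move=> Bxy cs.
have ve : vedge B x' y by rewrite /vedge; case: cs => -> /=; rewrite Bxy ?orbT.
have row z : z = y \/ z = y.+1 -> depth (x', z) = depth (x, z).
  move=> cz; case: cs => [-> //|->]; apply: (depth_row r cutP); apply: row_id_run => // t ht.
  have -> : t = x by move: ht; rewrite ltnS -eqn_leq => /eqP.
  by rewrite /hedge /vedge /transpose; case: cz => -> /=; rewrite Bxy ?orbT.
have st : vstep B (x', y) (x', y.+1) by rewrite /vstep /= !eqxx ve.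
have cr : strip B x' y = strip B x y.
  by rewrite /strip; case: cs => -> //=; rewrite Bxy.
have Eu : upper_far x y = (depth (x', y) < depth (x', y.+1)).
  by rewrite /upper_far -(row y) ?(row y.+1) //; [right|left].
rewrite /far_y /near_y Eu; case: ifP => lt.
  split; last by rewrite /crossed /= (minn_idPr (leqnSn _)).
  by apply: (parent_depth sB cutP bN) lt; rewrite vstep_sym.
split; last by rewrite /crossed /= (minn_idPl (leqnSn _)).
case/orP: (parent_total sB r cutP st) => // /(depth_parent sB cutP bN) E.
by move: lt; rewrite E ltnSn.
Qed.

End FarSide.

Section Labelling.
Variables (P : {fset cell}) (hP : polyomino P) (hsimple : simple P).
Local Notation A := (shift P).
Local Notation A' := (transpose A).
Local Notation n := #|{: vertices P}|.
Local Notation pt i := (val (enum_val (i : 'I_n))).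
Let sA := shift_simple hP hsimple.
Let sA' := simple_transpose sA.

Variables (c0 : cell) (c0P : c0 \in P) (low : forall d, d \in P -> c0.2 <= d.2).
Local Notation v0 := (up c0).
Variables (cut cut' : cell -> region) (N : nat).
Hypothesis cutP : strip_cuts A cut.
Hypothesis cut'P : strip_cuts A' cut'.
Hypothesis bN : forall x y, A x y -> x < N /\ y < N.
Let bN' x y : A' x y -> x < N /\ y < N.
Proof. by case/bN. Qed.

Local Notation U i := (up (pt i)).
Definition row_of (i : 'I_n) := row_id A (U i).
Definition col_of (i : 'I_n) := row_id A' (swap (U i)).
Definition row_depth (i : 'I_n) := depth A v0 cut N (U i).
Definition col_depth (i : 'I_n) := depth A' (swap v0) cut' N (swap (U i)).
Definition vpar (i j : 'I_n) := parent A v0 cut (U i) (U j).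
Definition hpar (i j : 'I_n) := parent A' (swap v0) cut' (swap (U i)) (swap (U j)).

Lemma up_inj : injective up.
Proof. by case=> [a b] [c d] [-> ->]. Qed.

Lemma swap_inj : injective swap.
Proof. by case=> [a b] [c d] [-> ->]. Qed.

Lemma U_inj (i j : 'I_n) : U i = U j -> i = j.
Proof. by move/up_inj/val_inj/enum_val_inj. Qed.

Lemma U_in (i : 'I_n) : pt i \in vertices P.
Proof. exact: valP. Qed.

Lemma U_surj v : v \in vertices P -> exists i : 'I_n, pt i = v.
Proof. by move=> vP; exists (enum_rank [` vP]%fset); rewrite enum_rankK. Qed.

Lemma reach_U i : reach A v0 pred0 (U i).
Proof. by apply: reach_vertex => //; apply: U_in. Qed.

Lemma reach_U' i : reach A' (swap v0) pred0 (swap (U i)).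
Proof. exact: reach_transpose (reach_U i). Qed.

Lemma no_vpar i : (forall j, ~~ vpar i j) -> forall z, ~~ parent A v0 cut (U i) z.
Proof.
move=> H z; apply/negP => p; have [st _] := andP p.
have [w wP Ez] := up_vstep st; have [j Ej] := U_surj wP.
by move: (H j); rewrite /vpar Ej -Ez p.
Qed.

Lemma up_hstep v z : hstep A (up v) z -> exists2 w, w \in vertices P & z = up w.
Proof.
have cellv x y : hedge A x y -> exists u w, [/\ u \in vertices P, w \in vertices P,
    (x, y) = up u & (x.+1, y) = up w].
  rewrite /hedge /vedge /transpose; case/orP=> H.
    have [[a b] cP [-> ->]] := @shift_upP P (x, y) H.
    exists (a, b), (a.+1, b); split=> //; apply/verticesP; exists (a, b) => //.
      by constructor 1.
    by constructor 2.
  have [[a b] cP [-> E]] := @shift_upP P (x, y.-1) H.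
  have -> : y = b.+2 by move: E; case: (y) => //= ? ->.
  exists (a, b.+1), (a.+1, b.+1); split=> //; apply/verticesP; exists (a, b) => //.
    by constructor 3.
  by constructor 4.
case: z => [x y]; rewrite hstepE.
move=> /andP[/= /eqP <- /orP[]/andP[/eqP E /cellv[u [w [u1 u2 u3 u4]]]]].
  by exists w; rewrite // E -u4.
by exists u.
Qed.

Lemma no_hpar i : (forall j, ~~ hpar i j) ->
  forall z, ~~ parent A' (swap v0) cut' (swap (U i)) (swap z).
Proof.
move=> H z; apply/negP => p; have [st _] := andP p.
have [w wP Ez] := up_hstep st; have [j Ej] := U_surj wP.
by move: (H j); rewrite /hpar Ej -Ez p.
Qed.

Lemma no_hpar' i : (forall j, ~~ hpar i j) ->
  forall z, ~~ parent A' (swap v0) cut' (swap (U i)) z.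
Proof. by move=> H [x y]; have := no_hpar H (y, x). Qed.

Lemma U_ids i j : row_of i = row_of j -> col_of i = col_of j -> i = j.
Proof.
move=> /row_id_y E1 /row_id_y /= E2; apply: U_inj.
by rewrite [U i]surjective_pairing E1 [(U i).1]E2.
Qed.

(** The row of such a vertex is the root row by [vparent_exists], and its column the
    root column. *)
Lemma orphan_v0 i : (forall j, ~~ vpar i j) -> (forall j, ~~ hpar i j) -> U i = v0.
Proof.
move=> nv nh.
have Er : row_id A (U i) = row_id A v0.
  apply/eqP; apply: contraT => ne.
  have [z p] := vparent_exists sA cutP cut'P (reach_U i) (no_hpar nh) ne.
  by move: (no_vpar nv z); rewrite p.
have Ec : row_id A' (swap (U i)) = row_id A' (swap v0).
  apply/eqP; apply: contraT => ne.
  have nv' z : ~~ parent (transpose A') (swap (swap v0)) cut (swap (swap (U i))) (swap z).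
    exact: (no_vpar nv (swap z)).
  have [z p] := @vparent_exists A' sA' (swap v0) cut' cut cut'P cutP _ (reach_U' i) nv' ne.
  by move: (no_hpar' nh z); rewrite p.
have E1 := row_id_y Er; have /= E2 := row_id_y Ec.
by rewrite [U i]surjective_pairing E1 [(U i).1]E2.
Qed.

Lemma polyomino_tree_product :
  tree_product row_of col_of row_depth col_depth vpar hpar.
Proof.
split.
- exact: U_ids.
- by move=> i j /andP[st _]; exact: (@row_id_hstep A' (swap (U i)) (swap (U j)) st).
- by move=> i j /andP[st _]; exact: (@row_id_hstep A (U i) (U j) st).
- by move=> i j; apply: depth_parent.
- by move=> i j; apply: depth_parent.
- by move=> i j; apply: depth_row.
- by move=> i j; apply: depth_row.
- move=> i i' j j' p q E; have Ec := parent_strip sA cutP (reach_U i) E p q.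
  by have [_] := parent_side sA cutP p q Ec.
- move=> i i' j j' p q E; have Ec := parent_strip sA' cut'P (reach_U' i) E p q.
  by have [_] := parent_side sA' cut'P p q Ec.
- by move=> i j j' z E p Ec Er; apply: (parent_closed sA cutP bN E p Ec Er).
- move=> i j j' z E p Er Ec.
  have Er' : col_id A' (swap (U z)) = col_id A' (swap (U i)) by exact: Er.
  exact: (parent_closed sA' cut'P bN' E p Er' Ec).
- move=> i j E ni nj; apply: U_inj.
  exact: (valley_unique sA cutP (reach_U i) E (no_vpar ni) (no_vpar nj)).
- move=> i j E ni nj; apply/U_inj/swap_inj.
  have E' : col_id A' (swap (U i)) = col_id A' (swap (U j)) by exact: E.
  exact: (valley_unique sA' cut'P (reach_U' i) E' (no_hpar' ni) (no_hpar' nj)).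
- move=> i j k z p q ne; apply: (parent_fork sA cutP bN (U z) p q).
  by apply: contra ne => /eqP/U_inj ->.
- move=> i j k z p q ne; apply: (parent_fork sA' cut'P bN' (swap (U z)) p q).
  by apply: contra ne => /eqP/swap_inj/U_inj ->.
- move=> i nv nh; have E := orphan_v0 nv nh.
  by rewrite /row_depth /col_depth E !depth0.
Qed.

Let tp := polyomino_tree_product.

Lemma polyomino_root_end r w1 w2 : row_depth r = 0 -> col_depth r = 0 ->
  vpar w1 r -> vpar w2 r -> w1 = w2.
Proof.
move=> dr dc p q.
have Er : U r = v0.
  apply: orphan_v0 => j; apply/negP => h.
    by have := vp_depth tp h; rewrite dr.
  by have := hp_depth tp h; rewrite dc.
apply: U_inj; apply: (root_fork (A := A) (v0 := v0) (cut := cut)).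
- apply/orP; left; apply/negP; rewrite /vedge => H.
  have low' x : ~~ A x (up c0).2.-1.
    apply/negP => H'; have [[a b] dP [_ E]] := @shift_upP P (x, _) H'.
    by have /= := low dP; move: E => /=; lia.
  by case/orP: H => H; exact: (negP (low' _) H).
- by move: p; rewrite /vpar Er.
- by move: q; rewrite /vpar Er.
Qed.

Definition rlabel := row_label row_of row_depth col_depth.
Definition clabel := col_label col_of row_depth col_depth.

Lemma rlabelE i j : rlabel i = rlabel j <-> row_of i = row_of j.
Proof. exact: (row_label_eq tp). Qed.

Lemma clabelE i j : clabel i = clabel j <-> col_of i = col_of j.
Proof. exact: (col_label_eq tp). Qed.

Lemma labels_inj i j : rlabel i = rlabel j -> clabel i = clabel j -> i = j.
Proof. by move=> /rlabelE E1 /clabelE E2; apply: U_ids. Qed.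

Lemma labels_gamma_free : gamma_free rlabel clabel [set: 'I_n].
Proof.
move=> e a b _ _ _ /rlabelE ra /clabelE cb lr lc.
have [f rf cf] := no_gamma tp polyomino_root_end (esym ra) (esym cb) lr lc.
by exists f => //; split; [apply/rlabelE|apply/clabelE].
Qed.

Lemma last_in_rowP i : last_in_row rlabel clabel i <-> forall j, ~~ hpar i j.
Proof.
have cl := col_later tp i; rewrite -/clabel in cl.
split=> [/forallP H j|H].
  apply/negP => h; have [w [/rlabelE Ew lt]] := cl.2 (ex_intro _ j h).
  by move: (H w); rewrite Ew eqxx leqNgt lt.
apply/forallP => a; apply/implyP => /eqP/rlabelE E; rewrite leqNgt; apply/negP => lt.
by have [j h] := cl.1 (ex_intro _ a (conj E lt)); move: (H j); rewrite h.
Qed.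

Lemma last_in_colP i : last_in_col rlabel clabel i <-> forall j, ~~ vpar i j.
Proof.
have rl := row_later tp i; rewrite -/rlabel in rl.
split=> [/forallP H j|H].
  apply/negP => h; have [w [/clabelE Ew lt]] := rl.2 (ex_intro _ j h).
  by move: (H w); rewrite Ew eqxx leqNgt lt.
apply/forallP => a; apply/implyP => /eqP/clabelE E; rewrite leqNgt; apply/negP => lt.
by have [j h] := rl.1 (ex_intro _ a (conj E lt)); move: (H j); rewrite h.
Qed.

Lemma labels_corner i j : last_in_row rlabel clabel i -> last_in_col rlabel clabel i ->
  last_in_row rlabel clabel j -> last_in_col rlabel clabel j -> i = j.
Proof.
move=> /last_in_rowP hi /last_in_colP vi /last_in_rowP hj /last_in_colP vj.
by apply: U_inj; rewrite (orphan_v0 vi hi) (orphan_v0 vj hj).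
Qed.

Lemma inner_intervalP a b : reflect [/\ a.1 < b.1, a.2 < b.2 & forall x y,
    a.1 <= x < b.1 -> a.2 <= y < b.2 -> (x, y) \in P] (inner_interval P a b).
Proof.
apply: (iffP and3P) => -[l1 l2 H]; split=> //.
  move=> x y hx hy; move/allP: H => /(_ x); rewrite mem_index_iota => /(_ hx) /allP.
  by move=> /(_ y); rewrite mem_index_iota => /(_ hy).
apply/allP => x; rewrite mem_index_iota => hx; apply/allP => y; rewrite mem_index_iota.
exact: H.
Qed.

Lemma inner_labels i j k l : inner_interval P (pt i) (pt j) ->
  pt k = ((pt j).1, (pt i).2) -> pt l = ((pt i).1, (pt j).2) ->
  [/\ rlabel k = rlabel i, clabel k = clabel j, rlabel l = rlabel j & clabel l = clabel i].
Proof.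
move=> /inner_intervalP[] + + + Ek El; case Ei : (pt i) => [x1 y1] /=.
case Ej : (pt j) => [x2 y2] /=; rewrite Ei Ej in Ek El; move=> lx ly inn.
have cellA x y : x1 < x <= x2 -> y1 < y <= y2 -> A x y.
  move=> hx hy; have [x' Ex] : exists x', x = x'.+1 by exists x.-1; lia.
  have [y' Ey] : exists y', y = y'.+1 by exists y.-1; lia.
  by rewrite Ex Ey (shift_up P (x', y')); apply: inn; lia.
have rowE y : y1 < y <= y2.+1 -> y = y1.+1 \/ y = y2.+1 ->
    row_id A (x2.+1, y) = row_id A (x1.+1, y).
  move=> hy cs; apply: row_id_run => [|x hx]; first by lia.
  rewrite /hedge /vedge /transpose /=; apply/orP; case: cs => Ey; [left|right]; apply: cellA; lia.
have colE x : x1 < x <= x2.+1 -> x = x1.+1 \/ x = x2.+1 ->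
    row_id A' (y2.+1, x) = row_id A' (y1.+1, x).
  move=> hx cs; apply: row_id_run => [|y hy]; first by lia.
  rewrite /hedge /vedge /transpose /=; apply/orP; case: cs => Ey; [left|right]; apply: cellA; lia.
split; [apply/rlabelE|apply/clabelE|apply/rlabelE|apply/clabelE];
  rewrite /row_of /col_of ?Ek ?El ?Ei ?Ej /up /swap /=.
- by apply: rowE; [lia|left].
- by apply/esym/colE; [lia|right].
- by apply/esym/rowE; [lia|right].
- by apply: colE; [lia|left].
Qed.

(** The sides of the rectangle consist of edges, and [rectangle_filled] applies. *)
Lemma labels_inner i j k l : rlabel k = rlabel i -> clabel k = clabel j ->
  rlabel l = rlabel j -> clabel l = clabel i ->
  [/\ pt k = ((pt j).1, (pt i).2), pt l = ((pt i).1, (pt j).2) &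
      (pt i).1 < (pt j).1 -> (pt i).2 < (pt j).2 -> inner_interval P (pt i) (pt j)].
Proof.
move=> /rlabelE rk /clabelE ck /rlabelE rl /clabelE cl.
have [Ey1] := row_id_y rk; have [Ex1] := row_id_y ck.
have [Ey2] := row_id_y rl; have [Ex2] := row_id_y cl.
have Ek : pt k = ((pt j).1, (pt i).2) by rewrite [pt k]surjective_pairing Ex1 Ey1.
have El : pt l = ((pt i).1, (pt j).2) by rewrite [pt l]surjective_pairing Ex2 Ey2.
split=> // lx ly; apply/inner_intervalP; split=> // x y hx hy.
rewrite -(shift_up P (x, y)).
have h1 := row_idP (esym rk); have h2 := row_idP rl.
have v1 := @row_idP A' _ _ (esym cl); have v2 := @row_idP A' _ _ ck.
move: h1 h2 v1 v2; rewrite Ek El /= => h1 h2 v1 v2.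
apply: (@rectangle_filled A sA (pt i).1.+1 (pt j).1.+1 (pt i).2.+1 (pt j).2.+1) => [z hz|z hz||] //.
  by rewrite h1 // h2.
by apply/andP; split; [exact: (v1 z hz)|exact: (v2 z hz)].
Qed.

(** ** Cells and their corners furthest from the root *)

Local Notation fy c := (far_y A v0 cut N c.1.+1 c.2.+1).
Local Notation ny c := (near_y A v0 cut N c.1.+1 c.2.+1).
Local Notation fx c := (far_y A' (swap v0) cut' N c.2.+1 c.1.+1).
Local Notation nx c := (near_y A' (swap v0) cut' N c.2.+1 c.1.+1).

Lemma far_near B r ct x y : (far_y B r ct N x y = y /\ near_y B r ct N x y = y.+1) \/
  (far_y B r ct N x y = y.+1 /\ near_y B r ct N x y = y).
Proof. by rewrite /far_y /near_y; case: ifP; [right|left]. Qed.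

Lemma corner_vertex c x y : c \in P -> x = c.1.+1 \/ x = c.1.+2 -> y = c.2.+1 \/ y = c.2.+2 ->
  exists i : 'I_n, U i = (x, y).
Proof.
move=> cP hx hy.
have vP : (x.-1, y.-1) \in vertices P.
  apply/verticesP; exists c => //; case: hx hy => -> [] -> /=.
  - by constructor 1; rewrite -surjective_pairing.
  - by constructor 3.
  - by constructor 2.
  - by constructor 4.
have [i Ei] := U_surj vP; exists i; rewrite Ei /up /=.
by case: hx hy => -> [] ->.
Qed.

Lemma cell_corners c : c \in P -> exists i j k : 'I_n,
  [/\ U i = (fx c, fy c), U j = (nx c, fy c) & U k = (fx c, ny c)] /\
  [/\ vpar i k, hpar i j, crossed A (U i) (U k) = strip A c.1.+1 c.2.+1 &
      crossed A' (swap (U i)) (swap (U j)) = strip A' c.2.+1 c.1.+1].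
Proof.
move=> cP; have Ac : A c.1.+1 c.2.+1 by rewrite -(shift_up P c) in cP.
have Fx := far_near A' (swap v0) cut' c.2.+1 c.1.+1.
have Fy := far_near A v0 cut c.1.+1 c.2.+1.
have [i Ei] : exists i : 'I_n, U i = (fx c, fy c).
  apply: (corner_vertex cP); [case: Fx => -[-> _]|case: Fy => -[-> _]]; by [left|right].
have [j Ej] : exists i : 'I_n, U i = (nx c, fy c).
  apply: (corner_vertex cP); [case: Fx => -[_ ->]|case: Fy => -[-> _]]; by [left|right].
have [k Ek] : exists i : 'I_n, U i = (fx c, ny c).
  apply: (corner_vertex cP); [case: Fx => -[-> _]|case: Fy => -[_ ->]]; by [left|right].
exists i, j, k; split=> //.
have [||pv cv] := @far_sideP A sA v0 cut N cutP bN c.1.+1 c.2.+1 (fx c).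
- exact: Ac.
- by case: Fx => -[-> _]; [left|right].
have [||ph ch] := @far_sideP A' sA' (swap v0) cut' N cut'P bN' c.2.+1 c.1.+1 (fy c).
- exact: Ac.
- by case: Fy => -[-> _]; [left|right].
by split; rewrite /vpar /hpar ?Ei ?Ej ?Ek.
Qed.

(** Having a later entry in the row means not being its valley. *)
Lemma starE i : (i \in star rlabel clabel [set: 'I_n]) <->
  (exists j, hpar i j) /\ (exists k, vpar i k).
Proof.
have cl := col_later tp i; have rl := row_later tp i.
rewrite -/clabel in cl; rewrite -/rlabel in rl.
split=> [/starP[_ [a [_ ra ca]] [b [_ cb rb]]]|[hj vk]].
  split; first exact: (cl.1 (ex_intro _ a (conj ((rlabelE _ _).1 ra) ca))).
  exact: (rl.1 (ex_intro _ b (conj ((clabelE _ _).1 cb) rb))).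
have [a [ra ca]] := cl.2 hj; have [b [cb rb]] := rl.2 vk.
apply/starP; split; first by rewrite inE.
  by exists a; rewrite inE; split=> //; apply/rlabelE.
by exists b; rewrite inE; split=> //; apply/clabelE.
Qed.

Lemma strip_same_row c d : c \in P -> d \in P ->
  (strip A c.1.+1 c.2.+1 == strip A d.1.+1 d.2.+1) = same_row P c d.
Proof.
rewrite -!(shift_up P) /= => Ac Ad; rewrite /strip xpair_eqE eqSS andbC /same_row.
by case: eqP => //= E; rewrite -E in Ad *; rewrite lend_same.
Qed.

Lemma strip_same_column c d : c \in P -> d \in P ->
  (strip A' c.2.+1 c.1.+1 == strip A' d.2.+1 d.1.+1) = same_column P c d.
Proof.
rewrite -!(shift_up P) /= => Ac Ad; rewrite /strip xpair_eqE eqSS andbC /same_column.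
by case: eqP => //= E; rewrite -E in Ad *; rewrite lend_same.
Qed.

Lemma far_end (d : nat -> nat) y F M z z' : F = y /\ M = y.+1 \/ F = y.+1 /\ M = y ->
  d F = (d M).+1 -> d z = (d z').+1 -> z' = z.+1 \/ z = z'.+1 -> minn z z' = y -> z = F.
Proof.
move=> FM dF dz zz Ey.
have {zz Ey}[[E1 E2]|[E1 E2]] : y = z /\ z' = z.+1 \/ y = z' /\ z = z'.+1.
  by case: zz => E; [left|right]; rewrite -Ey E; clear; lia.
all: by subst; case: FM => -[? ?]; subst=> //; lia.
Qed.

Lemma row_edges a b x : row_of a = row_of b ->
  minn (U a).1 (U b).1 <= x < maxn (U a).1 (U b).1 -> hedge A x (U a).2.
Proof. by move=> E; exact: (@column_edge A' (swap (U a)) (swap (U b)) E x). Qed.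

Lemma col_edges a b y : col_of a = col_of b ->
  minn (U a).2 (U b).2 <= y < maxn (U a).2 (U b).2 -> vedge A (U a).1 y.
Proof. by move=> E; exact: (@column_edge A (U a) (U b) E y). Qed.

Lemma vpar_coords i k : vpar i k -> (U k).1 = (U i).1 /\
  ((U k).2 = (U i).2.+1 \/ (U i).2 = (U k).2.+1).
Proof.
by move=> /andP[/andP[/eqP E H] _]; split=> //; case/orP: H => /andP[/eqP ? _]; [left|right].
Qed.

Lemma hpar_coords i j : hpar i j -> (U j).2 = (U i).2 /\
  ((U j).1 = (U i).1.+1 \/ (U i).1 = (U j).1.+1).
Proof.
by move=> /andP[/andP[/eqP E H] _]; split=> //; case/orP: H => /andP[/eqP ? _]; [left|right].
Qed.

Lemma unit_square_filled x y : hedge A x y -> hedge A x y.+1 -> vedge A x y ->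
  vedge A x.+1 y -> A x y.
Proof.
move=> h1 h2 v1 v2; apply: (@rectangle_filled A sA x x.+1 y y.+1);
  rewrite ?leqnn ?ltnSn // => z; rewrite ltnS -eqn_leq => /eqP <-; exact/andP.
Qed.

(** The step towards the root in the row and the one in the column span a unit
    square, whose fourth corner exists by [no_gamma]. *)
Lemma star_corner i : i \in star rlabel clabel [set: 'I_n] ->
  exists2 c, c \in P & U i = (fx c, fy c).
Proof.
move=> /starE[[j hj] [k vk]].
have Eij := hp_rid tp hj; have Eik := vp_cid tp vk.
have [f rf cf] : exists2 f, row_of f = row_of k & col_of f = col_of j.
  apply: (no_gamma tp polyomino_root_end (esym Eij) (esym Eik)).
    exact: (vp_row_label tp vk).
  exact: (hp_col_label tp hj).
have [jy jx] := hpar_coords hj; have [kx ky] := vpar_coords vk.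
have fy' : (U f).2 = (U k).2 := row_id_y rf.
have fx' : (U f).1 = (U j).1 := row_id_y cf.
set X := (U i).1 in jx kx; set Y := (U i).2 in jy ky.
set X' := (U j).1 in jx fx'; set Y' := (U k).2 in ky fy'.
pose x := minn X X'; pose y := minn Y Y'.
have hx : minn X X' <= x < maxn X X' by rewrite /x leqnn; case: jx; clear; lia.
have hy : minn Y Y' <= y < maxn Y Y' by rewrite /y leqnn; case: ky; clear; lia.
have h1 : hedge A x Y by apply: (row_edges Eij).
have h2 : hedge A x Y' by apply: (row_edges (esym rf)); rewrite kx fx'.
have v1 : vedge A X y by apply: (col_edges Eik).
have v2 : vedge A X' y by apply: (col_edges (esym cf)); rewrite jy fy'.
have Axy : A x y.
  apply: unit_square_filled.
  - by rewrite /y; case: ky => E; rewrite E ?(minn_idPl (leqnSn _)) ?(minn_idPr (leqnSn _)).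
  - have [<-|<-] : Y = y.+1 \/ Y' = y.+1 by rewrite /y; case: ky; clear; lia.
      exact: h1.
    exact: h2.
  - by rewrite /x; case: jx => E; rewrite E ?(minn_idPl (leqnSn _)) ?(minn_idPr (leqnSn _)).
  - have [<-|<-] : X = x.+1 \/ X' = x.+1 by rewrite /x; case: jx; clear; lia.
      exact: v1.
    exact: v2.
have [c cP [Ex Ey]] := @shift_upP P (x, y) Axy.
exists c => //; rewrite [U i]surjective_pairing -/X -/Y.
have Ac : A c.1.+1 c.2.+1 by rewrite -Ex -Ey.
have [||pv _] := @far_sideP A sA v0 cut N cutP bN c.1.+1 c.2.+1 X.
- exact: Ac.
- by rewrite -Ex /x; case: jx; clear; lia.
have [||ph _] := @far_sideP A' sA' (swap v0) cut' N cut'P bN' c.2.+1 c.1.+1 Y.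
- exact: Ac.
- by rewrite -Ey /y; case: ky; clear; lia.
have vk' : parent A v0 cut (X, Y) (X, Y').
  by move: vk; rewrite /vpar [U i]surjective_pairing [U k]surjective_pairing kx.
have hj' : parent A' (swap v0) cut' (Y, X) (Y, X').
  by move: hj; rewrite /hpar /swap jy.
congr pair.
  exact: (far_end (d := fun t => depth A' (swap v0) cut' N (Y, t)) (far_near _ _ _ _ _)
    (depth_parent sA' cut'P bN' ph) (depth_parent sA' cut'P bN' hj') jx Ex).
exact: (far_end (d := fun t => depth A v0 cut N (X, t)) (far_near _ _ _ _ _)
  (depth_parent sA cutP bN pv) (depth_parent sA cutP bN vk') ky Ey).
Qed.

(** A cell is recorded by its corner furthest from the root, where the far sides of
    its horizontal and its vertical strip meet. Two cells lie in the same strip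
    exactly when these corners lie in the same row: one strip has one far side by
    [parent_side], and a row has one strip towards the root by [parent_strip]. *)
Lemma cell_labelling : exists kap : cell -> 'I_n,
  [/\ forall c, c \in P -> kap c \in star rlabel clabel [set: 'I_n],
      forall i, i \in star rlabel clabel [set: 'I_n] -> exists2 c, c \in P & kap c = i,
      {in P &, forall c d, (rlabel (kap c) == rlabel (kap d)) = same_row P c d} &
      {in P &, forall c d, (clabel (kap c) == clabel (kap d)) = same_column P c d}].
Proof.
have [i0 _] := corner_vertex c0P (or_introl erefl) (or_introl erefl).
have /choice[kap Hkap] c : exists i : 'I_n, c \in P -> U i = (fx c, fy c).
  case cP: (c \in P); last by exists i0.
  by have [i [j [k [[Ei _ _] _]]]] := cell_corners cP; exists i.
have corners c : c \in P -> exists j k : 'I_n, [/\ vpar (kap c) k, hpar (kap c) j,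
    crossed A (U (kap c)) (U k) = strip A c.1.+1 c.2.+1 &
    crossed A' (swap (U (kap c))) (swap (U j)) = strip A' c.2.+1 c.1.+1].
  move=> cP; have [i [j [k [[Ei _ _] H]]]] := cell_corners cP.
  by exists j, k; have -> : kap c = i by apply: U_inj; rewrite Ei Hkap.
exists kap; split.
- move=> c cP; have [j [k [vk hj _ _]]] := corners c cP.
  by apply/starE; split; [exists j|exists k].
- move=> i /star_corner[c cP Ei]; exists c => //.
  by apply: U_inj; rewrite Ei Hkap.
- move=> c d cP dP; rewrite -strip_same_row //.
  have [_ [k [vk _ <- _]]] := corners c cP; have [_ [l [vl _ <- _]]] := corners d dP.
  apply/eqP/eqP => [/rlabelE E|E]; last first.
    by apply/rlabelE; have [] := parent_side sA cutP vk vl E.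
  exact: (parent_strip sA cutP (reach_U _) E vk vl).
- move=> c d cP dP; rewrite -strip_same_column //.
  have [k [_ [_ vk _ <-]]] := corners c cP; have [l [_ [_ vl _ <-]]] := corners d dP.
  apply/eqP/eqP => [/clabelE E|E]; last first.
    by apply/clabelE; have [] := parent_side sA' cut'P vk vl E.
  exact: (parent_strip sA' cut'P (reach_U' _) E vk vl).
Qed.

End Labelling.

(** * Switching classes of rook placements *)

Lemma card_equivalence_partition (T : finType) (e : rel T) (N : {set T}) :
  equivalence_rel e -> (forall x, exists2 y, y \in N & e x y) ->
  {in N &, forall x y, e x y -> x = y} -> #|equivalence_partition e setT| = #|N|.
Proof.
move=> eq_e ex un; rewrite -(card_in_imset (f := fun x => [set y in setT | e x y]) (D := N)).
  apply: eq_card => B; apply/imsetP/imsetP => -[x xT ->]; last by exists x.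
  have [y yN xy] := ex x; exists y => //; apply/setP => z; rewrite !inE /=.
  by have [_ H] := eq_e x y z; apply: H.
move=> x y xN yN /setP/(_ y); rewrite !inE /= (eq_e y y y).1.
exact: un.
Qed.

Section Rooks.
Variables (P : {fset cell}) (n : nat) (rw cl : 'I_n -> nat) (kap : cell -> 'I_n).
Local Notation E := (star rw cl [set: 'I_n]).
Local Notation A := (shift P).
Hypothesis sA : simple_region A.
Hypothesis rwcl_inj : forall i j, rw i = rw j -> cl i = cl j -> i = j.
Hypothesis gT : gamma_free rw cl [set: 'I_n].
Hypothesis kapE : forall c, c \in P -> kap c \in E.
Hypothesis kap_surj : forall i, i \in E -> exists2 c, c \in P & kap c = i.
Hypothesis kap_row : {in P &, forall c d, (rw (kap c) == rw (kap d)) = same_row P c d}.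
Hypothesis kap_col : {in P &, forall c d, (cl (kap c) == cl (kap d)) = same_column P c d}.
Let gE := gamma_free_star gT.

Lemma same_row2 c d : same_row P c d -> c.2 = d.2.
Proof. by case/andP=> /eqP. Qed.

Lemma same_column1 c d : same_column P c d -> c.1 = d.1.
Proof. by case/andP=> /eqP. Qed.

Lemma kap_inj : {in P &, injective kap}.
Proof.
move=> c d cP dP Ek; rewrite [c]surjective_pairing [d]surjective_pairing.
by rewrite (@same_column1 c d) ?(@same_row2 c d) // -?kap_row -?kap_col ?Ek.
Qed.

Lemma in_rook_sets k F : (F \in rook_sets P k) =
  [&& (F `<=` P)%fset, #|` F| == k & non_attacking P F].
Proof. by rewrite !inE /= fpowersetE. Qed.

Lemma non_attackingP F : reflect (forall c d, c \in F -> d \in F ->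
  same_row P c d \/ same_column P c d -> c = d) (non_attacking P F).
Proof.
apply: (iffP allP) => [H c d cF dF cd|H c cF].
  have /allP/(_ d dF)/implyP := H c cF; case: eqP => // _ /(_ isT).
  by case: cd => ->; rewrite ?andbF.
apply/allP => d dF; apply/implyP => ne; rewrite -negb_or.
by apply: contra ne => /orP cd; apply/eqP/H.
Qed.

(** A placement of rooks as a multiset of entries, so that the statements about
    monomials apply. *)
Definition mult (F : {fset cell}) (i : 'I_n) : nat := \sum_(c <- F) (kap c == i).
Definition corners F : {set 'I_n} := [set i | 0 < mult F i].

Lemma in_corners F i : reflect (exists2 c, c \in F & kap c = i) (i \in corners F).
Proof.
rewrite inE lt0n sum_nat_seq_neq0; apply: (iffP hasP) => -[c cF H]; exists c => //.
  by case: (kap c =P i) H.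
by rewrite /= H eqxx.
Qed.

Lemma corners_inj F F' : (F `<=` P)%fset -> (F' `<=` P)%fset ->
  corners F = corners F' -> F = F'.
Proof.
have sub G G' : (G `<=` P)%fset -> (G' `<=` P)%fset -> corners G = corners G' ->
    (G `<=` G')%fset.
  move=> /fsubsetP GP /fsubsetP GP' Ec; apply/fsubsetP => c cG.
  have : kap c \in corners G' by rewrite -Ec; apply/in_corners; exists c.
  by case/in_corners => d dG' /(kap_inj (GP' _ dG') (GP _ cG)) <-.
by move=> s s' Ec; apply/eqP; rewrite eqEfsubset (sub _ _ s s' Ec) (sub _ _ s' s (esym Ec)).
Qed.

Lemma card_corners F : (F `<=` P)%fset -> #|corners F| = #|` F|.
Proof.
move=> /fsubsetP FP; have -> : corners F = [set i in [seq kap c | c <- F]].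
  apply/setP => i; rewrite [RHS]inE; apply/in_corners/mapP => -[c cF] H; by exists c.
rewrite cardsE (card_uniqP _) ?size_map // map_inj_in_uniq ?fset_uniq //.
by move=> c d /FP cP /FP dP; apply: kap_inj.
Qed.

Lemma corners_sub F : (F `<=` P)%fset -> corners F \subset E.
Proof.
by move=> /fsubsetP FP; apply/subsetP => i /in_corners[c /FP/kapE cE <-].
Qed.

Lemma corners_matching F : (F `<=` P)%fset ->
  non_attacking P F = matching rw cl (corners F).
Proof.
move=> /fsubsetP FP; apply/non_attackingP/matchingP => H.
  move=> i j /in_corners[c cF <-] /in_corners[d dF <-] cd; congr kap; apply: H => //.
  by rewrite -kap_row ?FP // -kap_col ?FP //; case: cd => ->; [left|right].
move=> c d cF dF cd; apply: kap_inj; rewrite ?FP //; apply: H.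
- by apply/in_corners; exists c.
- by apply/in_corners; exists d.
- by move: cd; rewrite -kap_row ?FP // -kap_col ?FP // => -[]/eqP; [left|right].
Qed.

Lemma sum_mult F (Q : pred 'I_n) : \sum_(i | Q i) mult F i = \sum_(c <- F) Q (kap c).
Proof.
rewrite exchange_big /=; apply: eq_bigr => c _.
case Qc: (Q (kap c)).
  rewrite (bigD1 (kap c)) //= eqxx big1 // => i /andP[_ ne].
  by rewrite eq_sym (negbTE ne).
by rewrite big1 // => i Qi; case: eqP => // Ei; rewrite Ei Qi in Qc.
Qed.

(** ** Switches preserve the rows and columns of the rooks *)

Lemma sum_disjoint (X Y : {fset cell}) (g : cell -> nat) : [disjoint X & Y]%fset ->
  \sum_(c <- (X `|` Y)%fset) g c = \sum_(c <- X) g c + \sum_(c <- Y) g c.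
Proof.
move=> /fdisjointP dXY; rewrite -big_cat; apply: perm_big; apply: uniq_perm.
- exact: fset_uniq.
- rewrite cat_uniq !fset_uniq andbT /=; apply/hasPn => c cY.
  by apply/negP => /dXY; rewrite cY.
- by move=> c; rewrite mem_cat -in_fsetU.
Qed.

(** Equality of the sizes excludes that the new cells coincide or carry rooks
    already. *)
Lemma exchange_card (X Y F F' : {fset cell}) : exchange X Y F F' ->
  #|` F| = #|` F'| -> #|` Y| <= 2 -> [disjoint (F `\` X) & Y]%fset /\ #|` Y| = 2.
Proof.
move=> /and3P[/eqP cX XF /eqP EF'] cF cY.
have := cardfsUI (F `\` X)%fset Y; rewrite -EF' -cF.
have := cardfsD F X; rewrite (fsetIidPr XF) cX => -> H.
have := fsubset_leq_card XF; rewrite cX => le.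
have c0 : #|` ((F `\` X) `&` Y)%fset| = 0 by lia.
by split; [rewrite -fsetI_eq0 -cardfs_eq0 c0|lia].
Qed.

Lemma exchange_sum (X Y F F' : {fset cell}) (g : cell -> nat) : exchange X Y F F' ->
  #|` F| = #|` F'| -> #|` Y| <= 2 ->
  \sum_(c <- X) g c = \sum_(c <- Y) g c ->
  \sum_(c <- F) g c = \sum_(c <- F') g c.
Proof.
move=> H cF cY sXY; have /and3P[/eqP cX XF /eqP EF'] := H.
have FE : F = (X `|` (F `\` X))%fset by rewrite fsetUDl fsetDv fsetD0; apply/esym/fsetUidPr.
have dX : [disjoint X & (F `\` X)]%fset by apply/fdisjointP => x xX; rewrite inE xX.
have [dY _] := exchange_card H cF cY.
by rewrite EF' sum_disjoint // {1}FE sum_disjoint // sXY addnC.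
Qed.

Lemma inner_cell a b x y : inner_interval P a b -> a.1 <= x < b.1 -> a.2 <= y < b.2 ->
  (x, y) \in P.
Proof. by case/inner_intervalP => _ _; apply. Qed.

Lemma inner_row a b x x' y : inner_interval P a b -> a.1 <= x < b.1 ->
  a.1 <= x' < b.1 -> a.2 <= y < b.2 -> rw (kap (x, y)) = rw (kap (x', y)).
Proof.
move=> inn hx hx' hy; apply/eqP; rewrite kap_row; try exact: inner_cell inn _ _.
rewrite /same_row eqxx /=; apply/allP => z; rewrite mem_index_iota => hz.
by apply: (inner_cell inn) => //; lia.
Qed.

Lemma inner_column a b x y y' : inner_interval P a b -> a.1 <= x < b.1 ->
  a.2 <= y < b.2 -> a.2 <= y' < b.2 -> cl (kap (x, y)) = cl (kap (x, y')).
Proof.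
move=> inn hx hy hy'; apply/eqP; rewrite kap_col; try exact: inner_cell inn _ _.
rewrite /same_column eqxx /=; apply/allP => z; rewrite mem_index_iota => hz.
by apply: (inner_cell inn) => //; lia.
Qed.

Lemma cardfs_pair (c d : cell) : #|` [fset c; d]%fset| <= 2.
Proof. by rewrite cardfs2; case: eqP. Qed.

Lemma sum_pair (c d : cell) (g : cell -> nat) : #|` [fset c; d]%fset| == 2 ->
  \sum_(e <- [fset c; d]%fset) g e = g c + g d.
Proof.
rewrite cardfs2 eqSS eqb1 => ne.
have nin : c \notin [fset d]%fset by rewrite inE.
by rewrite big_fsetU1 //= big_seq_fset1.
Qed.

(** The same numbers of rooks in all rows and columns of vertices. *)
Definition same_lines F F' :=
  (forall r, \sum_(i | rw i == r) mult F i = \sum_(i | rw i == r) mult F' i) /\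
  (forall c, \sum_(i | cl i == c) mult F i = \sum_(i | cl i == c) mult F' i).

Lemma pred_between x b : x < b -> x <= b.-1 < b.
Proof. lia. Qed.

Lemma rook_set_card k (F : rook_sets P k) : #|` val F| = k.
Proof. by have := valP F; rewrite in_rook_sets => /and3P[_ /eqP]. Qed.

Lemma switch_same_lines k (F F' : rook_sets P k) : switch F F' -> same_lines (val F) (val F').
Proof.
move=> /existsP[a /existsP[b /andP[inn H]]].
have cF : #|` val F| = #|` val F'| by rewrite !rook_set_card.
have [l1 l2 _] := inner_intervalP _ _ _ inn.
set x1 := (val a).1 in l1; set x2 := (val b).1.-1; set y1 := (val a).2 in l2.
set y2 := (val b).2.-1.
have hx1 : x1 <= x1 < (val b).1 by rewrite leqnn.
have hx2 : x1 <= x2 < (val b).1 by apply: pred_between.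
have hy1 : y1 <= y1 < (val b).2 by rewrite leqnn.
have hy2 : y1 <= y2 < (val b).2 by apply: pred_between.
have r1 := inner_row inn hx1 hx2 hy1; have r2 := inner_row inn hx1 hx2 hy2.
have c1 := inner_column inn hx1 hy1 hy2; have c2 := inner_column inn hx2 hy1 hy2.
have Ea : val a = (x1, y1) by rewrite -surjective_pairing.
have key X Y : exchange X Y (val F) (val F') -> (X = diagonal_cells (val a) (val b) /\
    Y = antidiagonal_cells (val a) (val b)) \/ (Y = diagonal_cells (val a) (val b) /\
    X = antidiagonal_cells (val a) (val b)) -> same_lines (val F) (val F').
  move=> ex EXY.
  have cX : #|` X| == 2 by case/and3P: ex.
  have cY2 : #|` Y| <= 2 by case: EXY => -[EX EY]; rewrite ?EX ?EY; apply: cardfs_pair.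
  have [_ /eqP cY] := exchange_card ex cF cY2.
  have sums g : g (kap (x1, y1)) + g (kap (x2, y2)) = g (kap (x1, y2)) + g (kap (x2, y1)) ->
      \sum_(c <- val F) g (kap c) = \sum_(c <- val F') g (kap c).
    move=> Eg; apply: (exchange_sum (g := fun c => g (kap c)) ex cF cY2).
    case: EXY cX cY => -[-> ->] cX cY; rewrite (sum_pair _ cX) (sum_pair _ cY) /= Ea //.
  split=> l; rewrite !sum_mult.
    by apply: (sums (fun i => nat_of_bool (rw i == l))); rewrite r1 r2 addnC.
  by apply: (sums (fun i => nat_of_bool (cl i == l))); rewrite c1 c2.
case/orP: H => ex; apply: (key _ _ ex); [by left|by right].
Qed.

Lemma connect_same_lines k (F F' : rook_sets P k) :
  connect (@switch P k) F F' -> same_lines (val F) (val F').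
Proof.
move=> /connectP[s p ->]; elim: s F p => [|G s IH] F //= /andP[sw p].
have [r1 c1] := switch_same_lines sw; have [r2 c2] := IH G p.
by split=> l; [rewrite r1 r2|rewrite c1 c2].
Qed.

(** ** Every placement can be switched to a normal one *)

(** The outer sides of the four runs of cells are edges, and bound the rectangle. *)
Lemma rectangle_cells x1 x2 y1 y2 : x1 < x2 -> y1 < y2 ->
  same_row P (x1, y1) (x2, y1) -> same_row P (x1, y2) (x2, y2) ->
  same_column P (x1, y1) (x1, y2) -> same_column P (x2, y1) (x2, y2) ->
  inner_interval P (x1, y1) (x2.+1, y2.+1).
Proof.
move=> lx ly; rewrite /same_row /same_column /= !eqxx /=.
rewrite !(minn_idPl (ltnW lx)) !(maxn_idPr (ltnW lx)) !(minn_idPl (ltnW ly)) !(maxn_idPr (ltnW ly)).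
move=> /allP h1 /allP h2 /allP v1 /allP v2.
have run x y : A x.+1 y.+1 = ((x, y) \in P) by exact: (shift_up P (x, y)).
apply/inner_intervalP; split=> /= [||x y hx hy]; [by apply: leqW|by apply: leqW|].
rewrite -run; apply: (@rectangle_filled A sA x1.+1 x2.+2 y1.+1 y2.+2) => //.
  move=> [//|z] hz; rewrite /hedge /vedge /transpose /= !run.
  by rewrite h1 ?h2 ?orbT // mem_index_iota.
move=> [//|z] hz; rewrite /vedge /= !run.
by rewrite v1 ?v2 ?orbT // mem_index_iota.
Qed.

Lemma lower_corner x y : (x, y) \in P -> (x, y) \in vertices P.
Proof. by move=> cP; apply/verticesP; exists (x, y) => //; constructor 1. Qed.

Lemma upper_corner x y : (x, y) \in P -> (x.+1, y.+1) \in vertices P.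
Proof. by move=> cP; apply/verticesP; exists (x, y) => //; constructor 4. Qed.

Lemma opposite_pairs ca cb cc cd :
  ca \in P -> cb \in P -> cc \in P -> cd \in P ->
  rw (kap cc) = rw (kap ca) -> cl (kap cc) = cl (kap cb) ->
  rw (kap cd) = rw (kap cb) -> cl (kap cd) = cl (kap ca) ->
  ca.1 != cb.1 -> ca.2 != cb.2 ->
  exists a b : vertices P, inner_interval P (val a) (val b) /\
    (([fset ca; cb] = diagonal_cells (val a) (val b) /\
      [fset cc; cd] = antidiagonal_cells (val a) (val b)) \/
     ([fset ca; cb] = antidiagonal_cells (val a) (val b) /\
      [fset cc; cd] = diagonal_cells (val a) (val b)))%fset.
Proof.
move=> aP bP cP dP /eqP; rewrite kap_row // => rc /eqP; rewrite kap_col // => cc'.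
move=> /eqP; rewrite kap_row // => rd /eqP; rewrite kap_col // => cd'.
move: (same_row2 rc) (same_column1 cc') (same_row2 rd) (same_column1 cd').
case: ca cb cc cd aP bP cP dP rc cc' rd cd' => [xa ya] [xb yb] [xc yc] [xd yd] /=.
move=> aP bP cP dP rc cc' rd cd' E1 E2 E3 E4; subst xc yc xd yd.
have rsym c d : same_row P c d -> same_row P d c.
  move=> H; have := same_row2 H; move: H; rewrite /same_row => /andP[_ H] E.
  by rewrite E eqxx /= minnC maxnC -E.
have csym c d : same_column P c d -> same_column P d c.
  move=> H; have := same_column1 H; move: H; rewrite /same_column => /andP[_ H] E.
  by rewrite E eqxx /= minnC maxnC -E.
rewrite neq_ltn => /orP[lx|lx]; rewrite neq_ltn => /orP[ly|ly].
- exists [` lower_corner aP]%fset, [` upper_corner bP]%fset; split.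
    by apply: rectangle_cells; rewrite // ?(rsym _ _ rc) ?(csym _ _ cd').
  by left; split=> //; rewrite fsetUC.
- exists [` lower_corner dP]%fset, [` upper_corner cP]%fset; split.
    by apply: rectangle_cells; rewrite // ?(rsym _ _ rc) ?(csym _ _ cc').
  by right; split=> //; rewrite fsetUC.
- exists [` lower_corner cP]%fset, [` upper_corner dP]%fset; split.
    by apply: rectangle_cells; rewrite // ?(rsym _ _ rd) ?(csym _ _ cd').
  by right; split=> //; rewrite fsetUC.
- exists [` lower_corner bP]%fset, [` upper_corner aP]%fset; split.
    by apply: rectangle_cells; rewrite // ?(rsym _ _ rd) ?(csym _ _ cc').
  by left; split=> //; rewrite fsetUC.
Qed.

Definition weight (F : {fset cell}) := \sum_(c <- F) rw (kap c) * cl (kap c).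

(** An inversion is the antidiagonal of a rectangle of corners, and the rooks at it
    can be switched. The weight grows as in the straightening of monomials. *)
Lemma switch_step k (F : rook_sets P k) : ~~ normal rw cl E (corners (val F)) ->
  exists F1 : rook_sets P k, [/\ switch F F1, switch F1 F &
    weight (val F) < weight (val F1)].
Proof.
have := valP F; rewrite in_rook_sets => /and3P[FP /eqP cF naF] nn.
have [a [b [c [d [/and4P[aS bS cE dE] [rc cc] [rd cd] [lr lc]]]]]] :=
  not_normal_swap gE (corners_sub FP) nn.
have [ca caF Ea] := in_corners _ _ aS; have [cb cbF Eb] := in_corners _ _ bS.
have [c1 c1P Ec] := kap_surj cE; have [d1 d1P Ed] := kap_surj dE.
move/fsubsetP: (FP) => FP'; have caP := FP' _ caF; have cbP := FP' _ cbF.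
subst a b c d; move/non_attackingP: naF => naF.
have nab : ca != cb by apply: contraTneq lr => ->; rewrite ltnn.
have inj e f : e \in val F -> f \in val F -> rw (kap e) = rw (kap f) \/ cl (kap e) = cl (kap f) -> e = f.
  move=> eF fF H; apply: naF => //.
  by rewrite -kap_row ?FP' // -kap_col ?FP' //; case: H => ->; [left|right].
have c1F : c1 \notin val F.
  apply/negP => H; have E1 := inj _ _ H caF (or_introl rc).
  by move: lc; rewrite -cc E1 ltnn.
have d1F : d1 \notin val F.
  apply/negP => H; have E1 := inj _ _ H caF (or_intror cd).
  by move: lr; rewrite -rd E1 ltnn.
have ncd : c1 != d1 by apply: contraTneq lr => E1; rewrite -rc E1 rd ltnn.
pose G := (val F `\` [fset ca; cb])%fset.
have inG e : (e \in G) = [&& e != ca, e != cb & e \in val F].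
  by rewrite !inE negb_or andbA.
have FE : val F = (ca |` (cb |` G))%fset.
  apply/fsetP => e; rewrite !in_fset1U inG; case: eqP => [->|_] //=.
  by case: eqP => [->|_] //=.
pose F1 := (c1 |` (d1 |` G))%fset.
have nG e : e \notin val F -> e \notin G by rewrite inG !negb_and => ->; rewrite !orbT.
have cbG : cb \notin G by rewrite inG eqxx andbF.
have caG : ca \notin (cb |` G)%fset by rewrite in_fset1U negb_or nab inG eqxx.
have d1G := nG _ d1F; have c1G : c1 \notin (d1 |` G)%fset.
  by rewrite in_fset1U negb_or ncd nG.
have F1P : (F1 `<=` P)%fset.
  apply/fsubsetP => e; rewrite !in_fset1U inG => /or3P[/eqP->//|/eqP->//|].
  by move=> /and3P[_ _ /FP'].
have cF1 : #|` F1| = k.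
  by rewrite !cardfsU1 c1G d1G; rewrite FE !cardfsU1 caG cbG in cF.
have sepG e : e \in G -> [/\ rw (kap e) <> rw (kap ca), rw (kap e) <> rw (kap cb),
    cl (kap e) <> cl (kap ca) & cl (kap e) <> cl (kap cb)].
  rewrite inG => /and3P[na nb eF]; split=> H.
  - by rewrite (inj e ca) ?eqxx // in na; left.
  - by rewrite (inj e cb) ?eqxx // in nb; left.
  - by rewrite (inj e ca) ?eqxx // in na; right.
  - by rewrite (inj e cb) ?eqxx // in nb; right.
have na1 : non_attacking P F1.
  rewrite corners_matching //; apply/matchingP => i j.
  move=> /in_corners[e eF <-] /in_corners[f fF <-].
  have in1 g : g \in F1 -> [\/ g = c1, g = d1 | g \in G].
    by rewrite !in_fset1U => /or3P[/eqP->|/eqP->|H]; [constructor 1|constructor 2|constructor 3].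
  case: (in1 _ eF) => [->|->|eG]; case: (in1 _ fF) => [->|->|fG] //.
  - by rewrite rc cc rd cd => -[H|H]; move: lr lc; rewrite H ltnn.
  - by rewrite rc cc; have [s1 _ _ s2] := sepG _ fG => -[] /esym.
  - by rewrite rc cc rd cd => -[H|H]; move: lr lc; rewrite H ltnn.
  - by rewrite rd cd; have [_ s1 s2 _] := sepG _ fG => -[] /esym.
  - by rewrite rc cc; have [s1 _ _ s2] := sepG _ eG => -[].
  - by rewrite rd cd; have [_ s1 s2 _] := sepG _ eG => -[].
  - move=> H; congr kap; move: eG fG; rewrite !inG => /and3P[_ _ eF'] /and3P[_ _ fF'].
    exact: inj.
have F1k : F1 \in rook_sets P k by rewrite in_rook_sets F1P cF1 eqxx.
exists [` F1k]%fset.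
have /same_row2 rc2 : same_row P c1 ca by rewrite -kap_row // rc.
have /same_column1 cc1 : same_column P c1 cb by rewrite -kap_col // cc.
have nx : ca.1 != cb.1.
  apply: contra c1F => /eqP Ex; suff -> : c1 = ca by [].
  by rewrite [c1]surjective_pairing cc1 rc2 -Ex -surjective_pairing.
have ny : ca.2 != cb.2.
  apply: contra c1F => /eqP Ey; suff -> : c1 = cb by [].
  by rewrite [c1]surjective_pairing cc1 rc2 Ey -surjective_pairing.
have [u [v [inn H]]] := opposite_pairs caP cbP c1P d1P rc cc rd cd nx ny.
have ex1 : exchange [fset ca; cb]%fset [fset c1; d1]%fset (val F) F1.
  apply/and3P; split; first by rewrite cardfs2 nab.
    by apply/fsubsetP => e; rewrite !inE => /orP[]/eqP ->.
  by rewrite -/G /F1 fsetUA fsetUC.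
have ex2 : exchange [fset c1; d1]%fset [fset ca; cb]%fset F1 (val F).
  apply/and3P; split; first by rewrite cardfs2 ncd.
    by apply/fsubsetP => e; rewrite !inE => /orP[]/eqP ->; rewrite eqxx ?orbT.
  have -> : (F1 `\` [fset c1; d1] = G)%fset.
    apply/fsetP => e; rewrite in_fsetD !in_fset1U in_fset1.
    case: eqP => [->|_] /=; first by rewrite (negbTE (nG _ c1F)).
    by case: eqP => [->|_] //=; rewrite (negbTE d1G).
  by rewrite fsetUC -fsetUA -FE.
split.
- apply/existsP; exists u; apply/existsP; exists v; rewrite inn /=.
  by case: H => -[<- <-]; rewrite ex1 ?orbT.
- apply/existsP; exists u; apply/existsP; exists v; rewrite inn /=.
  by case: H => -[<- <-]; rewrite ex2 ?orbT.
- rewrite /weight FE /= !big_fsetU1 //= rc cc rd cd !addnA ltn_add2r.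
  by move: lr lc; clear; nia.
Qed.

Lemma weight_le k (F : rook_sets P k) :
  weight (val F) <= k * ((\max_i rw i) * (\max_i cl i)).
Proof.
suff : weight (val F) <= #|` val F| * ((\max_i rw i) * (\max_i cl i)).
  by rewrite rook_set_card.
rewrite /weight; elim: (enum_fset (val F)) => [|c s IH].
  by rewrite big_nil.
rewrite big_cons /= mulSn; apply: leq_add; last exact: IH.
by apply: leq_mul; apply: leq_bigmax.
Qed.

Lemma switch_to_normal k (F : rook_sets P k) : exists F' : rook_sets P k,
  [/\ normal rw cl E (corners (val F')), connect (@switch P k) F F' &
      connect (@switch P k) F' F].
Proof.
set B := k * ((\max_i rw i) * (\max_i cl i)).
have [N] := ubnP (B - weight (val F)); elim: N F => // N IH F lt.
have [nF|/switch_step[F1 [s1 s2 w1]]] := boolP (normal rw cl E (corners (val F))).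
  by exists F; split=> //; apply: connect0.
have [|F' [nF' c1 c2]] := IH F1.
  by have := weight_le F1; rewrite -/B; move: lt w1; clear; lia.
exists F'; split=> //; first exact: connect_trans (connect1 s1) c1.
exact: connect_trans c2 (connect1 s2).
Qed.

Lemma corners_normal_in k (F : rook_sets P k) : normal rw cl E (corners (val F)) ->
  normal_in rw cl E [set i | 0 < mult (val F) i].
Proof.
move=> nF; have := valP F; rewrite in_rook_sets => /andP[FP _].
by rewrite /normal_in corners_sub.
Qed.

Lemma normal_rooks_unique k (F F' : rook_sets P k) :
  normal rw cl E (corners (val F)) -> normal rw cl E (corners (val F')) ->
  same_lines (val F) (val F') -> F = F'.
Proof.
move=> nF nF' [r c]; apply: val_inj.
have := valP F; have := valP F'; rewrite !in_rook_sets => /andP[FP' _] /andP[FP _].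
apply: corners_inj => //; apply/setP => i; rewrite !inE.
by rewrite (normal_unique rwcl_inj (corners_normal_in nF) (corners_normal_in nF') r c).
Qed.

(** Each placement can be switched, back and forth, to a normal one. Switches
    preserve the rows and columns of the rooks, which determine a normal
    placement. *)
Theorem card_rook_classes k : #|rook_classes P k| = #|normal_matchings rw cl E k|.
Proof.
pose N := [set F : rook_sets P k | normal rw cl E (corners (val F))].
have csym (F G : rook_sets P k) : connect (@switch P k) F G -> connect (@switch P k) G F.
  move=> /connect_same_lines[r c].
  have [F' [nF c1 c2]] := switch_to_normal F; have [G' [nG d1 d2]] := switch_to_normal G.
  suff EFG : F' = G' by apply: connect_trans d1 _; rewrite -EFG.
  apply: normal_rooks_unique => //.
  have [r1 k1] := connect_same_lines c1; have [r2 k2] := connect_same_lines d1.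
  by split=> l; [rewrite -r1 r r2|rewrite -k1 c k2].
rewrite /rook_classes (@card_equivalence_partition _ _ N); last 1 first.
- move=> F G; rewrite !inE => nF nG /connect_same_lines.
  exact: normal_rooks_unique.
- rewrite -(card_in_imset (f := fun F : rook_sets P k => corners (val F)) (D := N)).
    apply: eq_card => S; rewrite [RHS]inE; apply/imsetP/and3P.
      move=> [F]; rewrite inE => nF ->; have := valP F; rewrite in_rook_sets.
      move=> /and3P[FP /eqP cF naF]; rewrite card_corners // cF.
      by rewrite -corners_matching // /normal_in corners_sub.
    move=> [/eqP cS mS /andP[/subsetP SE nS]].
    pose F := [fset c in P | kap c \in S]%fset.
    have FP : (F `<=` P)%fset by apply/fsubsetP => c; rewrite !inE => /andP[].
    have EF : corners F = S.
      apply/setP => i; apply/in_corners/idP => [[c]|iS].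
        by rewrite !inE => /andP[_ cS'] <-.
      have [c cP Ec] := kap_surj (SE i iS); exists c => //.
      by rewrite !inE cP Ec.
    have Fk : F \in rook_sets P k.
      by rewrite in_rook_sets FP -card_corners // EF cS eqxx corners_matching // EF.
    by exists [` Fk]%fset; rewrite ?inE /= EF.
  move=> F G _ _ /= Ec; apply: val_inj; have := valP F; have := valP G.
  by rewrite !in_rook_sets => /andP[GP _] /andP[FP _]; apply: corners_inj.
- move=> F G H; split=> [|FG]; first exact: connect0.
  by apply/idP/idP => c; [exact: connect_trans (csym _ _ FG) c|exact: connect_trans FG c].
- move=> F; have [F' [nF c1 _]] := switch_to_normal F.
  by exists F'; rewrite ?inE.
Qed.

End Rooks.

(** * The switching rook polynomial counts normal matchings *)

Section SwitchingPolynomial.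
Local Open Scope ring_scope.

Lemma switching_rook_polynomial_coef (P : {fset cell}) k :
  (switching_rook_polynomial P)`_k = #|rook_classes P k|%:R.
Proof.
rewrite /switching_rook_polynomial coef_sum.
under eq_bigr => i _ do rewrite coefZ coefXn.
case: (ltnP k (rook_number P).+1) => lt.
  rewrite (bigD1 (Ordinal lt)) //= eqxx mulr1 big1 ?addr0 // => i ne.
  by rewrite eq_sym (negbTE (ne : (i : nat) != k)) mulr0.
rewrite big1 => [|i _]; last by rewrite gtn_eqF ?mulr0 // (leq_trans (ltn_ord i)).
have empty (F : rook_sets P k) : false.
  have := valP F; rewrite !inE /= fpowersetE => /andP[FP /andP[/eqP cF _]].
  have kP : (k < #|` P|.+1)%N by rewrite ltnS -cF fsubset_leq_card.
  have ne : rook_sets P k != fset0 by apply/fset0Pn; exists (val F); apply: valP.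
  have := @leq_bigmax_cond _ (fun j : 'I__ => rook_sets P j != fset0)
    (fun j : 'I_(#|` P|.+1) => j : nat) (Ordinal kP) ne.
  by rewrite -/(rook_number P) /= leqNgt lt.
rewrite (_ : rook_classes P k = set0) ?cards0 //.
by apply/setP => B; rewrite !inE; apply/negbTE/negP => /imsetP[F]; have := empty F.
Qed.

End SwitchingPolynomial.

Lemma vertices_gt0 (P : {fset cell}) : polyomino P -> 0 < #|{: vertices P}|.
Proof.
move=> [/fset0Pn[[x y] cP] _]; apply/card_gt0P.
by exists [` lower_corner cP]%fset.
Qed.

Theorem theorem3p4 (K : fieldType) (P : {fset cell}) (h : {poly int})
    (hP : polyomino P) (hsimple : simple P) (hrank : (#|` P| <= 11)%N) :
  hilbert_numerator K P h <-> h = switching_rook_polynomial P.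
Proof.
have sA := shift_simple hP hsimple.
have [c0 c0P low] := lowest_cell hP; have [N bN] := shift_bounded P.
have [cut cutP] := cuts_exist sA; have [cut' cut'P] := cuts_exist (simple_transpose sA).
have inj := labels_inj hP hsimple c0P cutP cut'P bN.
have gam := labels_gamma_free hP hsimple c0P low cutP cut'P bN.
have [kap [kE ks kr kc]] := cell_labelling hP hsimple c0P low cutP cut'P bN.
rewrite (hilbert_numeratorE K (vertices_gt0 hP) inj gam
  (labels_corner hP hsimple c0P cutP cut'P bN)
  (inner_labels hP hsimple c0P cutP cut'P bN)
  (labels_inner hP hsimple c0P cutP cut'P bN)).
split=> [H|-> k].
  apply/polyP => k; rewrite H switching_rook_polynomial_coef.
  by rewrite (card_rook_classes sA inj gam kE ks kr kc) /nmatchings natz.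
rewrite switching_rook_polynomial_coef.
by rewrite (card_rook_classes sA inj gam kE ks kr kc) /nmatchings natz.
Qed.
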